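(* Let $P(t)=\sum_{n\ge 0}\gamma_n t^n\in\mathbb{C}[[t]]$ be a tame power series with radius of convergence $r=r_P$, and suppose $P\in\mathbb{C}\{t\}_{r_P}$ and that $P$ is finite rationally accumulating of period $h_P$. Let $d_P:=\dim_{\mathbb{C}}\mathbb{C}\Omega(P)$, let $\Delta_P^{op}(s)$ be the opposite denominator polynomial and $\Delta_P^{top}(t)$ the top denominator polynomial of $P$. Then: (i) $\deg_t \Delta_P^{top}(t)=d_P=\deg_s\Delta_P^{op}(s)$, and $$t^{d_P}\Delta_P^{op}(t^{-1})=\Delta_P^{top}(t),\qquad\text{equivalently}\qquad s^{d_P}\Delta_P^{top}(s^{-1})=\Delta_P^{op}(s).$$ (ii) There is an equality of matrices $$\Big(\tfrac{P(t)}{T^{[e]}P(t)}\Big|_{t=x_i}\Big)_{[e]\in\mathbb{Z}/h_P\mathbb{Z},\ x_i\in V(\Delta_P^{top}(t))}=\Big(A^{[e]}(s)\big|_{s=x_i^{-1}}\Big)_{[e]\in\mathbb{Z}/h_P\mathbb{Z},\ x_i^{-1}\in V(\Delta_P^{op}(s))}.$$ In particular, the matrix $\Big(\tfrac{P(t)}{T^{[e]}P(t)}\big|_{t=x_i}\Big)_{[e],\,x_i}$ has maximal rank $d_P$.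
   Context: A power series $P(t)=\sum_{n\ge0}\gamma_nt^n\in\mathbb{C}[[t]]$ is tame if there are $u,v\in\mathbb{R}_{>0}$ with $u\le|\gamma_{n-1}/\gamma_n|\le v$ for all sufficiently large $n$. Then $\gamma_n\ne0$ for $n\ge N_P$ (some $N_P$), and for such $n$ set $X_n(P):=\sum_{k=0}^n\frac{\gamma_{n-k}}{\gamma_n}s^k$. Equip $\mathbb{C}[[s]]$ with the topology of coefficientwise convergence. $\Omega(P)\subset\mathbb{C}[[s]]$ is the set of accumulation points (limits of subsequences) of the sequence $\{X_n(P)\}_{n\ge N_P}$, and $\mathbb{C}\Omega(P)$ is the $\mathbb{C}$-linear span of $\Omega(P)$ in $\mathbb{C}[[s]]$. A subset $U\subset\mathbb{Z}_{\ge0}$ is rational if $\sum_{n\in U}t^n$ is a rational function; equivalently, there is $h\in\mathbb{Z}_{>0}$ with ($n+h\in U\iff n\in U$) for all large $n$; the least such $h$ is the period of $U$. For $h>0$ put $U^{[e]}:=\{n\in\mathbb{Z}_{\ge0}: n\equiv e \bmod h\}$. A finite rational partition of $\mathbb{Z}_{\ge0}$ is a finite family $\{U_a\}_{a\in\Omega}$ of rational subsets such that for some finite set $D$ one has the disjoint decomposition $\mathbb{Z}_{\ge0}\setminus D=\coprod_a(U_a\setminus D)$; its period is the least common multiple of the periods of the $U_a$. A sequence $\{X_n\}$ in a Hausdorff space is finite rationally accumulating if it accumulates to a finite set $\Omega$ such that, for a system of pairwise disjoint open neighbourhoods $\mathcal{V}_a$ of $a\in\Omega$, the sets $U_a:=\{n: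 X_n\in\mathcal{V}_a\}$ form a finite rational partition; its period is the period of this partition. The tame series $P$ is called finite rationally accumulating of period $h_P$ if the sequence $\{X_n(P)\}$ is (equivalently, the sequence $\{\gamma_{n-1}/\gamma_n\}$ is). In that case, write $h=h_P$ and, for $[e]\in\mathbb{Z}/h\mathbb{Z}$, $a_1^{[e]}:=\lim_{n\to\infty,\,n\equiv e\bmod h}\gamma_{n-1}/\gamma_n\in\mathbb{C}^\times$, $A_P:=\prod_{i=0}^{h-1}a_1^{[i]}$, and $$A^{[e]}(s):=\sum_{j=0}^{h-1}\Big(\prod_{i=1}^{j}a_1^{[e-i+1]}\Big)s^j .$$ The polynomial $\gcd(A^{[e]}(s),1-A_Ps^h)$, normalized to have constant term $1$, is independent of $[e]$ and is denoted $\delta(s)$. The opposite denominator polynomial is $\Delta_P^{op}(s):=(1-A_Ps^{h})/\delta(s)$. For $r>0$, $\mathbb{C}\{t\}_r$ is the set of $P(t)\in\mathbb{C}[[t]]$ which converge on the open disc $D(0,r)$ and are analytically continuable to a meromorphic function on an open neighbourhood of $\overline{D(0,r)}$. For $P\in\mathbb{C}\{t\}_r$, $\Delta_P(t)$ is the monic polynomial of lowest degree such that $\Delta_P(t)P(t)$ is holomorphic in a neighbourhood of the circle $|t|=r$; write $\Delta_P(t)=\prod_{i=1}^N(t-x_i)^{d_i}$ with distinct $x_i$, $|x_i|=r$, $d_i\ge1$. The top denominator polynomial is $\Delta_P^{top}(t):=\prod_{i:\,d_i=d_m}(t-x_i)$, where $d_m:=\max_i d_i$. For $[e]\in\mathbb{Z}/h_P\mathbb{Z}$,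 $T^{[e]}P(t):=\sum_{n\equiv e\bmod h_P}\gamma_nt^n$. The value $\frac{P(t)}{T^{[e]}P(t)}\big|_{t=x}$ at a pole $x$ is the value at $x$ of the meromorphic function $P/T^{[e]}P$, i.e. after cancelling the poles. $V(f)$ denotes the set of roots of the polynomial $f$. *)

(* Defs.v *)
From HB Require Import structures.
From mathcomp Require Import all_boot all_order all_algebra.
From mathcomp Require Import complex.
From mathcomp Require Import all_classical all_reals all_analysis.

Set Implicit Arguments.
Unset Strict Implicit.
Unset Printing Implicit Defensive.

Import Order.TTheory GRing.Theory Num.Theory.
Import numFieldNormedType.Exports.

Local Open Scope classical_set_scope.
Local Open Scope ring_scope.

(* The complex numbers R[i], packed as a numClosedFieldType: this is the form
   from which the norm topology of an abstract numClosedFieldType is inferred.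
   The norm `|z| of z : Cplx R is itself an element of Cplx R. *)
Definition Cplx (R : realType) : numClosedFieldType := R[i].

Definition inC (R : realType) (x : R) : Cplx R := real_complex R x.

(* C[[t]] is represented by coefficient sequences. *)
Definition fps (R : realType) : Type := nat -> Cplx R.

(* C[[s]] with the topology of coefficientwise convergence. *)
Definition fps_top (R : realType) : topologicalType :=
  prod_topology (fun _ : nat => Cplx R).

Section RationalAccumulation.

(* U is rational if its generating series, multiplied by some nonzero
   polynomial q, is a polynomial p. *)
Definition rational_subset (R : realType) (U : set nat) : Prop :=
  exists p q : {poly Cplx R}, q != 0 /\
    forall n, \sum_(k < n.+1) q`_k * \1_U (n - k)%N = p`_n.

Definition eventual_period (U : set nat) (h : nat) : Prop :=
  (0 < h)%N /\ \forall n \near \oo, U (n + h)%N <-> U n.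

Definition is_period (U : set nat) (h : nat) : Prop :=
  eventual_period U h /\ forall h', eventual_period U h' -> (h <= h')%N.

Definition finite_rational_partition (R : realType) (I : choiceType)
    (Om : set I) (U : I -> set nat) : Prop :=
  [/\ finite_set Om,
      forall a, Om a -> rational_subset R (U a) &
      exists D : set nat, [/\ finite_set D,
        ~` D = \bigcup_(a in Om) (U a `\` D) &
        trivIset Om (fun a => U a `\` D)]].

Definition partition_period (I : choiceType) (Om : set I) (U : I -> set nat)
    (h : nat) : Prop :=
  exists p : I -> nat, (forall a, Om a -> is_period (U a) (p a)) /\
    h = \big[lcmn/1%N]_(a \in Om) p a.

Definition accumulation_points (T : topologicalType) (X : nat -> T) : set T :=
  [set a | exists phi : nat -> nat,
     {homo phi : m n / (m < n)%N} /\ (X \o phi) @ \oo --> a].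

(* The period does not depend on the neighbourhoods V, since changing them
   changes each U a by a finite set. *)
Definition finite_rationally_accumulating (R : realType) (T : topologicalType)
    (X : nat -> T) (h : nat) : Prop :=
  let Om := accumulation_points X in
  exists V : T -> set T,
    let U := fun a => [set n | V a (X n)] in
    [/\ finite_set Om,
        forall a, Om a -> open_nbhs a (V a),
        trivIset Om V,
        finite_rational_partition R Om U &
        partition_period Om U h].

End RationalAccumulation.

Section TameSeries.
Variable R : realType.
Local Notation C := (Cplx R).
Implicit Types (gamma : fps R) (r : R) (h : nat) (e : int).

(* As x / 0 = 0, the lower bound forces gamma n != 0 for large n. *)
Definition tame gamma : Prop :=
  exists u v : R, [/\ 0 < u, 0 < v &
    \forall n \near \oo, inC u <= `|gamma n.-1 / gamma n| <= inC v].

(* For the finitely many n with gamma n = 0 this is the zero series. *)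
Definition Xseq gamma (n : nat) : fps R :=
  fun k => if (k <= n)%N then gamma (n - k)%N / gamma n else 0.

Definition Omega gamma : set (fps R) :=
  accumulation_points (T := fps_top R) (Xseq gamma).

Definition Cspan (S : set (fps R)) : set (fps R) :=
  [set f | exists (n : nat) (c : 'I_n -> C) (g : 'I_n -> fps R),
     (forall i, S (g i)) /\ forall k, f k = \sum_(i < n) c i * g i k].

Definition has_dim (V : set (fps R)) (d : nat) : Prop :=
  exists b : 'I_d -> fps R,
    [/\ forall i, V (b i),
        forall c : 'I_d -> C,
          (forall k, \sum_(i < d) c i * b i k = 0) -> forall i, c i = 0 &
        forall f, V f ->
          exists c : 'I_d -> C, forall k, f k = \sum_(i < d) c i * b i k].

Definition fra_series gamma h : Prop :=
  finite_rationally_accumulating R (T := fps_top R) (Xseq gamma) h.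

(* Classes mod h are given by arbitrary integer representatives e. *)
Definition a1 gamma h e : C :=
  lim ((gamma n.-1 / gamma n)
         @[n --> within [set n | (n%:Z = e %[mod h%:Z])%Z] \oo]).

Definition AP gamma h : C := \prod_(i < h) a1 gamma h i%:Z.

Definition Apoly gamma h e : {poly C} :=
  \poly_(j < h) \prod_(1 <= i < j.+1) a1 gamma h (e - i%:Z + 1).

Definition delta gamma h e : {poly C} :=
  let g := gcdp (Apoly gamma h e) (1 - AP gamma h *: 'X^h) in
  (g`_0)^-1 *: g.

Definition opp_denom gamma h e : {poly C} :=
  (1 - AP gamma h *: 'X^h) %/ delta gamma h e.

Definition Tpart gamma h e : fps R :=
  fun n => if (n%:Z == e %[mod h%:Z])%Z then gamma n else 0.

Definition radius_of_convergence gamma r : Prop :=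
  (forall z : C, `|z| < inC r -> cvg (series (fun n => gamma n * z ^+ n) @ \oo))
  /\
  (forall z : C, inC r < `|z| ->
     ~ cvg (series (fun n => gamma n * z ^+ n) @ \oo)).

(* f is the sum of a convergent power series near x; a function is holomorphic
   on an open set if it is so at each of its points. *)
Definition analytic_at (f : C -> C) (x : C) : Prop :=
  exists a : fps R, \forall z \near x,
    series (fun n => a n * (z - x) ^+ n) @ \oo --> f z.

(* Meromorphic functions are represented by total functions, whose values at
   isolated points (such as poles) are irrelevant. *)
Definition meromorphic_at (f : C -> C) (x : C) : Prop :=
  exists (k : nat) (g : C -> C), analytic_at g x /\
    \forall z \near x^', (z - x) ^+ k * f z = g z.

(* v is the value at x of the meromorphic function f, which thus has no pole
   at x after removal of singularities. *)
Definition meromorphic_value (f : C -> C) (x v : C) : Prop :=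
  exists g : C -> C, [/\ analytic_at g x,
    \forall z \near x^', f z = g z & g x = v].

(* The series gamma converges on D(0,r), and F is a meromorphic continuation
   of its sum to an open neighbourhood of the closed disc. *)
Definition meromorphic_continuation gamma r (F : C -> C) : Prop :=
  (forall z, `|z| < inC r -> series (fun n => gamma n * z ^+ n) @ \oo --> F z)
  /\
  exists U : set C, [/\ open U, [set z | `|z| <= inC r] `<=` U &
    forall x, U x -> meromorphic_at F x].

(* C{t}_r *)
Definition Ct_r r : set (fps R) :=
  [set gamma | exists F, meromorphic_continuation gamma r F].

Definition clears_circle gamma r (D : {poly C}) : Prop :=
  exists F, meromorphic_continuation gamma r F /\
    forall x, `|x| = inC r ->
      exists v, meromorphic_value (fun z => D.[z] * F z) x v.

Definition is_circle_denom gamma r (D : {poly C}) : Prop :=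
  [/\ D \is monic, clears_circle gamma r D &
      forall D' : {poly C}, D' \is monic -> clears_circle gamma r D' ->
        (size D <= size D')%N].

(* Delta_P; the default value 1 is not used when gamma is in C{t}_r. *)
Definition circle_denom gamma r : {poly C} :=
  xget 1 [set D | is_circle_denom gamma r D].

Definition distinct_roots (p : {poly C}) : seq C :=
  undup (sval (closed_field_poly_normal p)).

(* Delta_P^top *)
Definition top_denom gamma r : {poly C} :=
  let D := circle_denom gamma r in
  let dm := (\max_(x <- distinct_roots D) mup x D)%N in
  \prod_(x <- distinct_roots D | mup x D == dm) ('X - x%:P).

(* v is the value at x of P / T^{[e]} P, both series being continued
   meromorphically beyond the disc of radius r. *)
Definition quotient_value gamma r h e (x v : C) : Prop :=
  exists F G : C -> C,
    [/\ meromorphic_continuation gamma r F,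
        meromorphic_continuation (Tpart gamma h e) r G &
        meromorphic_value (fun z => F z / G z) x v].

End TameSeries.

(* Main.v *)
Require Import Defs.
From HB Require Import structures.
From mathcomp Require Import all_boot all_order all_algebra separable cyclic cyclotomic.
From mathcomp Require Import complex.
From mathcomp Require Import all_classical all_reals all_analysis.
From mathcomp Require Import ring lra zify.
Import Order.TTheory GRing.Theory Num.Theory.
Import numFieldNormedType.Exports.
Local Open Scope classical_set_scope.
Local Open Scope ring_scope.
Set Implicit Arguments.
Unset Strict Implicit.
Unset Printing Implicit Defensive.

(* Let D be the denominator of P on the circle |t| = r and m the maximal
   multiplicity of its roots.  The product D P has a holomorphic germ at every
   point of the closed disc; comparing the re-expansions of its power series at
   points of the open disc with these germs bounds its Taylor coefficients
   uniformly, and Cauchy's estimate then shows that D P converges beyond |t| = r.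
   Hence sum |gamma_n| x^n = O((r - x)^(-m)), by partial fractions.

   For |y| = r let R(y) and R_e(y) be the limits of (1 - t)^m P(ty) and
   (1 - t)^m T^[e]P(ty) as t tends to 1 from below; R(y) is nonzero exactly at the
   top poles, and R is the sum of the R_e.  Since gamma_(n-1) - a_1 gamma_n is
   o(gamma_n), the bound above gives y R_(e-1)(y) = a_1^[e] R_e(y), whence
   R(y) = A^[e](1/y) R_e(y), and R_e(y) can be nonzero only if y^h = A_P.
   As R_e(zeta y) = zeta^e R_e(y) for zeta^h = 1, all R_e are nonzero at every y
   with y^h = A_P.  So the top poles are the y with y^h = A_P and A^[e](1/y) <> 0,
   and P / T^[e]P takes the value A^[e](1/y) there; the rest is orthogonality of
   the characters of Z/h. *)

(** * The complex modulus and limits *)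

(** The hypothesis on the ratios controls gamma_(n-1) - a_1 gamma_n only in modulus. It can
    therefore be exploited only through the majorant sum |gamma_n| x^n, and a pole of order m bounds
    |P| but not this majorant. The bound on the majorant uses that D P converges absolutely on the
    circle |t| = r itself, which is why the extension beyond the circle has to come first. A
    meromorphic continuation is tied to the series only inside the disc, and its values at isolated
    points are arbitrary. So functions near a point y of the circle are compared along the radius of
    y, where every continuation equals the sum of the series; this also makes the values of P /
    T^[e]P independent of the chosen continuations. One exponent m serves all points of the circle
    and all classes: R and the R_e are then defined everywhere, possibly zero, and the linear
    relations between them need no case distinction on pole orders. T^[e]P is continued as a
    weighted mean of the rotations F(w^j t), with w a primitive h-th root of unity; its poles on the
    circle again have order at most m. *)

Section Modulus.
Variable R : realType.
Local Notation C := (Cplx R).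
Implicit Types (x y z : C).

(** The norm of [Cplx R] takes its values in [Cplx R]; this real-valued copy makes estimates
    accessible to real linear arithmetic. *)
Definition nrm (z : C) : R := Normc.normc z.

Lemma nrmE z : `|z| = inC (nrm z).
Proof. by []. Qed.

Lemma nrmM x y : nrm (x * y) = nrm x * nrm y.
Proof. exact: Normc.normcM. Qed.

Lemma nrmD x y : nrm (x + y) <= nrm x + nrm y.
Proof. exact: le_normcD. Qed.

Lemma nrmN x : nrm (- x) = nrm x.
Proof. exact: normcN. Qed.

Lemma nrmV x : nrm x^-1 = (nrm x)^-1.
Proof. exact: Normc.normcV. Qed.

Lemma nrm0 : nrm 0 = 0.
Proof. exact: Normc.normc0. Qed.

Lemma nrm1 : nrm 1 = 1.
Proof. exact: Normc.normc1. Qed.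

Lemma nrm_ge0 z : 0 <= nrm z.
Proof. by rewrite /nrm; case: z => a b /=; rewrite sqrtr_ge0. Qed.

Lemma nrm_eq0 z : (nrm z == 0) = (z == 0).
Proof.
by apply/eqP/eqP => [/Normc.eq0_normc|->]//; rewrite nrm0.
Qed.

Lemma nrm_gt0 z : (0 < nrm z) = (z != 0).
Proof. by rewrite lt0r nrm_eq0 nrm_ge0 andbT. Qed.

Lemma nrmX z n : nrm (z ^+ n) = nrm z ^+ n.
Proof. by elim: n => [|n IH]; rewrite ?expr0 ?nrm1// !exprS nrmM IH. Qed.

Lemma nrmB x y : nrm (x - y) = nrm (y - x).
Proof. by rewrite -nrmN opprB. Qed.

Lemma inCE (a : R) : inC a = Complex a 0 :> C.
Proof. by []. Qed.

Lemma inCB (a b : R) : inC (a - b) = inC a - inC b.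
Proof. exact: rmorphB. Qed.
Lemma inC1 : inC (1 : R) = 1. Proof. by []. Qed.

Lemma ltc_inC (a b : R) : (inC a < inC b) = (a < b).
Proof. exact: ltcR. Qed.

Lemma lec_inC (a b : R) : (inC a <= inC b) = (a <= b).
Proof. exact: lecR. Qed.

Lemma nrm_inC (a : R) : nrm (inC a) = `|a|.
Proof. by rewrite /nrm /= expr0n/= addr0 sqrtr_sqr. Qed.

Lemma nrm_nat (n : nat) : nrm n%:R = n%:R.
Proof. by rewrite -[X in nrm X](rmorph_nat (@real_complex R)) nrm_inC ger0_norm. Qed.

Lemma nrm_sum (I : Type) (s : seq I) (P : pred I) (F : I -> C) :
  nrm (\sum_(i <- s | P i) F i) <= \sum_(i <- s | P i) nrm (F i).
Proof.
elim/big_rec2: _ => [|i a b _ H]; first by rewrite nrm0.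
by apply: le_trans (nrmD _ _) _; rewrite lerD2l.
Qed.

Lemma nrmBB x y : nrm x - nrm y <= nrm (x - y).
Proof. by rewrite lerBlDr -{1}(subrK y x) nrmD. Qed.

Lemma nrm_ReIm (a b : R) : nrm (Complex a b) <= `|a| + `|b|.
Proof.
have -> : Complex a b = inC a + Complex 0 b :> C by rewrite inCE; congr Complex; rewrite /= ?addr0 ?add0r.
apply: le_trans (nrmD _ _) _; rewrite nrm_inC lerD2l.
by rewrite /nrm /= expr0n/= add0r sqrtr_sqr.
Qed.

Lemma Re_nrm (z : C) : `|complex.Re z| <= nrm z.
Proof.
rewrite /nrm; case: z => a b /=; rewrite -sqrtr_sqr ler_sqrt ?lerDl ?sqr_ge0//.
by rewrite addr_ge0 ?sqr_ge0.
Qed.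

Lemma Im_nrm (z : C) : `|complex.Im z| <= nrm z.
Proof.
rewrite /nrm; case: z => a b /=; rewrite -sqrtr_sqr ler_sqrt ?lerDr ?sqr_ge0//.
by rewrite addr_ge0 ?sqr_ge0.
Qed.

Lemma posC (e : C) : 0 < e -> exists2 d : R, 0 < d & e = inC d.
Proof.
move=> e0; exists (complex.Re e).
  by move: e0; rewrite ltcE /= => /andP[].
by move: e0; rewrite ltcE /= => /andP[/eqP]; case: e => a b /= ->.
Qed.

Lemma nbhsC (x : C) (A : set C) :
  nbhs x A <-> exists2 e : R, 0 < e & forall z, nrm (z - x) < e -> A z.
Proof.
split.
  move=> /nbhs_normP[e /= /posC[d d0 ->]] H; exists d => // z zx; apply: H => /=.
  by rewrite /ball_ /= nrmE ltc_inC nrmB.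
case=> e e0 H; apply/nbhs_normP; exists (inC e) => /=; first by rewrite ltc_inC.
by move=> z /=; rewrite nrmE ltc_inC nrmB; exact: H.
Qed.

Lemma dnbhsC (x : C) (A : set C) :
  x^' A <-> exists2 e : R, 0 < e & forall z, nrm (z - x) < e -> z != x -> A z.
Proof.
rewrite /dnbhs /within /= -/(nbhs x _).
split.
  by move=> /nbhsC[e e0 H]; exists e => // z ze zx; apply: H.
by case=> e e0 H; apply/nbhsC; exists e => // z ze zx; apply: H.
Qed.

Lemma cvgC (T : Type) (F : set_system T) {FF : Filter F} (u : T -> C) (l : C) :
  u @ F --> l <-> forall e : R, 0 < e -> \forall n \near F, nrm (u n - l) < e.
Proof.
split.
  move=> ul e e0; have /ul : nbhs l [set z | nrm (z - l) < e] by apply/nbhsC; exists e.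
  by [].
move=> H A /nbhsC[e e0 eA]; have := H _ e0; apply: filterS => n; exact: eA.
Qed.

Lemma cvgnC (u : nat -> C) (l : C) :
  u @ \oo --> l <-> forall e : R, 0 < e -> exists N, forall n, (N <= n)%N -> nrm (u n - l) < e.
Proof.
rewrite cvgC; split => H e e0.
  by have [N _ HN] := H _ e0; exists N.
by have [N HN] := H _ e0; exists N.
Qed.

Lemma cvg_atC (f : C -> C) x l : (f z @[z --> x] --> l) <->
  forall e : R, 0 < e -> exists2 d : R, 0 < d & forall z, nrm (z - x) < d -> nrm (f z - l) < e.
Proof.
split.
  move=> fl e e0; have /fl/nbhsC[d d0 H] : nbhs l [set z | nrm (z - l) < e] by apply/nbhsC; exists e.
  by exists d.
move=> H A /nbhsC[e e0 eA]; have [d d0 Hd] := H _ e0; apply/nbhsC; exists d => // z zd.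
by apply: eA; exact: Hd.
Qed.

Lemma cvg_nrm (T : Type) (F : set_system T) {FF : Filter F} (u : T -> C) (l : C) :
  u @ F --> l -> nrm (u t) @[t --> F] --> nrm l.
Proof.
move=> /cvgC H; apply/cvgrPdist_lt => e e0; have := H _ e0; apply: filterS => n.
apply: le_lt_trans; rewrite distrC ler_norml nrmBB andbT lerNl opprB nrmB nrmBB//.
Qed.

Lemma cvg_nrm_le (u : nat -> C) (l : C) (M : R) :
  u @ \oo --> l -> (forall n, nrm (u n) <= M) -> nrm l <= M.
Proof.
move=> /cvgnC ul H; rewrite leNgt; apply/negP => Ml.
have [|N /(_ N (leqnn _))] := ul (nrm l - M); first by rewrite subr_gt0.
rewrite nrmB => HN; have := nrmBB l (u N); have := H N; lra.
Qed.

Lemma cvgC0_le (u : nat -> C) (v : nat -> R) (l : C) :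
  v @ \oo --> (0 : R) -> (forall n, nrm (u n - l) <= v n) -> u @ \oo --> l.
Proof.
move=> /cvgrPdist_lt v0 H; apply/cvgC => e e0; have := v0 _ e0; apply: filterS => n.
rewrite sub0r normrN; apply: le_lt_trans; apply: le_trans (H _) (ler_norm _).
Qed.

Section CvgArithmetic.
Context {T : Type} {F : set_system T} {FF : Filter F}.
Implicit Types (u v : T -> C) (a b : C).

Lemma cvgCD u v a b : u @ F --> a -> v @ F --> b -> (fun t => u t + v t) @ F --> a + b.
Proof. by move=> h k; exact: (cvgD h k). Qed.

Lemma cvgCB u v a b : u @ F --> a -> v @ F --> b -> (fun t => u t - v t) @ F --> a - b.
Proof. by move=> h k; exact: (cvgB h k). Qed.

Lemma cvgCM u v a b : u @ F --> a -> v @ F --> b -> (fun t => u t * v t) @ F --> a * b.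
Proof. by move=> h k; exact: (cvgM h k). Qed.

Lemma cvgCV u a : a != 0 -> u @ F --> a -> (fun t => (u t)^-1) @ F --> a^-1.
Proof. by move=> a0 h; exact: (cvgV a0 h). Qed.

Lemma cvgC_cst a : (fun _ : T => a) @ F --> a.
Proof. exact: cvg_cst. Qed.

Lemma cvgCX u a n : u @ F --> a -> (fun t => u t ^+ n) @ F --> a ^+ n.
Proof.
move=> ua; elim: n => [|n IH]; first by under eq_fun do rewrite expr0; exact: cvgC_cst.
by under eq_fun do rewrite exprS; rewrite exprS; exact: cvgCM.
Qed.

End CvgArithmetic.

End Modulus.
Arguments nrm : simpl never.

(** * Absolutely convergent series *)

Section AbsoluteSeries.
Variable R : realType.
Local Notation C := (Cplx R).
Implicit Types (a b c : nat -> C) (x y z s : C) (M e : R).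

Lemma cvg_sumC (T : Type) (F : set_system T) {FF : Filter F} (N : nat)
    (f : 'I_N -> T -> C) (l : 'I_N -> C) :
  (forall i, f i @ F --> l i) ->
  (\sum_(i < N) f i t) @[t --> F] --> \sum_(i < N) l i.
Proof.
elim: N f l => [|N IH] f l H.
  under eq_fun do rewrite big_ord0.
  by rewrite big_ord0; exact: cvg_cst.
under eq_fun do rewrite big_ord_recr.
by rewrite big_ord_recr; apply: cvgCD; [apply: IH => i; exact: H|exact: H].
Qed.

Definition absbd a M := forall N, \sum_(n < N) nrm (a n) <= M.

Lemma absbd_real_cvg (u : nat -> R) M :
  (forall N, \sum_(n < N) `|u n| <= M) -> exists t : R, series u @ \oo --> t.
Proof.
move=> H.
have : cvgn (series u).
  apply: normed_cvg; apply: nondecreasing_is_cvgn.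
    by apply: nondecreasing_series => n _ _; exact: normr_ge0.
  exists M => _ [n _ <-]; change (\sum_(0 <= k < n) `|u k| <= M).
  by rewrite big_mkord.
by move=> cu; exists (limn (series u)).
Qed.

Lemma absbd_cvg a M : absbd a M -> exists s, series a @ \oo --> s.
Proof.
move=> H.
have [x Hx] : exists x : R, series (fun n => complex.Re (a n)) @ \oo --> x.
  apply: (@absbd_real_cvg _ M) => N; apply: le_trans (H N); apply: ler_sum => i _.
  exact: Re_nrm.
have [y Hy] : exists y : R, series (fun n => complex.Im (a n)) @ \oo --> y.
  apply: (@absbd_real_cvg _ M) => N; apply: le_trans (H N); apply: ler_sum => i _.
  exact: Im_nrm.
exists (Complex x y : C); apply/cvgC => e e0.
have e2 : 0 < e / 2 by lra.
move/cvgrPdist_lt: Hx => /(_ _ e2) Hx; move/cvgrPdist_lt: Hy => /(_ _ e2) Hy.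
have E n : series a n = Complex (series (fun n => complex.Re (a n)) n) (series (fun n => complex.Im (a n)) n) :> C.
  elim: n => [|n IH]; first by rewrite /series /= !big_geq.
  by rewrite !seriesSr IH; case: (a n).
near=> n; rewrite E.
apply: le_lt_trans (nrm_ReIm _ _) _.
rewrite distrC [X in _ + X]distrC (splitr e); apply: ltrD.
  by near: n.
by near: n.
Unshelve. all: by end_near. Qed.

Lemma series_cvg_nrm_le a M s : absbd a M -> series a @ \oo --> s -> nrm s <= M.
Proof.
move=> H /cvg_nrm_le; apply => n.
by rewrite /series /= big_mkord; apply: le_trans (H n); exact: nrm_sum.
Qed.

Lemma series_unique a s s' : series a @ \oo --> s -> series a @ \oo --> s' -> s = s'.
Proof. by move=> H H'; apply: cvg_unique H H'; exact: norm_hausdorff. Qed.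

Lemma series_term a s : series a @ \oo --> s -> exists M, forall n, nrm (a n) <= M.
Proof.
move=> /cvgnC /(_ 1 ltr01)[N HN].
(* Beyond [N] a term is a difference of two partial sums, each within 1 of [s]. *)
exists (2 + \sum_(i < N.+1) nrm (a i)) => n.
have S0 k (P : pred 'I_k) : 0 <= \sum_(i < k | P i) nrm (a i) by apply: sumr_ge0 => i _; exact: nrm_ge0.
have [nN|nN] := ltnP n N.+1.
  by rewrite (bigD1 (Ordinal nN)) //= addrCA lerDl; apply: addr_ge0 => //; exact: S0.
rewrite -lerBlDr; apply: le_trans (_ : nrm (a n) <= _); first by rewrite gerBl.
have -> : a n = (series a n.+1 - s) - (series a n - s) by rewrite seriesSr; ring.
apply: le_trans (nrmD _ _) _; rewrite nrmN.
have := HN n (ltnW nN); have := HN n.+1 (leqW (ltnW nN)); lra.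
Qed.

(** Padding with zeros lets sums over nested rectangles be subtracted term by term. *)
Lemma mass_box (V : nmodType) (f : nat -> nat -> V) (N0 K0 N K : nat) : (N0 <= N)%N -> (K0 <= K)%N ->
  \sum_(n < N) \sum_(k < K) (if (n < N0)%N && (k < K0)%N then f n k else 0)
   = \sum_(n < N0) \sum_(k < K0) f n k.
Proof.
move=> hN hK.
rewrite (big_ord_widen _ (fun n => \sum_(k < K0) f n k) hN) [RHS]big_mkcond /=.
apply: eq_bigr => i _; case: ifP => iN /=; last by rewrite big1.
by rewrite (big_ord_widen _ (fun k => f i k) hK) [RHS]big_mkcond.
Qed.

(** Fubini: a large enough square carries all but [e / 4] of the total mass of the moduli, so both
    iterated sums are close to the sum over that square. *)
Lemma double_series (u : nat -> nat -> C) M (rs cs : nat -> C) :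
  (forall N K, \sum_(n < N) \sum_(k < K) nrm (u n k) <= M) ->
  (forall n, series (u n) @ \oo --> rs n) ->
  (forall k, series (u ^~ k) @ \oo --> cs k) ->
  exists s, series rs @ \oo --> s /\ series cs @ \oo --> s.
Proof.
move=> H Hr Hc.
pose m N K := \sum_(n < N) \sum_(k < K) nrm (u n k).
have mb N0 K0 N K (hN : (N0 <= N)%N) (hK : (K0 <= K)%N) : m N0 K0 =
    \sum_(n < N) \sum_(k < K) (if (n < N0)%N && (k < K0)%N then nrm (u n k) else 0).
  exact/esym/(mass_box (fun n k => nrm (u n k)) hN hK).
have rows N : (\sum_(n < N) \sum_(k < K) u n k) @[K --> \oo] --> \sum_(n < N) rs n.
  apply: cvg_sumC => i; have := Hr i.
  by rewrite seriesEord.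
have cols K : (\sum_(n < N) \sum_(k < K) u n k) @[N --> \oo] --> \sum_(k < K) cs k.
  under eq_fun do rewrite exchange_big.
  by apply: cvg_sumC => i; have := Hc i; rewrite seriesEord.
have [s Hs] : exists s, series rs @ \oo --> s.
  apply: (@absbd_cvg _ M) => N.
  have K1 : (\sum_(i < N) inC (nrm (\sum_(k < K) u i k))) @[K --> \oo] --> \sum_(i < N) inC (nrm (rs i)).
    apply: cvg_sumC.
    move=> i; have := Hr i; rewrite seriesEord => Hri.
    have /cvgrPdist_lt Hn : nrm (\sum_(k < n) u i k) @[n --> \oo] --> nrm (rs i) by exact: cvg_nrm Hri.
    apply/cvgC => e e0; have := Hn _ e0; apply: filterS => n.
    by rewrite -inCB nrm_inC distrC.
  have -> : \sum_(n < N) nrm (rs n) = nrm (\sum_(i < N) inC (nrm (rs i))).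
    rewrite (_ : \sum_(i < N) inC (nrm (rs i)) = inC (\sum_(i < N) (nrm (rs i)))); last by rewrite /inC raddf_sum.
    by rewrite nrm_inC ger0_norm //; apply: sumr_ge0 => i _; exact: nrm_ge0.
  apply: (cvg_nrm_le K1) => K; apply: le_trans (H N K).
  apply: le_trans (nrm_sum _ _ _) _; apply: ler_sum => i _; rewrite nrm_inC ger0_norm ?nrm_ge0//.
  exact: nrm_sum.
exists s; split => //; apply/cvgnC => e e0.
(* The total mass. A square of size [N0] reaches it up to [e / 4], so what lies outside this square
   is negligible. *)
pose S := sup [set m n n | n in setT].
have hS : has_sup [set m n n | n in setT].
  by split; [exists (m 0 0)%N; exists 0%N | exists M => _ [n _ <-]; exact: H].
have mS N K : m N K <= S.
  apply: le_trans (_ : m (maxn N K) (maxn N K) <= _); last first.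
    by apply: sup_ubound; [case: hS|exists (maxn N K)].
  rewrite (mb _ _ _ _ (leq_maxl N K) (leq_maxr N K)).
  apply: ler_sum => i _; apply: ler_sum => j _; case: ifP => // _; exact: nrm_ge0.
have e4 : 0 < e / 4 by lra.
have [_ [N0 _ <-] HN0] := sup_adherent e4 hS.
pose B := \sum_(n < N0) \sum_(k < N0) u n k.
have box N K : (N0 <= N)%N -> (N0 <= K)%N -> nrm (\sum_(n < N) \sum_(k < K) u n k - B) <= e / 4.
  move=> hN hK.
  have -> : B = \sum_(n < N) \sum_(k < K) (if (n < N0)%N && (k < N0)%N then u n k else 0).
    exact/esym/(mass_box u hN hK).
  rewrite -sumrB; apply: le_trans (nrm_sum _ _ _) _.
  apply: le_trans (_ : m N K - m N0 N0 <= _); last by have := mS N K; rewrite -/S in HN0; lra.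
  rewrite (mb _ _ _ _ hN hK) /m -sumrB; apply: ler_sum => i _.
  rewrite -!sumrB; apply: le_trans (nrm_sum _ _ _) _; apply: ler_sum => j _.
  by case: ifP => _; rewrite ?subrr ?nrm0 ?subr0.
(* The estimate for rectangles survives the limit in one direction, here for rows and next for
   columns. *)
have boxr N : (N0 <= N)%N -> nrm (\sum_(n < N) rs n - B) <= e / 4.
  move=> hN; have := rows N; rewrite -(cvg_shiftn N0) => rN.
  apply: (@cvg_nrm_le _ (fun K => \sum_(n < N) \sum_(k < K + N0) u n k - B)).
    by apply: cvgCB; [exact: rN|exact: cvgC_cst].
  by move=> K; apply: box => //; rewrite leq_addl.
have boxc K : (N0 <= K)%N -> nrm (\sum_(k < K) cs k - B) <= e / 4.
  move=> hN; have := cols K; rewrite -(cvg_shiftn N0) => rN.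
  apply: (@cvg_nrm_le _ (fun N => \sum_(n < N + N0) \sum_(k < K) u n k - B)).
    by apply: cvgCB; [exact: rN|exact: cvgC_cst].
  by move=> N; apply: box => //; rewrite leq_addl.
move/cvgnC: Hs => /(_ _ e4)[N1 HN1]; exists N0 => K hK.
have := HN1 (maxn N0 N1) (leq_maxr _ _); have := boxr (maxn N0 N1) (leq_maxl _ _).
have := boxc K hK; rewrite /series /= !big_mkord.
set X := \sum_(k < K) _; set Y := \sum_(n < maxn _ _) _ => h1 h2 h3.
have -> : X - s = (X - B) - (Y - B) + (Y - s) by ring.
apply: le_lt_trans (nrmD _ _) _; have := nrmD (X - B) (- (Y - B)); rewrite nrmN; lra.
Qed.

End AbsoluteSeries.

(** * Power series *)

Section PowerSeries.
Variable R : realType.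
Local Notation C := (Cplx R).
Implicit Types (a b c : nat -> C) (x y z s t v w : C) (rho : R).

(** Stands for a radius of convergence at least [rho]: by Abel's lemma ([gbd_abs]) the series
    converges absolutely on the open disc, and convergence at one point gives the bound back
    ([psum_gbd]). *)
Definition gbd a rho := exists M : R, forall n, nrm (a n) * rho ^+ n <= M.

Definition psum a z s := series (fun n => a n * z ^+ n) @ \oo --> s.

Lemma geo_sum_le (q : R) N : 0 <= q -> q < 1 -> \sum_(i < N) q ^+ i <= (1 - q)^-1.
Proof.
move=> q0 q1; have q1' : 0 < 1 - q by rewrite subr_gt0.
rewrite -[leLHS](mulKf (lt0r_neq0 q1')) ler_piMr ?invr_ge0 ?(ltW q1')//.
by rewrite -opprB mulNr -subrX1 opprB gerBl exprn_ge0.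
Qed.

Lemma gbd_le a rho rho' : 0 <= rho' -> rho' <= rho -> gbd a rho -> gbd a rho'.
Proof.
move=> r0 rr [M HM]; exists M => n; apply: le_trans (HM n).
by apply: ler_wpM2l; [exact: nrm_ge0|apply: lerXn2r => //; rewrite nnegrE ?(le_trans r0)].
Qed.

Lemma gbd_abs a rho (x : R) : gbd a rho -> 0 <= x -> x < rho ->
  exists M : R, forall N, \sum_(n < N) nrm (a n) * x ^+ n <= M.
Proof.
move=> [M HM] x0 xr; have r0 : 0 < rho by exact: le_lt_trans xr.
have M0 : 0 <= M by apply: le_trans (HM 0%N); rewrite expr0 mulr1 nrm_ge0.
exists (M * (1 - x / rho)^-1) => N.
apply: le_trans (_ : \sum_(n < N) M * (x / rho) ^+ n <= _).
  apply: ler_sum => n _; rewrite expr_div_n mulrA ler_pdivlMr ?exprn_gt0//.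
  by rewrite mulrAC; apply: ler_wpM2r; rewrite ?exprn_ge0.
rewrite -mulr_sumr; apply: ler_wpM2l => //; apply: geo_sum_le.
  by rewrite divr_ge0// ltW.
by rewrite ltr_pdivrMr ?mul1r.
Qed.

Lemma gbd_absbd a rho z : gbd a rho -> nrm z < rho ->
  exists M : R, absbd (fun n => a n * z ^+ n) M.
Proof.
move=> ar zr; have [M HM] := gbd_abs ar (nrm_ge0 z) zr.
exists M => N; apply: le_trans (HM N); apply: ler_sum => n _.
by rewrite nrmM nrmX.
Qed.

Lemma gbd_psum a rho z : gbd a rho -> nrm z < rho -> exists s, psum a z s.
Proof. by move=> ar zr; have [M /absbd_cvg] := gbd_absbd ar zr. Qed.

Lemma psum_gbd a z s : psum a z s -> gbd a (nrm z).
Proof.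
by move=> /series_term[M HM]; exists M => n; rewrite -nrmX -nrmM.
Qed.

Lemma psum_unique a z s t : psum a z s -> psum a z t -> s = t.
Proof. exact: series_unique. Qed.

Lemma series_eventually (f : nat -> C) (s : C) N :
  (forall n, (N <= n)%N -> series f n = s) -> series f @ \oo --> s.
Proof.
move=> H; apply/cvgnC => e e0; exists N => n Nn; by rewrite H// subrr nrm0.
Qed.

Lemma psum_scale a z s t : psum a z s -> psum (fun n => t * a n) z (t * s).
Proof.
rewrite /psum => H.
have -> : (series (fun n => t * a n * z ^+ n)) = (fun n => t * series (fun n => a n * z ^+ n) n).
  by apply/funext => n; rewrite /series /= big_distrr /=; apply: eq_bigr => i _; rewrite mulrA.
by apply: cvgCM; [exact: cvgC_cst|exact: H].
Qed.

Lemma psum_add a b z s t : psum a z s -> psum b z t -> psum (fun n => a n + b n) z (s + t).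
Proof.
rewrite /psum => H K.
have -> : (series (fun n => (a n + b n) * z ^+ n)) =
   (fun n => series (fun n => a n * z ^+ n) n + series (fun n => b n * z ^+ n) n).
  by apply/funext => n; rewrite /series /= -big_split /=; apply: eq_bigr => i _; rewrite mulrDl.
by apply: cvgCD; [exact: H|exact: K].
Qed.

Lemma eq_psum a b z s : a =1 b -> psum a z s -> psum b z s.
Proof. by move=> /funext ->. Qed.

Lemma psum_opp a z s : psum a z s -> psum (fun n => - a n) z (- s).
Proof.
move=> /(@psum_scale _ _ _ (-1)); rewrite mulN1r; apply: eq_psum => n.
by rewrite mulN1r.
Qed.

Lemma psum_sum (I : Type) (r : seq I) (A : I -> nat -> C) (S : I -> C) z :
  (forall i, psum (A i) z (S i)) ->
  psum (fun n => \sum_(i <- r) A i n) z (\sum_(i <- r) S i).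
Proof.
move=> H; elim: r => [|i r IH].
  rewrite big_nil; apply: (@series_eventually _ _ 0%N) => n _.
  by rewrite /series /= big1 // => i _; rewrite big_nil mul0r.
rewrite big_cons; have := psum_add (H i) IH.
by apply: eq_psum => n; rewrite big_cons.
Qed.

Lemma psum_shift a z s n : z != 0 -> psum a z s ->
  psum (fun k => a (k + n)%N) z ((s - \sum_(k < n) a k * z ^+ k) / z ^+ n).
Proof.
move=> z0 H; rewrite /psum.
have zn : z ^+ n != 0 by rewrite expf_neq0.
have -> : series (fun k => a (k + n)%N * z ^+ k) =
    (fun N => (series (fun k => a k * z ^+ k) (N + n)%N - \sum_(k < n) a k * z ^+ k) / z ^+ n).
  apply/funext => N; apply: (mulIf zn); rewrite divfK//.
  have -> : \sum_(k < n) a k * z ^+ k = series (fun k => a k * z ^+ k) n.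
    by rewrite /series /= big_mkord.
  rewrite series_addn addrAC subrr add0r /series /=.
  rewrite -[X in index_iota X (N + n)]add0n big_addn addnK big_distrl /=.
  by apply: eq_bigr => i _; rewrite exprD mulrA.
move: H; rewrite /psum -(cvg_shiftn n) => H; by apply: cvgCM; [apply: cvgCB; [exact: H|exact: cvgC_cst]|exact: cvgC_cst].
Qed.

Lemma psum0 a : psum a 0 (a 0%N).
Proof.
apply: (@series_eventually _ _ 1%N) => n n0; rewrite /series /= big_mkord.
case: n n0 => // n _; rewrite big_ord_recl /= expr0 mulr1 big1 ?addr0// => i _.
by rewrite /bump /= exprS mul0r mulr0.
Qed.

(** The difference is [z] times the shifted series, which is bounded on the disc of half the
    radius. *)
Lemma psum_lip a rho : 0 < rho -> gbd a rho ->
  exists M : R, forall z s, nrm z <= rho / 2 -> psum a z s -> nrm (s - a 0%N) <= M * nrm z.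
Proof.
move=> r0 ar.
have br : gbd (fun k => a (k + 1)%N) rho.
  case: ar => M HM; exists (M / rho) => n; rewrite ler_pdivlMr// -mulrA -exprSr -[n.+1]addn1; exact: HM.
have h0 : 0 <= rho / 2 by lra.
have h1 : rho / 2 < rho by lra.
have [M HM] := gbd_abs br h0 h1.
exists M => z s zr; have [->|z0] := eqVneq z 0.
  by move=> H; rewrite (psum_unique H (@psum0 a)) subrr nrm0 mulr0.
move=> /(psum_shift (n := 1%N) z0); rewrite big_ord1 expr0 mulr1 expr1 => H.
rewrite -ler_pdivrMr ?nrm_gt0// -nrmV -nrmM.
apply: series_cvg_nrm_le H => N; apply: le_trans (HM N).
apply: ler_sum => i _; rewrite nrmM nrmX; apply: ler_wpM2l; first exact: nrm_ge0.
by apply: lerXn2r => //; rewrite nnegrE ?nrm_ge0//; lra.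
Qed.

(** Identity theorem. At a first nonzero coefficient [a n] the series shifted by [n] would vanish
    off 0 and yet be close to [a n] near 0. *)
Lemma psum_eq0 a rho : 0 < rho -> gbd a rho ->
  (forall z, z != 0 -> nrm z < rho -> psum a z 0) -> forall n, a n = 0.
Proof.
move=> r0 ar H n.
have [m] := ubnP n; elim: m n => // m IH n; rewrite ltnS => nm.
have an k : (k < n)%N -> a k = 0 by move=> kn; apply: IH; exact: leq_trans nm.
pose b k := a (k + n)%N.
have br : gbd b rho.
  case: ar => M HM; exists (M / rho ^+ n) => k.
  by rewrite ler_pdivlMr ?exprn_gt0// -mulrA -exprD; exact: HM.
have Hb z : z != 0 -> nrm z < rho -> psum b z 0.
  move=> z0 zr; have := psum_shift (n := n) z0 (H z z0 zr).
  by rewrite big1 ?subr0 ?mul0r// => i _; rewrite an// mul0r.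
have [M HM] := psum_lip r0 br.
apply/eqP; rewrite -nrm_eq0; apply/eqP/le_anti; rewrite nrm_ge0 andbT.
rewrite leNgt; apply/negP => n0.
have M0 : 0 < M.
  pose z := inC (rho / 2); have zE : nrm z = rho / 2 by rewrite nrm_inC ger0_norm; lra.
  have z0 : z != 0 by rewrite -nrm_gt0 zE; lra.
  have := HM z 0 _ (Hb z z0 _); rewrite zE sub0r nrmN /b add0n => /(_ (lexx _)) h.
  have : 0 < M * (rho / 2) by apply: lt_le_trans (h _); [exact: n0|lra].
  by rewrite pmulr_lgt0//; lra.
(* This radius makes [M * d] at most half of [nrm (a n)], against the bound [nrm (a n) <= M * d]
   from [psum_lip]. *)
pose d := Num.min (rho / 2) (nrm (a n) / M / 2).
have d0 : 0 < d by rewrite lt_min !divr_gt0.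
have zE : nrm (inC d) = d by rewrite nrm_inC gtr0_norm.
have z0 : inC d != 0 by rewrite -nrm_gt0 zE.
have d1 : d <= rho / 2 by rewrite ge_min lexx.
have := HM (inC d) 0 _ (Hb (inC d) z0 _); rewrite zE sub0r nrmN /b add0n => h.
have {h} : nrm (a n) <= M * d by apply: h; lra.
have : d <= nrm (a n) / M / 2 by rewrite ge_min lexx orbT.
rewrite -(ler_pM2l M0) => h1 h2; have := le_trans h2 h1.
have -> : M * (nrm (a n) / M / 2) = nrm (a n) / 2 by field; exact: lt0r_neq0.
lra.
Qed.

End PowerSeries.

(** * Products, re-expansions and inverses of power series *)

Section PowerSeriesOps.
Variable R : realType.
Local Notation C := (Cplx R).
Implicit Types (a b c : nat -> C) (x y z s t v w : C) (rho : R).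

Lemma sum_widen_le (f : nat -> R) N K : (forall n, 0 <= f n) -> (N <= K)%N ->
  \sum_(n < N) f n <= \sum_(n < K) f n.
Proof.
move=> f0 NK; rewrite (big_ord_widen _ f NK) big_mkcond /=; apply: ler_sum => i _.
by case: ifP.
Qed.

Lemma trunc_sum (V : nmodType) (g : nat -> V) n K : (n < K)%N ->
  \sum_(k < K) (if (k <= n)%N then g k else 0) = \sum_(k < n.+1) g k.
Proof. by move=> nK; rewrite (big_ord_widen _ g nK) [RHS]big_mkcond. Qed.

Lemma trunc_sum_le (g : nat -> R) n K : (forall k, 0 <= g k) ->
  \sum_(k < K) (if (k <= n)%N then g k else 0) <= \sum_(k < n.+1) g k.
Proof.
move=> g0; rewrite -(@trunc_sum _ g n (K + n.+1)) ?ltn_addl//.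
apply: (@sum_widen_le (fun k => if (k <= n)%N then g k else 0)); last exact: leq_addr.
by move=> k; case: ifP.
Qed.

Lemma shift_sum (V : nmodType) (f : nat -> V) k N :
  \sum_(n < k + N) (if (k <= n)%N then f (n - k)%N else 0) = \sum_(n < N) f n.
Proof.
rewrite big_split_ord /= big1 ?add0r => [|i _]; last by rewrite leqNgt ltn_ord.
by apply: eq_bigr => i _; rewrite leq_addr addKn.
Qed.

Lemma shift_series (f : nat -> C) k s : series f @ \oo --> s ->
  series (fun n => if (k <= n)%N then f (n - k)%N else 0) @ \oo --> s.
Proof.
move=> H; rewrite -(cvg_shiftn k).
apply: cvg_trans H; apply: near_eq_cvg; apply: nearW => N.
by rewrite /series /= !big_mkord addnC shift_sum.
Qed.

Definition conv a b n := \sum_(k < n.+1) a k * b (n - k)%N.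

(** Fubini for the triangular array [u]: its rows add up to the terms of the Cauchy product, its
    columns are the series of [b] shifted by [k] and multiplied by the [k]-th term of [a]. *)
Lemma psum_conv a b rho z s t : gbd a rho -> gbd b rho -> nrm z < rho ->
  psum a z s -> psum b z t -> psum (conv a b) z (s * t).
Proof.
move=> ar br zr As Bt.
have [Ma HMa] := gbd_abs ar (nrm_ge0 z) zr.
have [Mb HMb] := gbd_abs br (nrm_ge0 z) zr.
pose u n k : C := if (k <= n)%N then a k * z ^+ k * (b (n - k)%N * z ^+ (n - k)) else 0.
have Mb0 : 0 <= Mb by have := HMb 0%N; rewrite big_ord0.
have [|n|k|S [SR SC]] := @double_series _ u (Ma * Mb) (fun n => conv a b n * z ^+ n) (fun k => a k * z ^+ k * t).
- move=> N K; rewrite exchange_big /=.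
  apply: le_trans (_ : \sum_(k < K) (nrm (a k) * nrm z ^+ k) * Mb <= _); last first.
    by rewrite -mulr_suml; apply: ler_wpM2r.
  apply: ler_sum => k _.
  pose f m := nrm (a k) * nrm z ^+ k * (nrm (b m) * nrm z ^+ m).
  have f0 m : 0 <= f m by rewrite /f !mulr_ge0 ?exprn_ge0 ?nrm_ge0.
  apply: le_trans (_ : \sum_(n < k + N) (if (k <= n)%N then f (n - k)%N else 0) <= _).
    apply: le_trans (_ : \sum_(n < N) (if (k <= n)%N then f (n - k)%N else 0) <= _).
      apply: ler_sum => n _; rewrite /u; case: ifP; rewrite ?nrm0//.
      by rewrite /f !nrmM !nrmX.
    apply: (@sum_widen_le (fun n => if (k <= n)%N then f (n - k)%N else 0)); last exact: leq_addl.
    by move=> n; case: ifP.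
  rewrite shift_sum /f -mulr_sumr; apply: ler_wpM2l; last exact: HMb.
  by rewrite mulr_ge0 ?exprn_ge0 ?nrm_ge0.
- apply: (@series_eventually _ _ _ n.+1) => m nm; rewrite /series /= big_mkord.
  rewrite (@trunc_sum _ (fun k => a k * z ^+ k * (b (n - k)%N * z ^+ (n - k))))//.
  rewrite /conv mulr_suml; apply: eq_bigr => k _.
  rewrite mulrACA -exprD subnKC//; exact: (ltn_ord k).
- apply: (@shift_series (fun m => a k * z ^+ k * (b m * z ^+ m))).
  rewrite (_ : series _ = fun n => a k * z ^+ k * series (fun m => b m * z ^+ m) n).
    by apply: cvgCM; [exact: cvgC_cst|exact: Bt].
  by apply/funext => n; rewrite /series /= big_distrr.
suff -> : s * t = S by exact: SR.
apply: (series_unique _ SC).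
rewrite (_ : series _ = fun n => series (fun m => a m * z ^+ m) n * t).
  by apply: cvgCM; [exact: As|exact: cvgC_cst].
by apply/funext => n; rewrite /series /= big_distrl.
Qed.

(** The [k]-th Taylor coefficient at [w] of the sum of [a]; meaningful for [w] inside the disc of
    convergence, by [tay_cvg]. *)
Definition tay a w k : C :=
  lim (series (fun n => ('C(n + k, k)%:R * a (n + k)%N) * w ^+ n) @ \oo).

Lemma binom_term_le (X Y : R) m k : 0 <= X -> 0 <= Y ->
  'C(m + k, k)%:R * X ^+ m * Y ^+ k <= (X + Y) ^+ (m + k).
Proof.
move=> X0 Y0; have kn : (k < (m + k).+1)%N by rewrite ltnS leq_addl.
rewrite exprDn (bigD1 (Ordinal kn)) //= addnK -[X in _ <= X + _]mulr_natl mulrA lerDl.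
by apply: sumr_ge0 => i _; rewrite mulrn_wge0// mulr_ge0// exprn_ge0.
Qed.

(** The binomial coefficient times X^n d^k is a single term in the expansion of (X + d)^(n + k), so
    the absolute series at [X + d] bounds the sum for all [k] at once. *)
Lemma tay_mass a rho (X d : R) : gbd a rho -> 0 <= X -> 0 < d -> X + d < rho ->
  exists M : R, forall k N,
   (\sum_(n < N) 'C(n + k, k)%:R * nrm (a (n + k)%N) * X ^+ n) * d ^+ k <= M.
Proof.
move=> ar X0 d0 Xd; have Xd0 : 0 <= X + d by lra.
have [M HM] := gbd_abs ar Xd0 Xd; exists M => k N.
apply: le_trans (HM (N + k)%N).
pose f n := nrm (a n) * (X + d) ^+ n.
apply: le_trans (_ : \sum_(n < N) f (n + k)%N <= _).
  rewrite mulr_suml; apply: ler_sum => n _.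
  rewrite mulrAC [_ * nrm _]mulrC mulrAC -mulrA mulrAC /f -mulrA.
  apply: ler_wpM2l; first exact: nrm_ge0.
  by rewrite mulrC mulrA; apply: binom_term_le => //; exact: ltW.
rewrite addnC big_split_ord /=.
rewrite (eq_bigr (fun n : 'I_N => f (k + n)%N)); last by move=> n _; rewrite addnC.
by rewrite lerDr; apply: sumr_ge0 => i _; rewrite mulr_ge0 ?exprn_ge0 ?nrm_ge0.
Qed.

Lemma tay_cvg a rho w k : gbd a rho -> nrm w < rho ->
  psum (fun n => 'C(n + k, k)%:R * a (n + k)%N) w (tay a w k).
Proof.
move=> ar wr.
have d0 : 0 < (rho - nrm w) / 2 by lra.
have d1 : nrm w + (rho - nrm w) / 2 < rho by lra.
have [M HM] := tay_mass ar (nrm_ge0 w) d0 d1.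
have [|s Hs] := @absbd_cvg _ (fun n => ('C(n + k, k)%:R * a (n + k)%N) * w ^+ n) (M / ((rho - nrm w) / 2) ^+ k).
  move=> N; rewrite ler_pdivlMr ?exprn_gt0//; apply: le_trans (HM k N).
  rewrite !mulr_suml; apply: ler_sum => n _; rewrite !nrmM nrmX.
  by rewrite -[X in nrm X](rmorph_nat (@real_complex R)) nrm_inC ger0_norm ?ler0n.
by rewrite /psum /tay (cvg_lim _ Hs)//; exact: norm_hausdorff.
Qed.

Lemma tay_bound a rho (X d : R) : gbd a rho -> 0 <= X -> 0 < d -> X + d < rho ->
  exists M : R, forall w, nrm w <= X -> forall k, nrm (tay a w k) * d ^+ k <= M.
Proof.
move=> ar X0 d0 Xd; have [M HM] := tay_mass ar X0 d0 Xd; exists M => w wX k.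
have wr : nrm w < rho by lra.
rewrite -ler_pdivlMr ?exprn_gt0//; apply: (series_cvg_nrm_le _ (tay_cvg ar wr)) => N.
rewrite ler_pdivlMr ?exprn_gt0//; apply: le_trans (HM k N).
rewrite !mulr_suml; apply: ler_sum => n _; rewrite !nrmM nrmX.
rewrite nrm_nat.
apply: ler_wpM2r; first by rewrite exprn_ge0// ltW.
apply: ler_wpM2l; first by rewrite mulr_ge0 ?nrm_ge0.
by apply: lerXn2r => //; rewrite nnegrE ?nrm_ge0.
Qed.

(** Expand each (w + v)^n by the binomial theorem and exchange the two summations. *)
Lemma psum_tay a rho w v s : gbd a rho -> nrm w + nrm v < rho ->
  psum a (w + v) s -> psum (tay a w) v s.
Proof.
move=> ar wv Hs.
have [M HM] := gbd_abs ar (addr_ge0 (nrm_ge0 w) (nrm_ge0 v)) wv.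
pose u n k : C := if (k <= n)%N then 'C(n, k)%:R * a n * w ^+ (n - k) * v ^+ k else 0.
have wr : nrm w < rho by have := nrm_ge0 v; lra.
have [|n|k|S [SR SC]] := @double_series _ u M (fun n => a n * (w + v) ^+ n) (fun k => tay a w k * v ^+ k).
- move=> N K; apply: le_trans (HM N); apply: ler_sum => n _.
  pose g k := nrm (a n) * (nrm w ^+ (n - k) * nrm v ^+ k *+ 'C(n, k)).
  have g0 k : 0 <= g k by rewrite /g mulr_ge0 ?nrm_ge0// mulrn_wge0// mulr_ge0 ?exprn_ge0 ?nrm_ge0.
  apply: le_trans (_ : \sum_(k < K) (if (k <= n)%N then g k else 0) <= _).
    apply: ler_sum => k _; rewrite /u; case: ifP; rewrite ?nrm0// => _.
    rewrite !nrmM !nrmX nrm_nat.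
    by rewrite /g -[X in _ <= _ * X]mulr_natl le_eqVlt; apply/orP; left; apply/eqP; rewrite !mulrA; congr (_ * _ * _); rewrite mulrC.
  by apply: le_trans (trunc_sum_le _ _ g0) _; rewrite /g -mulr_sumr -exprDn.
- apply: (@series_eventually _ _ _ n.+1) => m nm; rewrite /series /= big_mkord.
  rewrite (@trunc_sum _ (fun k => 'C(n, k)%:R * a n * w ^+ (n - k) * v ^+ k))//.
  rewrite exprDn mulr_sumr; apply: eq_bigr => k _; rewrite -[X in _ = _ * X]mulr_natl !mulrA; congr (_ * _ * _); exact: mulrC.
- rewrite /u.
  have := @shift_series (fun m => 'C(m + k, k)%:R * a (m + k)%N * w ^+ m * v ^+ k) k (tay a w k * v ^+ k) _.
  rewrite (_ : (fun n => if (k <= n)%N then _ else 0) = (fun n => if (k <= n)%N then 'C(n, k)%:R * a n * w ^+ (n - k) * v ^+ k else 0)).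
    apply.
    rewrite (_ : series _ = fun n => series (fun m => 'C(m + k, k)%:R * a (m + k)%N * w ^+ m) n * v ^+ k).
      by apply: cvgCM; [exact: (tay_cvg ar wr)|exact: cvgC_cst].
    by apply/funext => n; rewrite /series /= big_distrl.
  by apply/funext => n; case: ifP => // kn; rewrite subnK.
suff -> : s = S by exact: SC.
exact: (series_unique Hs SR).
Qed.

(** The list of the first [n] coefficients of 1/a: the next coefficient uses all earlier ones, so
    the recursion carries the whole list. *)
Fixpoint inv_seq a n : seq C := if n is m.+1 then
    let l := inv_seq a m in
    rcons l ((a 0%N)^-1 * ((m == 0%N)%:R - \sum_(k < m) a k.+1 * l`_(m - k.+1)))
  else [::].

Definition inv_coef a n := (inv_seq a n.+1)`_n.

Lemma size_inv_seq a n : size (inv_seq a n) = n.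
Proof. by elim: n => //= n IH; rewrite size_rcons IH. Qed.

Lemma nth_inv_seq a n k : (k < n)%N -> (inv_seq a n)`_k = inv_coef a k.
Proof.
elim: n => // n IH; rewrite ltnS leq_eqVlt => /orP[/eqP->//|kn].
by rewrite /= nth_rcons size_inv_seq kn IH.
Qed.

Lemma inv_coefE a n : inv_coef a n =
  (a 0%N)^-1 * ((n == 0%N)%:R - \sum_(k < n) a k.+1 * inv_coef a (n - k.+1)%N).
Proof.
rewrite {1}/inv_coef /= nth_rcons size_inv_seq ltnn eqxx; congr (_ * (_ - _)).
apply: eq_bigr => k _; rewrite nth_inv_seq//.
by rewrite ltn_subrL /=; case: n k => // -[].
Qed.

Lemma conv_inv a n : a 0%N != 0 -> conv a (inv_coef a) n = (n == 0%N)%:R.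
Proof.
move=> a0; rewrite /conv big_ord_recl subn0 /= [X in _ * X + _]inv_coefE mulVKf//.
by rewrite /bump /= subrK.
Qed.

Lemma gbd_inv a rho : 0 < rho -> gbd a rho -> a 0%N != 0 ->
  exists2 rho', 0 < rho' & gbd (inv_coef a) rho'.
Proof.
move=> r0 [M HM] a0.
have M0 : 0 <= M by apply: le_trans (HM 0%N); rewrite expr0 mulr1 nrm_ge0.
pose A := (nrm (a 0%N))^-1; have A0 : 0 < A by rewrite invr_gt0 nrm_gt0.
(* The recursion at order n + 1 produces the sum of K (K + 1)^k over k <= n, which is (K + 1)^(n +
   1) - 1; the inverse thus loses at most the factor [K + 1] in the radius. *)
pose K := M * A; have K0 : 0 <= K by rewrite mulr_ge0// ltW.
have K1 : 0 < K + 1 by lra.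
exists (rho / (K + 1)); first by rewrite divr_gt0.
exists A => n; rewrite expr_div_n mulrA ler_pdivrMr ?exprn_gt0//.
have [m] := ubnP n; elim: m n => // m IH n; rewrite ltnS => nm.
rewrite inv_coefE nrmM nrmV -/A -[leLHS]mulrA; apply: ler_wpM2l; first exact: ltW.
case: n nm => [|n] nm; first by rewrite big_ord0 subr0 nrm1 !expr0 mulr1.
rewrite sub0r nrmN.
apply: le_trans (_ : (\sum_(k < n.+1) nrm (a k.+1) * nrm (inv_coef a (n.+1 - k.+1)%N)) * rho ^+ n.+1 <= _).
  apply: ler_wpM2r; first by rewrite exprn_ge0// ltW.
  by apply: le_trans (nrm_sum _ _ _) _; apply: ler_sum => k _; rewrite nrmM.
rewrite mulr_suml.
apply: le_trans (_ : \sum_(k < n.+1) K * (K + 1) ^+ k <= _).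
  rewrite [leRHS](reindex_inj rev_ord_inj) /=; apply: ler_sum => k _.
  have kn : (k < n.+1)%N := ltn_ord k.
  have -> : rho ^+ n.+1 = rho ^+ k.+1 * rho ^+ (n.+1 - k.+1) by rewrite -exprD subnKC.
  rewrite mulrACA -[leRHS]mulrA; have r1 := ltW r0.
  apply: ler_pM; [by rewrite mulr_ge0 ?nrm_ge0 ?exprn_ge0|by rewrite mulr_ge0 ?nrm_ge0 ?exprn_ge0|exact: HM|].
  by apply: IH; apply: leq_trans nm; rewrite subSS ltnS leq_subr.
rewrite -mulr_sumr; have := subrX1 (K + 1) n.+1; rewrite addrK => <-.
by rewrite gerBl.
Qed.

End PowerSeriesOps.

(** * Analytic and meromorphic germs *)

Section Analytic.
Variable R : realType.
Local Notation C := (Cplx R).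
Implicit Types (a b c : nat -> C) (x y z s t v w : C) (rho : R) (f g : C -> C).

Lemma nearWC x (A : set C) : (forall z, A z) -> \forall z \near x, A z.
Proof. by move=> H; apply/nbhsC; exists 1. Qed.

(** Convergence at the single point [x + e / 2] already bounds the coefficients at radius [e / 2],
    hence the halved radius. *)
Lemma analyticP f x : analytic_at f x <-> exists a rho,
  [/\ 0 < rho, gbd a rho & forall z, nrm (z - x) < rho -> psum a (z - x) (f z)].
Proof.
split=> [[a /nbhsC[e e0 H]]|[a [rho [r0 _ H]]]]; last by exists a; apply/nbhsC; exists rho.
exists a, (e / 2); split; first by lra.
  have E : nrm (inC (e / 2)) = e / 2 by rewrite nrm_inC ger0_norm //; lra.
  rewrite -E; apply: (@psum_gbd _ _ _ (f (x + inC (e / 2)))).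
  by have := H (x + inC (e / 2)); rewrite addrC addKr E; apply; lra.
by move=> z zx; apply: H; lra.
Qed.

Lemma analytic_eqfun f g x : f =1 g -> analytic_at f x -> analytic_at g x.
Proof. by move=> /funext ->. Qed.

Lemma psum_const t z : psum (fun n => (n == 0%N)%:R * t) z t.
Proof.
apply: (@series_eventually _ _ _ 1%N) => n n0; rewrite /series /= big_mkord.
case: n n0 => // n _; rewrite big_ord_recl /= expr0 mulr1 mul1r big1 ?addr0// => i _.
by rewrite /= !mul0r.
Qed.

Lemma analytic_cst t x : analytic_at (fun _ => t) x.
Proof. by exists (fun n => (n == 0%N)%:R * t); apply/nbhsC; exists 1 => // z _; exact: psum_const. Qed.

Lemma psum_lin t z : psum (fun n => (n == 0%N)%:R * t + (n == 1%N)%:R) z (z + t).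
Proof.
apply: (@series_eventually _ _ _ 2%N) => n n0; rewrite /series /= big_mkord.
case: n n0 => // -[//|n] _; rewrite !big_ord_recl /= expr0 /bump /= expr1 !(mulr1,mul1r,mul0r,add0r,addr0) big1 ?addr0 1?addrC// => i _.
by rewrite /= !(mul0r,addr0).
Qed.

Lemma analytic_id x : analytic_at id x.
Proof.
exists (fun n => (n == 0%N)%:R * x + (n == 1%N)%:R); apply/nbhsC; exists 1 => // z _.
by have := @psum_lin x (z - x); rewrite subrK.
Qed.

Lemma analytic_add f g x : analytic_at f x -> analytic_at g x -> analytic_at (fun z => f z + g z) x.
Proof.
move=> [a H] [b K]; exists (fun n => a n + b n); move: H K; apply: filterS2 => z.
exact: psum_add.
Qed.

Lemma gbd_minl a (ra rb : R) : 0 < ra -> 0 < rb -> gbd a ra -> gbd a (Num.min ra rb).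
Proof. by move=> ra0 rb0; apply: gbd_le; rewrite ?ge_min ?lexx// le_min !ltW. Qed.

Lemma gbd_minr a (ra rb : R) : 0 < ra -> 0 < rb -> gbd a rb -> gbd a (Num.min ra rb).
Proof. by move=> ra0 rb0; apply: gbd_le; rewrite ?ge_min ?lexx ?orbT// le_min !ltW. Qed.

Lemma ltr_min_lt (u ra rb : R) : u < ra -> u < rb -> u < Num.min ra rb.
Proof. by move=> ua ub; rewrite lt_min ua. Qed.

Lemma analytic_mul f g x : analytic_at f x -> analytic_at g x -> analytic_at (fun z => f z * g z) x.
Proof.
move=> /analyticP[a [ra [ra0 ga H]]] /analyticP[b [rb [rb0 gb K]]].
exists (conv a b); apply/nbhsC; exists (Num.min ra rb); first by rewrite lt_min ra0.
move=> z; rewrite lt_min => /andP[za zb].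
exact: (psum_conv (gbd_minl ra0 rb0 ga) (gbd_minr ra0 rb0 gb) (ltr_min_lt za zb) (H _ za) (K _ zb)).
Qed.

Lemma analytic_inv f x : f x != 0 -> analytic_at f x -> analytic_at (fun z => (f z)^-1) x.
Proof.
move=> fx /analyticP[a [ra [ra0 ga H]]].
have a0 : a 0%N != 0.
  suff -> : a 0%N = f x by [].
  apply: (psum_unique (@psum0 _ a)); rewrite -(subrr x); apply: H; by rewrite subrr nrm0.
have [rb rb0 gb] := gbd_inv ra0 ga a0.
exists (inv_coef a); apply/nbhsC; exists (Num.min ra rb); first by rewrite lt_min ra0.
move=> z; rewrite lt_min => /andP[za zb].
have [t Ht] := gbd_psum gb zb.
suff -> : (f z)^-1 = t by exact: Ht.
have P1 : psum (conv a (inv_coef a)) (z - x) (f z * t).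
  exact: (psum_conv (gbd_minl ra0 rb0 ga) (gbd_minr ra0 rb0 gb) (ltr_min_lt za zb) (H _ za) Ht).
have P2 : psum (conv a (inv_coef a)) (z - x) 1.
  apply: eq_psum (@psum_const 1 (z - x)) => n; by rewrite conv_inv// mulr1.
have E := psum_unique P1 P2.
have fz : f z != 0 by apply/eqP => fz; move: E; rewrite fz mul0r => /eqP; rewrite eq_sym oner_eq0.
by rewrite -[t](mulKf fz) E mulr1.
Qed.

Lemma analytic_near f x : analytic_at f x -> \forall y \near x, analytic_at f y.
Proof.
move=> /analyticP[a [ra [ra0 ga H]]]; apply/nbhsC; exists ra => // y yx.
exists (tay a (y - x)); apply/nbhsC; exists (ra - nrm (y - x)); first by rewrite subr_gt0.
move=> z zy.
have hz : nrm (y - x) + nrm (z - y) < ra by lra.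
apply: (psum_tay ga hz).
have -> : y - x + (z - y) = z - x by ring.
apply: H; have := nrmD (y - x) (z - y).
have -> : y - x + (z - y) = z - x by ring.
lra.
Qed.

Lemma psum_analytic a rho f x : gbd a rho -> (forall z, nrm z < rho -> psum a z (f z)) ->
  nrm x < rho -> analytic_at f x.
Proof.
move=> ga H xr; exists (tay a x); apply/nbhsC; exists (rho - nrm x); first by rewrite subr_gt0.
move=> z za; apply: (psum_tay ga); first lra.
rewrite addrC subrK; apply: H; have := nrmD (z - x) x; rewrite subrK; lra.
Qed.

Lemma analytic_cvg f x : analytic_at f x -> f z @[z --> x] --> f x.
Proof.
move=> /analyticP[a [ra [ra0 ga H]]].
have [M HM] := psum_lip ra0 ga.
have a0 : a 0%N = f x.
  apply: (psum_unique (@psum0 _ a)); rewrite -(subrr x); apply: H; by rewrite subrr nrm0.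
apply/cvg_atC => e e0.
have M1 : 0 < `|M| + 1 by rewrite ltr_wpDl.
exists (Num.min (ra / 2) (e / (`|M| + 1))).
  by rewrite lt_min !divr_gt0.
move=> z; rewrite lt_min => /andP[z1 z2].
have := HM (z - x) (f z) (ltW z1); rewrite a0 => h.
apply: le_lt_trans (h _) _.
  by apply: H; lra.
rewrite ltr_pdivlMr// in z2; apply: le_lt_trans z2; rewrite mulrC.
apply: ler_wpM2l; first exact: nrm_ge0.
by have := ler_norm M; lra.
Qed.

Lemma analytic_rot f w x : nrm w = 1 -> analytic_at f (w * x) -> analytic_at (fun z => f (w * z)) x.
Proof.
move=> w1 /analyticP[a [ra [ra0 ga H]]].
exists (fun n => a n * w ^+ n); apply/nbhsC; exists ra => // z zx.
have := H (w * z); rewrite -mulrBr nrmM w1 mul1r => /(_ zx); rewrite /psum.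
suff -> : (fun n => a n * w ^+ n * (z - x) ^+ n) = (fun n => a n * (w * (z - x)) ^+ n) by [].
by apply/funext => n; rewrite exprMn mulrA.
Qed.

Lemma analytic_horner (p : {poly C}) x : analytic_at (fun z => p.[z]) x.
Proof.
elim/poly_ind: p => [|p c IH].
  by apply: (@analytic_eqfun (fun=> 0)); [move=> z; rewrite horner0|exact: analytic_cst].
apply: (@analytic_eqfun (fun z => p.[z] * z + c)).
  by move=> z; rewrite !hornerE.
apply: (@analytic_add (fun z => p.[z] * z) (fun=> c)); last exact: analytic_cst.
by apply: (@analytic_mul (fun z => p.[z]) id); [exact: IH|exact: analytic_id].
Qed.

Lemma analytic_factor f x : analytic_at f x -> f x = 0 ->
  exists2 g, analytic_at g x & \forall z \near x, f z = (z - x) * g z.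
Proof.
move=> /analyticP[a [ra [ra0 ga H]]] fx.
have a0 : a 0%N = 0.
  rewrite -fx; apply: (psum_unique (@psum0 _ a)); rewrite -(subrr x); apply: H; by rewrite subrr nrm0.
exists (fun z => if z == x then a 1%N else f z / (z - x)).
  exists (fun k => a (k + 1)%N); apply/nbhsC; exists ra; first exact: ra0.
  move=> z zx; case: (eqVneq z x) => [->|nzx].
    rewrite subrr; exact: (@psum0 _ (fun k => a (k + 1)%N)).
  have d0 : z - x != 0 by rewrite subr_eq0.
  have := psum_shift (n := 1%N) d0 (H z zx).
  rewrite big_ord1 a0 mul0r subr0 expr1; exact.
apply: nearWC => z; have [->|nzx] := eqVneq z x; first by rewrite subrr mul0r.
by rewrite mulrC divfK// subr_eq0.
Qed.

Lemma dnbhs_near x (A : set C) : (\forall z \near x, A z) -> x^' A.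
Proof. by apply: filterS. Qed.

Lemma meromorphic_analytic f x : analytic_at f x -> meromorphic_at f x.
Proof. by move=> fx; exists 0%N, f; split => //; apply: dnbhs_near; apply: nearWC => z; rewrite expr0 mul1r. Qed.

Lemma meromorphic_add f g x : meromorphic_at f x -> meromorphic_at g x ->
  meromorphic_at (fun z => f z + g z) x.
Proof.
move=> [k [F [Fx H]]] [l [G [Gx K]]].
exists (k + l)%N, (fun z => (z - x) ^+ l * F z + (z - x) ^+ k * G z); split.
  have an n : analytic_at (fun z => (z - x) ^+ n) x.
    apply: (@analytic_eqfun (fun z => (('X - x%:P) ^+ n).[z])); last exact: analytic_horner.
    by move=> z; rewrite !hornerE.
  by apply: analytic_add; apply: analytic_mul; [exact: an|exact: Fx|exact: an|exact: Gx].
move: H K; apply: filterS2 => z <- <-; rewrite exprD; ring.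
Qed.

Lemma meromorphic_scale f t x : meromorphic_at f x -> meromorphic_at (fun z => t * f z) x.
Proof.
move=> [k [F [Fx H]]]; exists k, (fun z => t * F z); split.
  by apply: analytic_mul; [exact: analytic_cst|exact: Fx].
by move: H; apply: filterS => z <-; rewrite mulrCA.
Qed.

Lemma meromorphic_rot f w x : nrm w = 1 -> meromorphic_at f (w * x) ->
  meromorphic_at (fun z => f (w * z)) x.
Proof.
move=> w1 [k [F [Fx /dnbhsC[e e0 H]]]]; exists k, (fun z => w ^- k * F (w * z)).
have w0 : w != 0 by rewrite -nrm_gt0 w1.
split.
  by apply: analytic_mul; [exact: analytic_cst|exact: (analytic_rot w1 Fx)].
apply/dnbhsC; exists e; first exact: e0.
move=> z ze zx.
rewrite -H ?(inj_eq (mulfI w0))//; last by rewrite -mulrBr nrmM w1 mul1r.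
by rewrite -mulrBr exprMn -mulrA mulKf// expf_neq0.
Qed.

Lemma meromorphic_sum (I : Type) (r : seq I) (F : I -> C -> C) x :
  (forall i, meromorphic_at (F i) x) -> meromorphic_at (fun z => \sum_(i <- r) F i z) x.
Proof.
move=> H; elim: r => [|i r IH].
  apply: meromorphic_analytic; apply: (@analytic_eqfun (fun=> 0)); last exact: analytic_cst.
  by move=> z; rewrite big_nil.
rewrite (_ : (fun z => _) = (fun z => F i z + \sum_(j <- r) F j z)); last first.
  by apply/funext => z; rewrite big_cons.
exact: meromorphic_add.
Qed.

End Analytic.

(** * Cauchy estimates and extension beyond the circle *)

Lemma root_unity_sum (K : fieldType) h (x : K) : x ^+ h = 1 -> \sum_(j < h) x ^+ j = if x == 1 then h%:R else 0.
Proof.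
move=> xh; case: eqVneq => [->|x1].
  by under eq_bigr do rewrite expr1n; rewrite sumr_const card_ord.
by have /esym/eqP := subrX1 x h; rewrite xh subrr mulf_eq0 subr_eq0 (negPf x1) => /eqP.
Qed.

(** * Compactness of closed discs *)

Section Compactness.
Variable R : realType.
Local Notation C := (Cplx R).
Implicit Types (x y z : C).

Lemma compact_rect (c : R) :
  compact [set z : C | `|complex.Re z| <= c /\ `|complex.Im z| <= c].
Proof.
pose phi (p : R * R) : C := Complex p.1 p.2.
have -> : [set z : C | `|complex.Re z| <= c /\ `|complex.Im z| <= c] =
    phi @` (`[- c, c] `*` `[- c, c]).
  apply/seteqP; split.
    move=> z /= [h1 h2]; exists (complex.Re z, complex.Im z); last by case: z {h1 h2}.
    by split; rewrite /= in_itv /= -ler_norml.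
  by move=> z [[p q] [/=]]; rewrite !in_itv /= -!ler_norml => h1 h2 <-.
apply: continuous_compact; last by apply: compact_setX; exact: segment_compact.
apply: continuous_subspaceT => -[p q].
apply/(@cvgC _ _ _ _) => e e0.
have e2 : 0 < e / 2 by lra.
have /cvgrPdist_lt /(_ _ e2) H1 : fst (pq : R * R) @[pq --> (p, q)] --> p by exact: cvg_fst.
have /cvgrPdist_lt /(_ _ e2) H2 : snd (pq : R * R) @[pq --> (p, q)] --> q by exact: cvg_snd.
move: H1 H2; apply: filterS2 => -[p' q'] /= h1 h2.
apply: le_lt_trans (nrm_ReIm _ _) _.
by rewrite distrC [X in _ + X]distrC (splitr e); apply: ltrD.
Qed.

(** Compactness in filter form, so that one statement serves two purposes: a uniform bound (real
    numbers tending to infinity) and a common denominator (polynomials ordered by divisibility). *)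
Lemma disc_cover (I : Type) (F : set_system I) (P : I -> C -> Prop) (c : R) :
  Filter F ->
  (forall x, nrm x <= c -> exists e : R, 0 < e /\ exists2 S, F S &
     forall y i, nrm (y - x) < e -> S i -> P i y) ->
  exists2 S, F S & forall i y, S i -> nrm y <= c -> P i y.
Proof.
move=> FF H.
have /compact_near_coveringP := @compact_rect c.
move=> /(_ I F (fun i y => nrm y <= c -> P i y) FF) K.
have {K} : \forall i \near F, [set z : C | `|complex.Re z| <= c /\ `|complex.Im z| <= c] `<=` (fun y => nrm y <= c -> P i y).
  apply: K => x _; have [xc|xc] := leP (nrm x) c.
    have [e [e0 [S FS HS]]] := H x xc.
    exists ([set y | nrm (y - x) < e], S) => /=.
      by split => //; apply/nbhsC; exists e.
    by move=> [y i] /= [h1 h2] _; exact: HS.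
  (* A point of the square outside the disc has a neighbourhood disjoint from the disc, where
     nothing is required. *)
  exists ([set y | nrm (y - x) < nrm x - c], setT) => /=.
    by split; [apply/nbhsC; exists (nrm x - c) => //; lra|exact: filterT].
  move=> [y i] /= [h1 _] yc; have := nrmBB x y; rewrite nrmB; lra.
move=> K; exists [set i | [set z : C | `|complex.Re z| <= c /\ `|complex.Im z| <= c] `<=` (fun y => nrm y <= c -> P i y)]; first exact: K.
move=> i y /= Si yc; apply: (Si y) => //; split.
  exact: le_trans (Re_nrm _) yc.
exact: le_trans (Im_nrm _) yc.
Qed.

End Compactness.

(** * Cauchy's estimate by averaging over roots of unity *)

Section Cauchy.
Variable R : realType.
Local Notation C := (Cplx R).
Implicit Types (a b c : nat -> C) (x y z s t v w : C) (rho : R).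

Lemma prim_root_ex N : (0 < N)%N -> exists w : C, N.-primitive_root w.
Proof.
move=> N0; have [rs Hrs] := closed_field_poly_normal ('X^N - 1 : {poly C}).
have sz : size ('X^N - 1 : {poly C}) = N.+1 by rewrite size_XnsubC.
have lc : lead_coef ('X^N - 1 : {poly C}) = 1 by apply/eqP; exact: (monicXnsubC (1 : C) N0).
rewrite lc scale1r in Hrs.
have Hall : all N.-unity_root rs.
  apply/allP => z zr; have : root ('X^N - 1 : {poly C}) z by rewrite Hrs root_prod_XsubC.
  by rewrite unity_rootE rootE !hornerE subr_eq0.
have Hsz : size rs = N.
  by have := sz; rewrite Hrs size_prod_XsubC => -[].
have Hu : uniq rs.
  rewrite -separable_prod_XsubC -Hrs separable_Xn_sub_1 //.
  by rewrite pnatr_eq0 -lt0n.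
have := has_prim_root N0 Hall Hu; rewrite Hsz leqnn => /(_ isT)/hasP[w _ Hw].
by exists w.
Qed.

Lemma prim_root_nrm N w : N.-primitive_root w -> nrm w = 1.
Proof.
move=> Hw; have := prim_expr_order Hw => /(congr1 (@nrm R)); rewrite nrmX nrm1 => H.
by move/eqP: H; rewrite (pexpr_eq1 (prim_order_gt0 Hw) (nrm_ge0 w)) => /eqP.
Qed.

(** The contour integral becomes a mean over the N-th roots of unity, which is exact for a
    polynomial as soon as [N] exceeds [n] and the degree. *)
Lemma cauchy_poly (p : {poly C}) (rho M : R) n : 0 <= rho ->
  (forall z, nrm z = rho -> nrm p.[z] <= M) -> nrm p`_n * rho ^+ n <= M.
Proof.
move=> r0 H; pose N := (maxn (size p) n.+1).
have N0 : (0 < N)%N by rewrite leq_max orbT.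
have [w Hw] := prim_root_ex N0.
have w1 := prim_root_nrm Hw.
have w0 : w != 0 by rewrite -nrm_gt0 w1.
have nN : (n < N)%N by rewrite leq_max ltnSn orbT.
have E : N%:R * (p`_n * inC rho ^+ n) = \sum_(j < N) p.[inC rho * w ^+ j] * (w ^- n) ^+ j.
  transitivity (\sum_(j < N) \sum_(k < N) p`_k * inC rho ^+ k * (w ^+ k / w ^+ n) ^+ j).
    rewrite exchange_big /= (bigD1 (Ordinal nN)) //= [X in _ + X]big1 ?addr0 => [|k kn].
      rewrite divff ?expf_neq0//; under eq_bigr do rewrite expr1n mulr1.
      by rewrite sumr_const card_ord mulr_natl.
    rewrite -mulr_sumr root_unity_sum; last first.
      by rewrite expr_div_n -!exprM ![(_ * N)%N]mulnC !exprM (prim_expr_order Hw) !expr1n divr1.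
    have -> : (w ^+ k / w ^+ n == 1) = false; last by rewrite mulr0.
    apply/negbTE; apply: contra kn => /eqP h.
    have : w ^+ k == w ^+ n by rewrite -[_ ^+ k](divfK (expf_neq0 n w0)) h mul1r.
    by rewrite (eq_prim_root_expr Hw) /eqn !modn_small// => /eqP kn; apply/eqP/val_inj.
  apply: eq_bigr => j _; rewrite (@horner_coef_wide _ N) ?leq_maxl// mulr_suml.
  apply: eq_bigr => k _; rewrite !exprMn -!exprM !mulrA; congr (_ * _).
  by rewrite [(j * k)%N]mulnC.
have Nr : 0 < N%:R :> R by rewrite ltr0n.
rewrite -(ler_pM2l Nr).
have -> : N%:R * (nrm p`_n * rho ^+ n) = nrm (N%:R * (p`_n * inC rho ^+ n)).
  by rewrite !nrmM nrmX nrm_nat nrm_inC ger0_norm.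
rewrite E; apply: le_trans (nrm_sum _ _ _) _.
apply: le_trans (_ : \sum_(j < N) M <= _); last by rewrite sumr_const card_ord mulr_natl.
apply: ler_sum => j _; rewrite nrmM !nrmX nrmV nrmX w1 expr1n invr1 expr1n mulr1.
by apply: H; rewrite nrmM nrmX w1 expr1n mulr1 nrm_inC ger0_norm.
Qed.

Lemma tail_small (u : nat -> R) (K e : R) : (forall n, 0 <= u n) ->
  (forall N, \sum_(n < N) u n <= K) -> 0 < e ->
  exists N0, forall N N', (N0 <= N)%N -> \sum_(n < N') u n - \sum_(n < N) u n <= e.
Proof.
move=> u0 uK e0; pose S := sup [set \sum_(n < N) u n | N in setT].
have hS : has_sup [set \sum_(n < N) u n | N in setT].
  by split; [exists (\sum_(n < 0) u n); exists 0%N | exists K => _ [n _ <-]; exact: uK].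
have [_ [N0 _ <-] HN0] := sup_adherent e0 hS.
exists N0 => N N' hN.
have h1 : \sum_(n < N') u n <= S by apply: sup_ubound; [case: hS|exists N'].
have h2 := sum_widen_le u0 hN.
rewrite -/S in HN0; lra.
Qed.

Lemma psum_tail a z s (e : R) N : psum a z s ->
  (forall N', (N <= N')%N -> \sum_(n < N') nrm (a n) * nrm z ^+ n - \sum_(n < N) nrm (a n) * nrm z ^+ n <= e) ->
  nrm (s - \sum_(n < N) a n * z ^+ n) <= e.
Proof.
move=> H He; move: H; rewrite /psum -(cvg_shiftn N) => H.
pose u n := series (fun n => a n * z ^+ n) (n + N)%N - \sum_(n < N) a n * z ^+ n.
apply: (@cvg_nrm_le _ u).
  by apply: cvgCB; [exact: H|exact: cvgC_cst].
move=> n; apply: le_trans (He (N + n)%N (leq_addr _ _)).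
rewrite /u /series /= big_mkord addnC !big_split_ord /= !(addrC (\sum_(i < N) _)) !addrK.
by apply: le_trans (nrm_sum _ _ _) _; apply: ler_sum => i _; rewrite nrmM nrmX.
Qed.

(** If the bound failed, a truncation whose error on the circle is at most half the excess would
    contradict [cauchy_poly]. *)
Lemma cauchy_est a (f : C -> C) rho' rho (M : R) n : gbd a rho' -> 0 <= rho -> rho < rho' ->
  (forall z, nrm z = rho -> psum a z (f z)) ->
  (forall z, nrm z = rho -> nrm (f z) <= M) -> nrm (a n) * rho ^+ n <= M.
Proof.
move=> ga r0 rr Hf HM; have [K HK] := gbd_abs ga r0 rr.
rewrite leNgt; apply/negP => lt; pose e := (nrm (a n) * rho ^+ n - M) / 2.
have e0 : 0 < e by rewrite /e; lra.
have u0 k : 0 <= nrm (a k) * rho ^+ k by rewrite mulr_ge0 ?nrm_ge0 ?exprn_ge0.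
have [N0 HN0] := tail_small u0 HK e0.
pose N := maxn N0 n.+1.
pose p : {poly C} := \poly_(k < N) a k.
have : nrm p`_n * rho ^+ n <= M + e.
  apply: cauchy_poly => // z zr.
  have := nrmD (f z) (p.[z] - f z); rewrite addrC subrK nrmB.
  have : nrm (f z - p.[z]) <= e.
    rewrite /p horner_poly; apply: psum_tail; first exact: Hf.
    by move=> N' _; rewrite zr; apply: HN0; exact: leq_maxl.
  by have := HM z zr; lra.
rewrite /p coef_poly leq_max ltnSn orbT.
by rewrite /e; lra.
Qed.

End Cauchy.

(** * Extension of a power series across its circle *)

Section Extension.
Variable R : realType.
Local Notation C := (Cplx R).
Implicit Types (a b c : nat -> C) (x y z s t v w : C) (rho r : R) (f g : C -> C).

Lemma gbd_inC a rho s : 0 <= rho -> psum a (inC rho) s -> gbd a rho.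
Proof. by move=> r0 /psum_gbd; rewrite nrm_inC ger0_norm. Qed.

Lemma gbd_disc b r (B : C -> C) : (forall z, nrm z < r -> psum b z (B z)) ->
  forall rho, 0 <= rho -> rho < r -> gbd b rho.
Proof.
move=> H rho r0 rr; apply: (gbd_inC r0 (H _ _)); by rewrite nrm_inC ger0_norm.
Qed.

(** Puts interior and boundary points on the same footing for the compactness argument: the
    expansion at [x] is a re-expansion of [b] or the given germ. *)
Lemma local_expansion b r (B : C -> C) x :
  (forall z, nrm z < r -> psum b z (B z)) ->
  (nrm x = r -> exists2 g, analytic_at g x &
     \forall z \near x, nrm z < r -> B z = g z) ->
  nrm x <= r ->
  exists a rho, [/\ 0 < rho, gbd a rho &
    forall z, nrm (z - x) < rho -> nrm z < r -> psum a (z - x) (B z)].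
Proof.
move=> HB Hx; rewrite le_eqVlt => /orP[/eqP /Hx [g /analyticP[a [ra [ra0 ga H]]] /nbhsC[e e0 K]]|xr].
  exists a, (Num.min ra e); split; first by rewrite lt_min ra0.
    exact: gbd_minl.
  move=> z; rewrite lt_min => /andP[z1 z2] zr; rewrite (K z z2 zr); exact: H.
have x0 := nrm_ge0 x.
pose d := (r - nrm x) / 4.
have d0 : 0 < d by rewrite /d; lra.
have gb : gbd b (nrm x + 3 * d).
  by apply: (gbd_disc HB); rewrite /d; lra.
have h : nrm x + d < nrm x + 3 * d by lra.
have [M HM] := tay_bound gb x0 d0 h.
exists (tay b x), d; split; [exact: d0|by exists M => n; apply: HM|].
move=> z zx zr; apply: (psum_tay gb); first by lra.
rewrite addrC subrK; exact: HB.
Qed.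

(** Both series have the sum [B (y + v)] for small [v], so the identity theorem applies. Bounds for
    the single series [a] thereby pass to [tay b y] for all [y] near [x] in the open disc. *)
Lemma tay_eq b r (B : C -> C) a rho x y :
  (forall z, nrm z < r -> psum b z (B z)) -> gbd a rho ->
  (forall z, nrm (z - x) < rho -> nrm z < r -> psum a (z - x) (B z)) ->
  nrm (y - x) < rho -> nrm y < r -> forall k, tay b y k = tay a (y - x) k.
Proof.
move=> HB ga Ha yx yr k.
pose d := Num.min (rho - nrm (y - x)) (r - nrm y) / 4.
have d0 : 0 < d by rewrite divr_gt0// lt_min !subr_gt0 yx yr.
have d1 : d * 4 <= rho - nrm (y - x) by rewrite /d divfK ?ge_min ?lexx//.
have d2 : d * 4 <= r - nrm y by rewrite /d divfK ?ge_min ?lexx ?orbT//.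
have y0 := nrm_ge0 y; have yx0 := nrm_ge0 (y - x).
have gb : gbd b (nrm y + 3 * d) by apply: (gbd_disc HB); lra.
have P v : nrm v < d -> psum (tay b y) v (B (y + v)) /\ psum (tay a (y - x)) v (B (y + v)).
  move=> vd; have yv : nrm (y + v) < r by have := nrmD y v; lra.
  split; first by apply: (psum_tay gb); [lra|exact: HB].
  have E : y - x + v = y + v - x by ring.
  apply: (psum_tay ga); first lra.
  rewrite E; apply: Ha; [rewrite -E; have := nrmD (y - x) v; lra|exact: yv].
apply/eqP; rewrite -subr_eq0; apply/eqP.
have hd : nrm (inC (d / 2)) < d by rewrite nrm_inC ger0_norm; lra.
apply: (@psum_eq0 _ (fun k => tay b y k - tay a (y - x) k) (d / 2)); first by lra.
  have [P1 P2] := P _ hd; apply: (@gbd_inC _ _ (B (y + inC (d / 2)) - B (y + inC (d / 2)))); first by lra.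
  exact: (psum_add P1 (psum_opp P2)).
move=> z _ zd; have zd' : nrm z < d by lra.
have [P1 P2] := P z zd'.
rewrite -(subrr (B (y + z))); exact: (psum_add P1 (psum_opp P2)).
Qed.

(** Compactness bounds the Taylor coefficients of order k by L^(k+1) on the whole open disc. As
    functions of the centre they are power series with coefficients binomial(n + k, k) b_(n+k),
    which Cauchy's estimate bounds in turn; the binomial expansion of (rho + eta)^n collects these
    bounds into one for b_n. *)
Lemma gbd_extend b r (B : C -> C) : 0 < r ->
  (forall z, nrm z < r -> psum b z (B z)) ->
  (forall x, nrm x = r -> exists2 g, analytic_at g x &
     \forall z \near x, nrm z < r -> B z = g z) ->
  exists2 rho, r < rho & gbd b rho.
Proof.
move=> r0 HB Hg.
have [x xr|S [L0 [_ HL0]] HS] := @disc_cover R R (pinfty_nbhs R)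
  (fun L y => nrm y < r -> forall k, nrm (tay b y k) <= L * L ^+ k) r.

  have [a [rho [rho0 ga Ha]]] := local_expansion HB (Hg x) xr.
  have q0 : 0 < rho / 4 by lra.
  have q1 : rho / 4 + rho / 4 < rho by lra.
  have [M HM] := tay_bound ga (ltW q0) q0 q1.
  exists (rho / 4); split; first lra.
  exists [set L | Num.max (Num.max M 0) (rho / 4)^-1 <= L].
    by apply: nbhs_pinfty_ge; rewrite num_real.
  move=> y L yx; rewrite /= ge_max ge_max => /andP[/andP[ML L0 LL]] yr k.
  have yx' : nrm (y - x) < rho by lra.
  rewrite (tay_eq HB ga Ha yx' yr).
  have := HM (y - x) (ltW yx) k; rewrite -ler_pdivlMr ?exprn_gt0// => h; apply: le_trans h _.
  rewrite -exprVn; apply: le_trans (_ : L * (rho / 4)^-1 ^+ k <= _).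
    by apply: ler_wpM2r; rewrite // exprn_ge0// invr_ge0 ltW.
  apply: ler_wpM2l => //; apply: lerXn2r => //; rewrite nnegrE// invr_ge0 ltW//.
pose L := Num.max (L0 + 1) 1.
have L1 : 1 <= L by rewrite le_max lexx orbT.
have SL : S L by apply: HL0; apply: lt_le_trans (_ : L0 + 1 <= _); [lra|rewrite le_max lexx].
have {HS} HL y (yr : nrm y < r) := HS L y SL (ltW yr) yr.
(* [L * eta = 1 / 2] makes the final sum geometric, and [rho >= r - eta / 2] puts [rho + eta] beyond
   [r]. *)
pose eta := (2 * L)^-1.
have eta0 : 0 < eta by rewrite invr_gt0; lra.
have Leta : L * eta = 1 / 2 by rewrite /eta; field; lra.
pose rho := Num.max 0 (r - eta / 2).
have rho0 : 0 <= rho by rewrite le_max lexx.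
have rhor : rho < r by rewrite gt_max r0; lra.
have coef k n : 'C(n + k, k)%:R * nrm (b (n + k)%N) * rho ^+ n <= L * L ^+ k.
  rewrite -nrm_nat -nrmM.
  have rm : 0 <= (rho + r) / 2 by lra.
  apply: (@cauchy_est _ (fun n => 'C(n + k, k)%:R * b (n + k)%N) (fun y => tay b y k) ((rho + r) / 2)).
  - apply: (@gbd_inC _ _ (tay b (inC ((rho + r) / 2)) k)); first exact: rm.
    apply: (@tay_cvg _ b (((rho + r) / 2 + r) / 2)).
      apply: (gbd_disc HB); lra.
    by rewrite nrm_inC ger0_norm; lra.
  - exact: rho0.
  - lra.
  - move=> z zr; apply: (@tay_cvg _ b ((rho + r) / 2)); last by rewrite zr; lra.
    apply: (gbd_disc HB); lra.
  - by move=> z zr; apply: HL; rewrite zr.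
exists (rho + eta).
  by apply: lt_le_trans (_ : r - eta / 2 + eta <= _); [lra|rewrite lerD2r le_max lexx orbT].
exists (L * (1 - 1 / 2)^-1) => n.
rewrite exprDn mulr_sumr.
apply: le_trans (_ : \sum_(i < n.+1) L * (1 / 2) ^+ i <= _); last first.
  by rewrite -mulr_sumr; apply: ler_wpM2l; [lra|apply: geo_sum_le; lra].
apply: ler_sum => i _; have iN : (i <= n)%N by rewrite -ltnS.
have := coef i (n - i)%N; rewrite subnK// => h.
rewrite -Leta exprMn mulrA -[X in _ * X]mulr_natl mulrA mulrA.
apply: ler_wpM2r; first by rewrite exprn_ge0// ltW.
by rewrite mulrCA mulrA.
Qed.

End Extension.

(** * The denominator on the circle *)

Section CircleDenominator.
Variable R : realType.
Local Notation C := (Cplx R).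
Implicit Types (a b c gamma : nat -> C) (x y z s t v w : C) (rho r : R) (f g F : C -> C) (D : {poly C}).

Lemma near_neq x y : x != y -> \forall z \near x, z != y.
Proof.
move=> xy; apply/nbhsC; exists (nrm (x - y)); first by rewrite nrm_gt0 subr_eq0.
by move=> z zx; apply/eqP => zy; move: zx; rewrite zy nrmB ltxx.
Qed.

(** For [y != x] a ball around [y] avoiding [x] suffices. This lets one germ at [x] serve all nearby
    points of the circle. *)
Lemma near_dnbhs_near (A : set C) x y (e : R) :
  (forall z, nrm (z - x) < e -> z != x -> A z) -> nrm (y - x) < e -> y^' A.
Proof.
move=> H yx; apply/dnbhsC; have [->|nyx] := eqVneq y x.
  exists e; last by [].
  by apply: le_lt_trans yx; exact: nrm_ge0.
exists (Num.min (e - nrm (y - x)) (nrm (y - x))).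
  by rewrite lt_min subr_gt0 yx nrm_gt0 subr_eq0.
move=> z; rewrite lt_min => /andP[z1 z2] _; apply: H.
  have := nrmD (z - y) (y - x); have -> : z - y + (y - x) = z - x by ring.
  lra.
by apply/eqP => zx; move: z2; rewrite zx nrmB ltxx.
Qed.

(** The radial parameter t tending to 1 from below; the shift by 2 keeps it strictly between 0 and
    1. *)
Definition tn (n : nat) : C := inC (1 - n.+2%:R^-1).

Lemma harm_cvg0 : (fun n => n.+2%:R^-1 : R) @ \oo --> (0 : R).
Proof.
have := @cvg_harmonic R; rewrite -(cvg_shiftS (@harmonic R : nat -> R)); exact.
Qed.

Lemma harm_gt0 n : 0 < n.+2%:R^-1 :> R.
Proof. by rewrite invr_gt0 ltr0n. Qed.

Lemma harm_lt1 n : n.+2%:R^-1 < 1 :> R.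
Proof. by rewrite invf_lt1 ?ltr0n// ltr1n. Qed.

Lemma tn_cvg x : (fun n => tn n * x) @ \oo --> x.
Proof.
apply: (@cvgC0_le _ _ (fun n => n.+2%:R^-1 * nrm x)).
  rewrite -[X in _ --> X](mul0r (nrm x)); apply: cvgM; [exact: harm_cvg0|exact: cvg_cst].
move=> n; have -> : tn n * x - x = - (inC n.+2%:R^-1 * x) by rewrite /tn inCB inC1; ring.
by rewrite nrmN nrmM nrm_inC ger0_norm// ltW// harm_gt0.
Qed.

Lemma tn_nrm x n : nrm (tn n * x) = (1 - n.+2%:R^-1) * nrm x.
Proof. by rewrite nrmM nrm_inC ger0_norm// subr_ge0 ltW// harm_lt1. Qed.

Lemma tn_lt x n : 0 < nrm x -> nrm (tn n * x) < nrm x.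
Proof. by move=> x0; rewrite tn_nrm gtr_pMl// ltrBlDr ltrDl harm_gt0. Qed.

Lemma tn_neq x n : 0 < nrm x -> tn n * x != x.
Proof. by move=> /(@tn_lt _ n) H; apply/eqP => E; move: H; rewrite E ltxx. Qed.

Lemma analytic_tn (f : C -> C) x : analytic_at f x -> (fun n => f (tn n * x)) @ \oo --> f x.
Proof.
move=> fx; apply/cvgC => e e0; have /cvg_atC/(_ _ e0)[d d0 K] := analytic_cvg fx.
have /cvgC T := @tn_cvg x; have := T _ d0; apply: filterS => n; exact: K.
Qed.

(* The radial approach to x sees the same limit as the punctured neighbourhood. *)
Lemma meromorphic_value_radial f x v (u : nat -> C) l : 0 < nrm x -> meromorphic_value f x v ->
  (forall n, f (tn n * x) = u n) -> u @ \oo --> l -> v = l.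
Proof.
move=> x0 [g [gx /dnbhsC[e e0 H] <-]] fu ul.
have /cvg_atC gc := analytic_cvg gx.
apply: (@cvg_unique _ (@norm_hausdorff _ C) (u @ \oo)); last exact: ul.
apply/cvgC => d d0; have [d' d'0 K] := gc _ d0.
have /cvgC T := @tn_cvg x.
have m0 : 0 < Num.min e d' by rewrite lt_min e0.
have := T _ m0; apply: filterS => n; rewrite lt_min => /andP[n1 n2].
by rewrite -fu H ?tn_neq//; exact: K.
Qed.

Lemma clears_ex gamma r : 0 < r -> Ct_r r gamma ->
  exists D, D \is monic /\ clears_circle gamma r D.
Proof.
move=> r0 [F [F1 [U [oU Usub HU]]]].
(* Sets containing all multiples of some monic polynomial: an element of this filter is a condition
   met by every sufficiently divisible polynomial, and local denominators (X - x)^k combine into a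
   common one. *)
pose FP : set_system {poly C} := [set S | exists D0 : {poly C}, D0 \is monic /\ forall D, D0 %| D -> S D].
have FF : Filter FP.
  split.
  - by exists 1; rewrite monic1.
  - move=> P Q [D1 [m1 H1]] [D2 [m2 H2]]; exists (D1 * D2); split; first by rewrite monicMl.
    by move=> D DD; split; [apply: H1; exact: dvdp_trans (dvdp_mulr _ (dvdpp _)) DD|apply: H2; exact: dvdp_trans (dvdp_mull _ (dvdpp _)) DD].
  - by move=> P Q PQ [D1 [m1 H1]]; exists D1; split => // D /H1/PQ.
have [|S [D0 [m0 HD0]] HS] := @disc_cover R {poly C} FP
  (fun D y => nrm y = r -> exists v, meromorphic_value (fun z => D.[z] * F z) y v) r FF.
  move=> x xr; have Ux : U x by apply: Usub; rewrite /= nrmE lec_inC.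
  have [k [g [gx /dnbhsC[e e0 H]]]] := HU x Ux.
  have /nbhsC[e' e'0 Hg] := analytic_near gx.
  exists (Num.min e e'); split; first by rewrite lt_min e0.
  exists [set D | (('X - x%:P) ^+ k) %| D].
    by exists (('X - x%:P) ^+ k); split => //; rewrite monic_exp// monicXsubC.
  move=> y D; rewrite lt_min => /andP[y1 y2] /= /dvdpP[Q ->] yr.
  exists (Q.[y] * g y), (fun z => Q.[z] * g z); split; last exact: erefl.
    apply: analytic_mul; [exact: analytic_horner|exact: Hg].
  apply: near_dnbhs_near y1 => z z1 z2.
  by rewrite -H// hornerM horner_exp hornerXsubC mulrA.
exists D0; split; first exact: m0.
exists F; split; first by split; [exact: F1|exists U].
move=> x; rewrite nrmE => /complexI xr; apply: (HS D0 x); [exact/HD0/dvdpp|by rewrite xr|exact: xr].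
Qed.

Lemma circle_denomP gamma r : 0 < r -> Ct_r r gamma ->
  is_circle_denom gamma r (circle_denom gamma r).
Proof.
move=> r0 H; rewrite /circle_denom; apply: (@xgetPex _ 1 [set D | is_circle_denom gamma r D]).
have [D [m c]] := clears_ex r0 H.
pose P n := `[< exists D, [/\ D \is monic, clears_circle gamma r D & size D = n] >].
have exP : exists n, P n by exists (size D); apply/asboolP; exists D.
have [n /asboolP[D1 [m1 c1 s1]] Hn] := ex_minnP exP.
exists D1; split; [exact: m1|exact: c1|].
move=> D' m' c'; rewrite s1; apply: Hn; apply/asboolP; by exists D'.
Qed.

(** By minimality D / (X - a) does not clear the circle. It would do so if [a] were off the circle,
    or if the germ of D F vanished at [a] and so absorbed the factor. *)
Lemma denom_root gamma r D F (a : C) : 0 < r -> is_circle_denom gamma r D ->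
  meromorphic_continuation gamma r F ->
  (forall x, nrm x = r -> exists v, meromorphic_value (fun z => D.[z] * F z) x v) ->
  root D a -> nrm a = r /\ forall v, meromorphic_value (fun z => D.[z] * F z) a v -> v != 0.
Proof.
move=> r0 [mD cD minD] HF HD /factor_theorem[D1 ED].
have m1 : D1 \is monic by move: mD; rewrite ED mulrC monicMl// monicXsubC.
have contra : ~ (forall x, nrm x = r -> exists v, meromorphic_value (fun z => D1.[z] * F z) x v).
  move=> H; have : clears_circle gamma r D1.
    by exists F; split; [exact: HF|move=> x; rewrite nrmE => /complexI; exact: H].
  by move=> /(minD _ m1); rewrite ED size_Mmonic ?monicXsubC ?monic_neq0// size_XsubC addn2 ltnn.
have away x : nrm x = r -> x != a -> exists v, meromorphic_value (fun z => D1.[z] * F z) x v.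
  move=> xr xa; have [v [g [gx H _]]] := HD x xr.
  exists (g x / (x - a)), (fun z => g z / (z - a)); split; last exact: erefl.
    apply: analytic_mul; first exact: gx.
    apply: (@analytic_inv _ (fun z => z - a)); first by rewrite subr_eq0.
    by apply: analytic_add; [exact: analytic_id|exact: analytic_cst].
  have := dnbhs_near (near_neq xa); move: H; apply: filterS2 => z <- za.
  by rewrite ED hornerM hornerXsubC mulrAC mulfK// subr_eq0.
split.
  apply/eqP; apply/negPn/negP => ar; apply: contra => x xr; apply: away => //.
  by apply/eqP => xa; move: ar; rewrite -xa xr eqxx.
move=> v [g [ga H gv]]; apply/eqP => v0; apply: contra => x xr.
have [xa|xa] := eqVneq x a; last exact: away.
have [g2 g2a K] := analytic_factor ga (etrans gv v0).
exists (g2 a), g2; rewrite xa; split; [exact: g2a| |exact: erefl].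
have := dnbhs_near K; move: H => /dnbhsC[e e0 H] /dnbhsC[d d0 K'].
apply/dnbhsC; exists (Num.min e d); first by rewrite lt_min e0.
move=> z; rewrite lt_min => /andP[z1 z2] za; have za0 : z - a != 0 by rewrite subr_eq0.
apply: (mulfI za0); rewrite -K'// -H// ED hornerM hornerXsubC; ring.
Qed.

Lemma psum_poly D z : psum (fun n => D`_n) z D.[z].
Proof.
apply: (@series_eventually _ _ _ (size D)) => n n0; rewrite /series /= big_mkord.
by rewrite (@horner_coef_wide _ n).
Qed.

Lemma gbd_poly D rho : 0 <= rho -> gbd (fun n => D`_n) rho.
Proof. by move=> r0; exact: (gbd_inC r0 (@psum_poly D _)). Qed.

Definition dmul D a := conv (fun n => D`_n) a.

(** Replaces the unrelated germs of D F by one function [B], the sum of a single power series on a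
    disc larger than that of [gamma]. *)
Lemma circle_data gamma r : 0 < r -> radius_of_convergence gamma r -> Ct_r r gamma ->
  let D := circle_denom gamma r in
  exists F rho (B : C -> C),
  [/\ D \is monic /\ (1 < size D)%N, meromorphic_continuation gamma r F,
      (forall x, nrm x = r -> exists v, meromorphic_value (fun z => D.[z] * F z) x v),
      [/\ r < rho, gbd (dmul D gamma) rho & forall z, nrm z < rho -> psum (dmul D gamma) z (B z)] &
      (forall a : C, root D a -> nrm a = r /\ B a != 0)].
Proof.
move=> r0 [rad1 rad2] HC D; have HD := circle_denomP r0 HC; rewrite -/D in HD.
have [mD [F [HF cF]] minD] := HD.
have {}cF x : nrm x = r -> exists v, meromorphic_value (fun z => D.[z] * F z) x v.
  by move=> xr; apply: cF; rewrite nrmE xr.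
have HFs z : nrm z < r -> psum gamma z (F z).
  by move=> zr; apply: HF.1; rewrite nrmE ltc_inC.
have HB z : nrm z < r -> psum (dmul D gamma) z (D.[z] * F z).
  move=> zr; pose m := (nrm z + r) / 2; have z0 := nrm_ge0 z.
  have m0 : 0 <= m by rewrite /m; lra.
  apply: (@psum_conv _ _ _ m); first exact: gbd_poly.
  - by apply: (gbd_disc HFs); rewrite /m; lra.
  - by rewrite /m; lra.
  - exact: psum_poly.
  - exact: HFs.
have [rho rr gb] : exists2 rho, r < rho & gbd (dmul D gamma) rho.
  apply: (gbd_extend r0 HB) => x xr; have [v [g [gx /dnbhsC[e e0 H] _]]] := cF x xr.
  exists g; first exact: gx.
  apply/nbhsC; exists e; first exact: e0.
  move=> z z1 z2; apply: H; first exact: z1.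
  by apply/eqP => zx; move: z2; rewrite zx xr ltxx.
have [B EB] : exists B : C -> C, forall z, nrm z < rho -> psum (dmul D gamma) z (B z).
  have : forall z, exists s, nrm z < rho -> psum (dmul D gamma) z s.
    move=> z; have [zr|zr] := ltP (nrm z) rho; last by exists 0; discriminate.
    have [s Hs] := gbd_psum gb zr; exists s => _; exact: Hs.
  by move=> /choice[B HBB]; exists B.
have EBF z : nrm z < r -> B z = D.[z] * F z.
  move=> zr; apply: (psum_unique (EB z _) (HB z zr)); exact: lt_trans rr.
exists F, rho, B; split; [|exact: HF|exact: cF|by split; [exact: rr|exact: gb|exact: EB]|].
  split; first exact: mD.
  (* A constant denominator would make [gamma] itself converge beyond [r]. *)
  rewrite ltnNge; apply/negP => sD.
  have D1 : D = 1.
    have := size1_polyC sD => E; move: mD; rewrite E monicE lead_coefC => /eqP ->.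
    by [].
  have gg : gbd gamma rho.
    case: gb => M HM; exists M => n; have := HM n; rewrite D1 /dmul /conv big_ord_recl subn0 coef1 /= mul1r.
    by rewrite big1 ?addr0// => i _; rewrite coef1 mul0r.
  pose z := inC ((r + rho) / 2).
  have zE : nrm z = (r + rho) / 2 by rewrite nrm_inC ger0_norm; lra.
  apply: (rad2 z); first by rewrite nrmE ltc_inC zE; lra.
  have [|s Hs] := @gbd_psum _ gamma rho z gg; first by rewrite zE; lra.
  by apply/cvg_ex; exists s.
move=> a ra; have [ar nz] := denom_root r0 HD HF cF ra; split => //.
have [v Hv] := cF a ar; suff <- : v = B a by exact: nz.
have a0 : 0 < nrm a by rewrite ar.
apply: (meromorphic_value_radial a0 Hv (u := fun n => B (tn n * a))).
  by move=> n; rewrite EBF// -ar tn_lt.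
apply: analytic_tn; apply: (psum_analytic gb EB); by rewrite ar.
Qed.

End CircleDenominator.

(** * Growth of the coefficients *)

Section PoleBound.
Variable R : realType.
Local Notation C := (Cplx R).
Implicit Types (a b c gamma : nat -> C) (x y z : C) (rho r : R) (p q D : {poly C}).

(** Truncating the series reduces the laws for [dmul] to those of the polynomial ring. *)
Lemma dmulE p a n N : (n < N)%N -> dmul p a n = (p * \poly_(i < N) a i)`_n.
Proof.
move=> nN; rewrite coefM; apply: eq_bigr => k _; rewrite coef_poly.
by rewrite (leq_ltn_trans (leq_subr _ _) nN).
Qed.

Lemma dmulM p q a : dmul (p * q) a =1 dmul p (dmul q a).
Proof.
move=> n; rewrite (dmulE _ _ (ltnSn n)) -mulrA coefM; apply: eq_bigr => k _.
by congr (_ * _); rewrite (@dmulE _ _ _ n.+1)// ltnS leq_subr.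
Qed.

Lemma dmulD p q a n : dmul (p + q) a n = dmul p a n + dmul q a n.
Proof. by rewrite !(dmulE _ _ (ltnSn n)) mulrDl coefD. Qed.

Lemma dmulC (c : C) a n : dmul c%:P a n = c * a n.
Proof. by rewrite (dmulE _ _ (ltnSn n)) coefCM coef_poly ltnSn. Qed.

Lemma dmul_XsubC x a n : dmul ('X - x%:P) a n = (if n is k.+1 then a k else 0) - x * a n.
Proof.
rewrite (dmulE _ _ (ltnSn n)) mulrBl coefB coefXM coefCM !coef_poly ltnSn.
by case: n => //= n; rewrite ltnS leqnSn.
Qed.

(** A truncated weighted l1 norm: submultiplicative for [conv], and finite without any convergence
    hypothesis. *)
Definition psnorm a rho N := \sum_(n < N) nrm (a n) * rho ^+ n.

Lemma psnorm_ge0 a rho N : 0 <= rho -> 0 <= psnorm a rho N.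
Proof. by move=> r0; apply: sumr_ge0 => i _; rewrite mulr_ge0 ?nrm_ge0 ?exprn_ge0. Qed.

Lemma psnorm_conv a b rho N : 0 <= rho -> psnorm (conv a b) rho N <= psnorm a rho N * psnorm b rho N.
Proof.
move=> r0.
apply: le_trans (_ : \sum_(n < N) \sum_(k < N)
   (if (k <= n)%N then nrm (a k) * rho ^+ k * (nrm (b (n - k)%N) * rho ^+ (n - k)) else 0) <= _).
  apply: ler_sum => n _.
  rewrite (@trunc_sum _ (fun k => nrm (a k) * rho ^+ k * (nrm (b (n - k)%N) * rho ^+ (n - k))))//.
  apply: le_trans (_ : (\sum_(k < n.+1) nrm (a k) * nrm (b (n - k)%N)) * rho ^+ n <= _).
    apply: ler_wpM2r; first exact: exprn_ge0.
    by apply: le_trans (nrm_sum _ _ _) _; apply: ler_sum => k _; rewrite nrmM.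
  rewrite mulr_suml; apply: ler_sum => k _.
  by rewrite mulrACA -exprD subnKC// -ltnS.
rewrite exchange_big /= /psnorm mulr_suml; apply: ler_sum => k _.
have u0 : 0 <= nrm (a k) * rho ^+ k by rewrite mulr_ge0 ?nrm_ge0 ?exprn_ge0.
pose f m := nrm (a k) * rho ^+ k * (nrm (b m) * rho ^+ m).
have f0 m : 0 <= f m by rewrite /f !mulr_ge0 ?nrm_ge0 ?exprn_ge0.
apply: le_trans (_ : \sum_(n < k + N) (if (k <= n)%N then f (n - k)%N else 0) <= _).
  apply: (@sum_widen_le _ (fun n => if (k <= n)%N then f (n - k)%N else 0)); last exact: leq_addl.
  by move=> n; case: ifP.
by rewrite shift_sum /f -mulr_sumr.
Qed.

Lemma psnorm_add a b c rho N : 0 <= rho -> (forall n, a n = b n + c n) ->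
  psnorm a rho N <= psnorm b rho N + psnorm c rho N.
Proof.
move=> r0 H; rewrite /psnorm -big_split; apply: ler_sum => i _ /=.
by rewrite H -mulrDl; apply: ler_wpM2r; [exact: exprn_ge0|exact: nrmD].
Qed.

Lemma psnorm_mono a rho r N : 0 <= rho -> rho <= r -> psnorm a rho N <= psnorm a r N.
Proof.
move=> r0 rr; apply: ler_sum => i _; apply: ler_wpM2l; first exact: nrm_ge0.
by apply: lerXn2r => //; rewrite nnegrE// (le_trans r0).
Qed.

Lemma psnorm_poly p rho r N : 0 <= rho -> rho <= r ->
  psnorm (fun n => p`_n) rho N <= psnorm (fun n => p`_n) r (size p).
Proof.
move=> r0 rr; have r0' := le_trans r0 rr; apply: le_trans (psnorm_mono _ _ r0 rr) _.
have f0 k : 0 <= nrm p`_k * r ^+ k by rewrite mulr_ge0 ?nrm_ge0 ?exprn_ge0.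
apply: le_trans (@sum_widen_le _ (fun k => nrm p`_k * r ^+ k) N (size p + N) f0 (leq_addl _ _)) _.
rewrite big_split_ord /= [X in _ + X]big1 ?addr0// => i _.
by rewrite nth_default ?leq_addr// nrm0 mul0r.
Qed.

(** From x a_n = a_(n-1) - b_n one gets r |a| <= |b| + rho |a| for the norms at [rho]. *)
Lemma psnorm_root a b x r rho N : nrm x = r -> 0 <= rho -> rho < r ->
  dmul ('X - x%:P) a =1 b -> psnorm a rho N * (r - rho) <= psnorm b rho N.
Proof.
move=> xr r0 rr H; rewrite mulrBr.
have -> : psnorm a rho N * r = \sum_(n < N) nrm (x * a n) * rho ^+ n.
  by rewrite mulr_suml; apply: eq_bigr => n _; rewrite nrmM xr mulrAC [_ * r]mulrC.
rewrite lerBlDr.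
apply: le_trans (_ : psnorm b rho N + psnorm (fun n => if n is k.+1 then a k else 0) rho N <= _).
  have -> : psnorm b rho N = psnorm (fun n => - b n) rho N.
    by rewrite /psnorm; under [RHS]eq_bigr do rewrite nrmN.
  have K n : x * a n = - b n + (if n is k.+1 then a k else 0) by rewrite -H dmul_XsubC opprB subrK.
  exact: (psnorm_add N r0 K).
rewrite lerD2l; case: N => [|N]; first by rewrite /psnorm !big_ord0 mul0r.
rewrite {1}/psnorm big_ord_recl /=.
rewrite nrm0 mul0r add0r.
apply: le_trans (_ : psnorm a rho N * rho <= _).
  by rewrite /psnorm mulr_suml; apply: ler_sum => i _; rewrite exprSr mulrA.
apply: ler_wpM2r => //; apply: (@sum_widen_le _ (fun n => nrm (a n) * rho ^+ n)) => //.
by move=> k; rewrite mulr_ge0 ?nrm_ge0 ?exprn_ge0.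
Qed.

Lemma psnorm_rootX k a b x r rho N : nrm x = r -> 0 <= rho -> rho < r ->
  dmul (('X - x%:P) ^+ k) a =1 b -> psnorm a rho N * (r - rho) ^+ k <= psnorm b rho N.
Proof.
move=> xr r0 rr; elim: k a => [|k IH] a H.
  by rewrite expr0 mulr1 /psnorm; under [leRHS]eq_bigr do rewrite -H expr0 dmulC mul1r.
rewrite exprS mulrA.
apply: le_trans (IH (dmul ('X - x%:P) a) _); last first.
  by move=> n; rewrite -dmulM -exprSr.
apply: ler_wpM2r; first by rewrite exprn_ge0// subr_ge0 ltW.
exact: (@psnorm_root _ _ x).
Qed.

Lemma mup_factor p x : p != 0 -> exists2 q, ~~ root q x & p = q * ('X - x%:P) ^+ mup x p.
Proof.
move=> p0; have [k [q]] := multiplicity_XsubC p x; rewrite p0 /= => qx E.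
by exists q => //; rewrite {2}E mupMr// mup_XsubCX eqxx.
Qed.

(** Partial fractions by induction on the degree: one root [x] is split off with its full
    multiplicity, and the norm of each part is bounded separately. *)
Lemma pole_bound D m r b (K : R) : 0 < r -> D != 0 ->
  (forall y, root D y -> nrm y = r /\ (mup y D <= m)%N) ->
  (forall N, psnorm b r N <= K) ->
  forall gamma, dmul D gamma =1 b ->
  exists K' : R, forall rho N, 0 <= rho -> rho < r -> psnorm gamma rho N * (r - rho) ^+ m <= K'.
Proof.
move=> r0; have [n] := ubnP (size D); elim: n D => // n IH D; rewrite ltnS => sD D0 HD HK gamma Hg.
have K0 : 0 <= K by have := HK 0%N; rewrite /psnorm big_ord0.
have [s1|s1] := eqVneq (size D) 1%N.
  have [c c0 Dc] : exists2 c : C, c != 0 & D = c%:P.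
    by apply/size_poly1P; rewrite s1.
  exists ((nrm c)^-1 * K * r ^+ m) => rho N p0 pr.
  apply: ler_pM; rewrite ?psnorm_ge0 ?exprn_ge0 ?subr_ge0 ?(ltW pr)//; last first.
    by apply: lerXn2r; rewrite ?nnegrE ?subr_ge0 ?(ltW pr) ?(ltW r0)// gerBl.
  rewrite ler_pdivlMl ?nrm_gt0//.
  apply: le_trans (ler_wpM2l (nrm_ge0 c) (psnorm_mono _ _ p0 (ltW pr))) _.
  apply: le_trans (HK N); rewrite /psnorm mulr_sumr; apply: ler_sum => i _.
  by rewrite -Hg Dc dmulC nrmM mulrA.
have [x xD] := closed_rootP D s1.
have [xr mx] := HD x xD.
have [q qx E] := mup_factor x D0; set k := mup x D in mx E.
have q0 : q != 0 by apply: contra D0 => /eqP q0; rewrite E q0 mul0r.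
have k0 : (0 < k)%N.
  by rewrite lt0n; apply/eqP => k0; move: xD; rewrite E k0 expr0 mulr1 (negPf qx).
have sq : (size q < n)%N.
  apply: leq_trans sD; rewrite E size_Mmonic ?monic_exp ?monicXsubC//.
  by rewrite size_exp_XsubC addnS /= -[X in (X < _)%N]addn0 ltn_add2l.
have Hq y : root q y -> nrm y = r /\ (mup y q <= m)%N.
  move=> yq; have yD : root D y by rewrite E rootM yq.
  have [yr ym] := HD y yD; split => //; apply: leq_trans ym.
  by rewrite E mupM ?expf_neq0 ?polyXsubC_eq0// leq_addr.
(* Bezout writes gamma as u (q gamma) + v ((X - x)^k gamma): the first series has only the
   denominator (X - x)^k, the second only [q], to which the induction applies. *)
have [[u v] /= uv] : exists uv : {poly C} * {poly C}, uv.1 * q + uv.2 * ('X - x%:P) ^+ k = 1.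
  by apply/Bezout_eq1_coprimepP; rewrite coprimep_expr// coprimep_XsubC.
have H1 : dmul (('X - x%:P) ^+ k) (dmul q gamma) =1 b.
  by move=> i; rewrite -dmulM mulrC -E Hg.
have [K1 HK1] := IH q sq q0 Hq HK (dmul (('X - x%:P) ^+ k) gamma) (fun i => etrans (esym (@dmulM _ _ _ i)) (etrans (congr1 (fun D => dmul D gamma i) (esym E)) (Hg i))).
pose U := psnorm (fun n => u`_n) r (size u); pose V := psnorm (fun n => v`_n) r (size v).
have U0 : 0 <= U by apply: psnorm_ge0; exact: ltW.
have V0 : 0 <= V by apply: psnorm_ge0; exact: ltW.
exists (U * (K * r ^+ (m - k)) + V * K1) => rho N p0 pr.
have d0 : 0 <= r - rho by rewrite subr_ge0 ltW.
have dm0 : 0 <= (r - rho) ^+ m by exact: exprn_ge0.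
apply: le_trans (_ : (psnorm (dmul u (dmul q gamma)) rho N + psnorm (dmul v (dmul (('X - x%:P) ^+ k) gamma)) rho N) * (r - rho) ^+ m <= _).
  apply: ler_wpM2r => //; apply: psnorm_add => // i.
  by rewrite -!dmulM -dmulD uv dmulC mul1r.
rewrite mulrDl; apply: lerD.
  apply: le_trans (_ : U * psnorm (dmul q gamma) rho N * (r - rho) ^+ m <= _).
    apply: ler_wpM2r => //; apply: le_trans (psnorm_conv _ _ _ p0) _.
    by apply: ler_wpM2r; [exact: psnorm_ge0|exact: psnorm_poly (ltW pr)].
  rewrite -mulrA; apply: ler_wpM2l => //.
  rewrite -(subnKC mx) exprD mulrA subnKC//; apply: ler_pM.
  - by rewrite mulr_ge0 ?psnorm_ge0 ?exprn_ge0.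
  - exact: exprn_ge0.
  - apply: le_trans (psnorm_rootX _ xr p0 pr H1) _.
    by apply: le_trans (psnorm_mono _ _ p0 (ltW pr)) _.
  - by apply: lerXn2r; rewrite ?nnegrE ?(ltW r0)// gerBl.
apply: le_trans (_ : V * psnorm (dmul (('X - x%:P) ^+ k) gamma) rho N * (r - rho) ^+ m <= _).
  apply: ler_wpM2r => //; apply: le_trans (psnorm_conv _ _ _ p0) _.
  by apply: ler_wpM2r; [exact: psnorm_ge0|exact: psnorm_poly (ltW pr)].
by rewrite -mulrA; apply: ler_wpM2l => //; exact: HK1.
Qed.

End PoleBound.

(** * Accumulation points *)

Section ProductTopology.
Variable R : realType.
Local Notation C := (Cplx R).

Lemma nbhs_coord (b : fps_top R) (k : nat) (e : R) : 0 < e ->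
  nbhs b [set f : fps_top R | nrm (f k - b k) < e].
Proof.
move=> e0.
have H : nbhs (b k) [set z : C | nrm (z - b k) < e] by apply/nbhsC; exists e.
exact: (@proj_continuous nat (fun=> (C : topologicalType)) k b _ H).
Qed.

Lemma cvg_coord (X : nat -> fps_top R) (b : fps_top R) :
  X @ \oo --> b -> forall k, (fun n => X n k) @ \oo --> b k.
Proof.
move=> Xb k; apply/cvgC => e e0; exact: (Xb _ (nbhs_coord b k e0)).
Qed.

Lemma coord_cvg (X : nat -> fps_top R) (b : fps_top R) :
  (forall k, (fun n => X n k) @ \oo --> b k) -> X @ \oo --> b.
Proof.
move=> H; apply/cvg_sup => i; apply/cvg_image.
  rewrite eqEsubset; split => // y _; by exists (fun=> y).
move=> A /(H i) /= [N _ HN]; exists [set f | A (f i)].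
  by exists N.
rewrite eqEsubset; split; first by move=> _ [f Af <-].
by move=> y Ay; exists (fun=> y).
Qed.

Lemma nbhs_coords (b : fps_top R) (j : nat) (e : R) : 0 < e ->
  nbhs b [set f : fps_top R | forall k, (k < j)%N -> nrm (f k - b k) < e].
Proof.
move=> e0; elim: j => [|j IH].
  by apply: (@filterS _ _ _ setT); [move=> f _ k|exact: filterT].
move: IH (nbhs_coord b j e0); apply: filterS2 => f H1 H2 k; rewrite ltnS leq_eqVlt => /orP[/eqP->//|].
exact: H1.
Qed.

Lemma ltn_homo (phi : nat -> nat) : (forall j, (phi j < phi j.+1)%N) -> {homo phi : m n / (m < n)%N}.
Proof. by move=> H; apply: homo_ltn => //; exact: ltn_trans. Qed.

(* Bolzano-Weierstrass in C[[s]], by Tychonoff. *)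
Lemma subseq_cvg (X : nat -> fps_top R) (c : nat -> R) (S : set nat) :
  (forall n k, nrm (X n k) <= c k) -> (forall N, exists2 n, (N <= n)%N & S n) ->
  exists (b : fps_top R) (phi : nat -> nat),
   [/\ {homo phi : m n / (m < n)%N}, forall j, S (phi j) & (X \o phi) @ \oo --> b].
Proof.
move=> Xc HS.
(* Since [S] is unbounded there is a cluster point along [S]; the subsequence is then extracted
   diagonally, [j] coordinates being controlled at step [j]. *)
have PF : ProperFilter (within S \oo).
  apply: Build_ProperFilter_ex => A [N _ HN]; have [n Nn Sn] := HS N; exists n; exact: HN.
have := @tychonoff nat (fun=> (C : topologicalType)) (fun k => [set z : C | `|complex.Re z| <= c k /\ `|complex.Im z| <= c k])
  (fun k => @compact_rect R (c k)).
move=> /(_ (X @ within S \oo) _ _)[].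
  exists 0%N => // n _ Sn k /=; split; apply: le_trans (Xc n k); [exact: Re_nrm|exact: Im_nrm].
move=> b [_ clb].
have pick j N : exists n, [/\ (N <= n)%N, S n & forall k, (k < j)%N -> nrm (X n k - b k) < j.+1%:R^-1].
  have A1 : (X @ within S \oo) [set X n | n in [set n | (N <= n)%N /\ S n]].
    exists N => // n Nn Sn; by exists n.
  have j0 : 0 < j.+1%:R^-1 :> R by rewrite invr_gt0 ltr0n.
  have [f [[n [Nn Sn] <-] Hf]] := clb _ _ A1 (@nbhs_coords b j _ j0).
  by exists n.
have [g Hg] : exists g : nat -> nat -> nat, forall j N, [/\ (N <= g j N)%N, S (g j N) & forall k, (k < j)%N -> nrm (X (g j N) k - b k) < j.+1%:R^-1].
  have {pick}pick (p : nat * nat) : exists n, [/\ (p.2 <= n)%N, S n & forall k, (k < p.1)%N -> nrm (X n k - b k) < p.1.+1%:R^-1].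
    exact: pick.
  have [g Hg] := choice pick; exists (fun j N => g (j, N)) => j N; exact: (Hg (j, N)).
pose phi := fix phi j := if j is i.+1 then g j (phi i).+1 else g 0%N 0%N.
have phiE j : exists N, phi j = g j N by case: j => [|j]; eexists.
exists b, phi; split.
- apply: ltn_homo => j /=; by have [] := Hg j.+1 (phi j).+1.
- by move=> j; have [N ->] := phiE j; have [] := Hg j N.
apply: coord_cvg => k; apply/cvgC => e e0.
have := @cvg_harmonic R => /cvgrPdist_lt/(_ _ e0)[N _ HN].
exists (maxn N k.+1) => // j /=; rewrite geq_max => /andP[Nj kj].
have [M ->] := phiE j; have [_ _ H] := Hg j M; apply: lt_trans (H k kj) _.
have := HN j Nj; rewrite sub0r normrN ger0_norm//.
by rewrite invr_ge0.
Qed.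

End ProductTopology.

Lemma finite_near (T : choiceType) (A : set T) (P : T -> nat -> Prop) :
  finite_set A -> (forall a, A a -> \forall n \near \oo, P a n) ->
  \forall n \near \oo, forall a, A a -> P a n.
Proof.
move=> /finite_seqP[s ->]; elim: s => [|x s IH] H.
  by apply: nearW => n a.
have H1 := H x (mem_head _ _).
have H2 : \forall n \near \oo, forall a, [set` s] a -> P a n.
  by apply: IH => a sa; apply: H; rewrite /= inE; apply/orP; right.
move: H1 H2; apply: filterS2 => n Hx Hs a; rewrite /= inE => /orP[/eqP->//|]; exact: Hs.
Qed.

Lemma dvdn_fsbig_lcm (T : choiceType) (A : set T) (p : T -> nat) a :
  finite_set A -> A a -> (p a %| \big[lcmn/1%N]_(i \in A) p i)%N.
Proof.
move=> finA Aa; have [s us As] : exists2 s : seq T, uniq s & A = [set` s].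
  have /finite_seqP[s ->] := finA; exists (undup s); first exact: undup_uniq.
  by apply/seteqP; split => x /=; rewrite mem_undup.
rewrite As -(@fsbig_seq _ _ _ _ s p us).
by rewrite (big_rem a) /=; [exact: dvdn_lcml|move: Aa; rewrite As].
Qed.

Lemma fsbig_lcm_gt0 (T : choiceType) (A : set T) (p : T -> nat) :
  finite_set A -> (forall a, A a -> (0 < p a)%N) -> (0 < \big[lcmn/1%N]_(i \in A) p i)%N.
Proof.
move=> finA H; have [s us As] : exists2 s : seq T, uniq s & A = [set` s].
  have /finite_seqP[s ->] := finA; exists (undup s); first exact: undup_uniq.
  by apply/seteqP; split => x /=; rewrite mem_undup.
rewrite As -(@fsbig_seq _ _ _ _ s p us) big_seq; elim/big_ind: _ => //.
  by move=> x y x0 y0; rewrite lcmn_gt0 x0.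
by move=> i si; apply: H; rewrite As.
Qed.

(** * Limits along residue classes modulo the period *)

Section RationalAccumulationLimits.
Variable R : realType.
Local Notation C := (Cplx R).
Implicit Types (gamma : nat -> C) (h n : nat) (e : int).

(** The coefficients of the accumulation point belonging to the class [e]; [Apoly] is their
    truncation below degree [h]. *)
Definition acoef gamma h e k : C := \prod_(1 <= i < k.+1) a1 gamma h (e - i%:Z + 1).

Lemma acoefS gamma h e k : acoef gamma h e k.+1 = acoef gamma h e k * a1 gamma h (e - k%:Z).
Proof.
rewrite /acoef big_nat_recr //=; congr (_ * a1 _ _ _).
lia.
Qed.

Lemma a1_mod gamma h e e' : (e = e' %[mod h%:Z])%Z -> a1 gamma h e = a1 gamma h e'.
Proof. by rewrite /a1 => ->. Qed.

Definition crep h e : nat := `|(e %% h%:Z)%Z|%N.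

Lemma crepE h e : (0 < h)%N -> (crep h e)%:Z = (e %% h%:Z)%Z.
Proof. by move=> h0; rewrite /crep gez0_abs// modz_ge0//; lia. Qed.

Lemma crep_lt h e : (0 < h)%N -> (crep h e < h)%N.
Proof. by move=> h0; have := crepE e h0; have := ltz_pmod e (_ : 0 < h%:Z); lia. Qed.

Lemma crep_mod h e : (0 < h)%N -> ((crep h e)%:Z = e %[mod h%:Z])%Z.
Proof. by move=> h0; rewrite crepE// modz_mod. Qed.

Lemma class_add h e n j : (n%:Z = e %[mod h%:Z])%Z -> ((n + j * h)%:Z = e %[mod h%:Z])%Z.
Proof. by move=> <-; rewrite PoszD PoszM addrC modzMDl. Qed.

Lemma class_split h e n m : (0 < h)%N -> (n%:Z = e %[mod h%:Z])%Z -> (m%:Z = e %[mod h%:Z])%Z ->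
  (m <= n)%N -> exists j, n = (m + j * h)%N.
Proof.
move=> h0 ne me mn; exists ((n - m) %/ h)%N.
have : (h%:Z %| n%:Z - m%:Z)%Z by rewrite -eqz_mod_dvd ne me.
rewrite subzn// => /divnK; rewrite absz_nat => ->; lia.
Qed.

Lemma tame_ratio gamma : tame gamma -> exists u v : R, 0 < u /\ 0 < v /\
  exists N, forall n, (N <= n)%N -> [/\ gamma n != 0, u <= nrm (gamma n.-1 / gamma n) & nrm (gamma n.-1 / gamma n) <= v].
Proof.
move=> [u [v [u0 v0 [N _ HN]]]]; exists u, v; do 2!split => //; exists N => n Nn.
have := HN n Nn; rewrite nrmE !lec_inC => /andP[h1 h2]; split => //.
apply/eqP => g0; move: h1; rewrite g0 invr0 mulr0 nrm0 leNgt => /negP; exact.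
Qed.

(** For large [n] coordinate [k] is a product of [k] consecutive ratios, each at most [v]; the
    finitely many other [n] are absorbed by a sum. *)
Lemma Xseq_bounded gamma : tame gamma -> exists c : nat -> R, forall n k, nrm (Xseq gamma n k) <= c k.
Proof.
move=> /tame_ratio[u [v [u0 [v0 [N HN]]]]].
suff H k : exists c : R, forall n, nrm (Xseq gamma n k) <= c.
  by have [c Hc] := choice H; exists c => n k; exact: Hc.
have large n : (N + k <= n)%N -> nrm (Xseq gamma n k) <= v ^+ k.
  elim: k n => [|k IH] n Nn.
    have [g0 _ _] := HN n (leq_trans (leq_addr _ _) Nn).
    by rewrite /Xseq leq0n subn0 divff// nrm1.
  have kn : (k.+1 <= n)%N by lia.
  rewrite /Xseq kn; have -> : gamma (n - k.+1)%N / gamma n = (gamma (n - k).-1 / gamma (n - k)%N) * Xseq gamma n k.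
    have [|g0 _ _] := HN (n - k)%N; first lia.
    by rewrite /Xseq (ltnW kn) -subnS mulrA divfK.
  rewrite nrmM exprS; apply: ler_pM; rewrite ?nrm_ge0//; last by apply: IH; lia.
  by have [|_ _] := HN (n - k)%N; first lia.
exists (v ^+ k + \sum_(i < N + k) nrm (Xseq gamma i k)) => n.
have S0 m (P : pred 'I_m) : 0 <= \sum_(i < m | P i) nrm (Xseq gamma i k) by apply: sumr_ge0 => i _; exact: nrm_ge0.
have [nN|nN] := leqP (N + k) n; first by apply: le_trans (large n nN) _; rewrite lerDl S0.
rewrite (bigD1 (Ordinal nN)) //= addrCA lerDl addr_ge0 ?S0// exprn_ge0// ltW//.
Qed.

(** The neighbourhood occupied by [X n] eventually depends only on the class of [n], and remaining
    in one neighbourhood means converging to its centre. *)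
Lemma fra_classes gamma h : tame gamma -> fra_series gamma h ->
  [/\ (0 < h)%N,
   forall e, exists2 a, Omega gamma a & forall k (eps : R), 0 < eps -> exists N, forall n,
     (N <= n)%N -> (n%:Z = e %[mod h%:Z])%Z -> nrm (Xseq gamma n k - a k) < eps &
   forall a, Omega gamma a -> exists e, forall k (eps : R), 0 < eps -> exists N, forall n,
     (N <= n)%N -> (n%:Z = e %[mod h%:Z])%Z -> nrm (Xseq gamma n k - a k) < eps].
Proof.
move=> tg [V [finOm VP disj [_ _ [D [finD covD _]]] [p [pP hE]]]].
set X := Xseq gamma in V VP disj finOm D finD covD p pP hE *.
rewrite -/(Omega gamma) in finOm VP disj covD pP hE.
have h0 : (0 < h)%N by rewrite hE; apply: fsbig_lcm_gt0 => // a /pP[[[]]].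
(* [h] is a multiple of the period of every set of the partition. *)
have per : \forall n \near \oo, forall a, Omega gamma a -> forall j, V a (X n) -> V a (X (n + j * h)%N).
  have : \forall n \near \oo, forall a, Omega gamma a -> forall m, (n <= m)%N -> V a (X m) -> V a (X (m + p a)%N).
    apply: (finite_near finOm) => a Oa; have [[pa0 [N _ HN]] _] := pP a Oa.
    by exists N => // n Nn m nm /(HN m (leq_trans Nn nm)).
  apply: filterS => n H a Oa j Vn.
  have /dvdnP[q ->] : (p a %| j * h)%N by rewrite dvdn_mull// hE; exact: dvdn_fsbig_lcm.
  elim: q => [|q IH]; first by rewrite addn0.
  by rewrite mulSnr addnA; apply: H => //; exact: leq_addr.
have cov : \forall n \near \oo, exists2 a, Omega gamma a & V a (X n).
  have : \forall n \near \oo, forall d, D d -> (d < n)%N.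
    by apply: (finite_near finD) => d _; exists d.+1.
  apply: filterS => n nD; have : (~` D) n by move=> /nD; rewrite ltnn.
  by rewrite covD => -[a Oa [Va _]]; exists a.
(* Otherwise a subsequence inside [V a] stays away from [a] in coordinate [k]. By compactness it may
   be taken convergent; its limit is an accumulation point whose neighbourhood meets [V a], hence is
   [a] itself. *)
have lims a k (eps : R) : Omega gamma a -> 0 < eps -> exists N, forall n, (N <= n)%N -> V a (X n) -> nrm (X n k - a k) < eps.
  move=> Oa e0; apply: contrapT => /forallNP H.
  have [c Hc] := Xseq_bounded tg.
  have [|b [phi [phi1 phi2 phi3]]] := @subseq_cvg R X c [set n | V a (X n) /\ eps <= nrm (X n k - a k)] Hc.
    move=> N; have /existsNP[n /not_implyP[Nn /not_implyP[Vn]]] := H N.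
    by move=> /negP; rewrite -leNgt => ?; exists n.
  have Ob : Omega gamma b by exists phi.
  have ab : a = b.
    have [ob Vb] := VP b Ob.
    have [N _ HN] := phi3 _ (open_nbhs_nbhs (conj ob Vb)).
    apply: (disj a b Oa Ob); exists (X (phi N)); split; last exact: (HN N (leqnn _)).
    by have [] := phi2 N.
  have /cvgnC/(_ _ e0)[N HN] : (fun n => (X \o phi) n k) @ \oo --> b k by exact: (cvg_coord phi3).
  have := HN N (leqnn _); have [_] := phi2 N; rewrite ab /= => h1 h2.
  by have := le_lt_trans h1 h2; rewrite ltxx.
have [N0 _ HN0] := filterI per cov.
have cls a n1 : (N0 <= n1)%N -> Omega gamma a -> V a (X n1) -> forall k (eps : R), 0 < eps -> exists N, forall n,
     (N <= n)%N -> (n%:Z = n1%:Z %[mod h%:Z])%Z -> nrm (Xseq gamma n k - a k) < eps.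
  move=> Nn1 Oa Va k eps e0; have [N HN] := lims a k eps Oa e0.
  exists (maxn N n1) => n; rewrite geq_max => /andP[Nn nn] nc.
  have [j nE] := class_split h0 nc (erefl _) nn.
  by apply: HN => //; rewrite nE; have [H _] := HN0 n1 Nn1; apply: H.
split => //.
  move=> e; pose n1 := (crep h e + N0 * h)%N.
  have n1c : (n1%:Z = e %[mod h%:Z])%Z by apply: class_add; exact: crep_mod.
  have n1N : (N0 <= n1)%N by rewrite /n1; apply: leq_trans (leq_pmulr N0 h0) (leq_addl _ _).
  have [_ [a Oa Va]] := HN0 n1 n1N.
  by exists a => // k eps e0; have := cls a n1 n1N Oa Va k eps e0; rewrite n1c.
move=> a Oa; have [phi [phi1 phi2]] := Oa.
have [oa Va] := VP a Oa.
have [N _ HN] := phi2 _ (open_nbhs_nbhs (conj oa Va)).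
have phi_ge j : (j <= phi j)%N by elim: j => // j IH; exact: leq_ltn_trans IH (phi1 j j.+1 (ltnSn _)).
have nN : (N0 <= phi (maxn N N0))%N by apply: leq_trans (phi_ge _); exact: leq_maxr.
exists (phi (maxn N N0))%:Z; apply: (cls a _ nN Oa).
exact: (HN _ (leq_maxl _ _)).
Qed.

(** Coordinate k + 1 of X_n is coordinate k times the ratio at n - k, an index in the class e -
    k. *)
Lemma class_limit gamma h e a : tame gamma -> (0 < h)%N ->
  (forall e (eps : R), 0 < eps -> exists N, forall n,
     (N <= n)%N -> (n%:Z = e %[mod h%:Z])%Z -> nrm (gamma n.-1 / gamma n - a1 gamma h e) < eps) ->
  (forall k (eps : R), 0 < eps -> exists N, forall n,
     (N <= n)%N -> (n%:Z = e %[mod h%:Z])%Z -> nrm (Xseq gamma n k - a k) < eps) ->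
  forall k, a k = acoef gamma h e k.
Proof.
move=> /tame_ratio[u [v [u0 [v0 [N HN]]]]] h0 Hr Ha.
pose nj j := (crep h e + j * h)%N.
have njc j : ((nj j)%:Z = e %[mod h%:Z])%Z by apply: class_add; exact: crep_mod.
have nj_ge j : (j <= nj j)%N by apply: leq_trans (leq_pmulr j h0) (leq_addl _ _).
have lX k : (fun j => Xseq gamma (nj j) k) @ \oo --> a k.
  apply/cvgnC => eps e0; have [M HM] := Ha k eps e0; exists M => j Mj.
  by apply: HM => //; exact: leq_trans Mj _.
have uniq (u1 u2 : nat -> C) (l1 l2 : C) : u1 @ \oo --> l1 -> u2 @ \oo --> l2 -> (\forall n \near \oo, u1 n = u2 n) -> l1 = l2.
  move=> H1 H2 E; apply: (@cvg_unique _ (@norm_hausdorff _ C) (u2 @ \oo)); last exact: H2.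
  by apply: cvg_trans H1; apply: near_eq_cvg; move: E; apply: filterS => n ->.
elim=> [|k IH].
  rewrite /acoef big_geq//; apply: (uniq _ (fun=> 1) _ _ (lX 0%N)); first exact: cvgC_cst.
  exists N => // j Nj; have [g0 _ _] := HN (nj j) (leq_trans Nj (nj_ge j)).
  by rewrite /Xseq leq0n subn0 divff.
rewrite acoefS -IH.
apply: (uniq _ (fun j => Xseq gamma (nj j) k * (gamma (nj j - k)%N.-1 / gamma (nj j - k)%N)) _ _ (lX k.+1)).
  apply: cvgCM; first exact: lX.
  apply/cvgnC => eps e0; have [M HM] := Hr (e - k%:Z) eps e0; exists (M + k)%N => j Mj.
  have Mnj := leq_trans Mj (nj_ge j).
  apply: HM; first lia.
  rewrite -subzn; last lia.
  by apply/eqP; rewrite eqz_modDr; apply/eqP.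
exists (N + k.+1)%N => // j Nj; have Nnj := leq_trans Nj (nj_ge j).
have [|g0 _ _] := HN (nj j - k)%N; first lia.
rewrite /Xseq (_ : (k < nj j)%N); last lia.
have -> : (k <= nj j)%N by lia.
by rewrite [RHS]mulrC -subnS mulrA divfK.
Qed.

Lemma fra_limits gamma h : tame gamma -> fra_series gamma h ->
  [/\ (0 < h)%N,
   forall eps : R, 0 < eps -> exists N, forall n, (N <= n)%N ->
     nrm (gamma n.-1 / gamma n - a1 gamma h n%:Z) < eps,
   forall e, a1 gamma h e != 0 &
   forall b, Omega gamma b <-> exists e : 'I_h, b = acoef gamma h e%:Z].
Proof.
move=> tg fg; have [h0 Hcl HO] := fra_classes tg fg.
have Hr e (eps : R) : 0 < eps -> exists N, forall n,
     (N <= n)%N -> (n%:Z = e %[mod h%:Z])%Z -> nrm (gamma n.-1 / gamma n - a1 gamma h e) < eps.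
  (* For n >= 1 the ratio is coordinate 1 of X_n, so it converges along the class. *)
  have [a Oa Ha] := Hcl e.
  have H1 (ep : R) : 0 < ep -> exists N, forall n, (N <= n)%N -> (n%:Z = e %[mod h%:Z])%Z -> nrm (gamma n.-1 / gamma n - a 1%N) < ep.
    move=> ep0; have [N HN] := Ha 1%N ep ep0; exists (maxn N 1) => n; rewrite geq_max => /andP[Nn n1] nc.
    by have := HN n Nn nc; rewrite /Xseq n1 subn1.
  suff -> : a1 gamma h e = a 1%N by exact: H1.
  have PF : ProperFilter (within [set n : nat | (n%:Z = e %[mod h%:Z])%Z] \oo).
    apply: Build_ProperFilter_ex => A [N _ HN]; exists (crep h e + N * h)%N.
    apply: HN; last by apply: class_add; exact: crep_mod.
    by apply: leq_trans (leq_pmulr N h0) (leq_addl _ _).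
  apply: cvg_lim; first exact: norm_hausdorff.
  apply/cvgC => ep ep0; have [N HN] := H1 ep ep0; exists N => // n Nn; exact: HN.
split => //.
- move=> eps e0.
  have [f Hf] := choice (fun i : 'I_h => Hr i%:Z eps e0).
  exists (\max_i f i) => n Nn.
  have nh : (n %% h < h)%N by rewrite ltn_mod.
  have E : (n%:Z = (Ordinal nh)%:Z %[mod h%:Z])%Z by rewrite /= -modz_nat modz_mod.
  rewrite (a1_mod gamma E); apply: Hf => //; apply: leq_trans Nn; exact: leq_bigmax.
- move=> e; have [u [v [u0 [v0 [N HN]]]]] := tame_ratio tg.
  apply/eqP => a0; have [M HM] := Hr e u u0; rewrite a0 in HM.
  pose n := (crep h e + (N + M) * h)%N.
  have nN : (N + M <= n)%N by apply: leq_trans (leq_pmulr _ h0) (leq_addl _ _).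
  have := HM n (leq_trans (leq_addl _ _) nN) (class_add _ (crep_mod e h0)); rewrite subr0.
  have [_ h1 _] := HN n (leq_trans (leq_addr _ _) nN); move=> h2.
  by have := le_lt_trans h1 h2; rewrite ltxx.
move=> b; split.
  move=> Ob; have [e He] := HO b Ob.
  exists (Ordinal (crep_lt e h0)); apply/funext => k /=.
  apply: (class_limit tg h0 Hr) => j eps e0; have [N HN] := He j eps e0.
  by exists N => n Nn; rewrite crep_mod//; exact: HN.
move=> [e ->]; have [a Oa Ha] := Hcl e%:Z.
suff <- : a = acoef gamma h e%:Z by [].
by apply/funext => k; apply: (class_limit tg h0 Hr).
Qed.

Lemma Apoly_horner gamma h e (y : C) : (Apoly gamma h e).[y] = \sum_(j < h) acoef gamma h e j * y ^+ j.
Proof. by rewrite /Apoly horner_poly. Qed.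

Lemma acoef_mod gamma h e e' j : (e = e' %[mod h%:Z])%Z -> acoef gamma h e j = acoef gamma h e' j.
Proof.
move=> ee; rewrite /acoef; apply: eq_bigr => i _; apply: a1_mod.
by apply/eqP; rewrite -!addrA eqz_modDr; apply/eqP.
Qed.

Lemma Apoly_mod gamma h e e' : (e = e' %[mod h%:Z])%Z -> Apoly gamma h e = Apoly gamma h e'.
Proof.
move=> ee; apply/polyP => j; rewrite !coef_poly; case: ifP => // _.
exact: (acoef_mod gamma j ee).
Qed.

(** A product over one full period does not depend on the class where it starts; starting at h - 1
    gives [AP] in reverse order. *)
Lemma acoef_full gamma h (e : nat) : (0 < h)%N -> (forall e, a1 gamma h e != 0) ->
  acoef gamma h e%:Z h = AP gamma h.
Proof.
move=> h0 a1_neq0.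
have step (n : nat) : acoef gamma h n.+1%:Z h = acoef gamma h n%:Z h.
  have a0 := a1_neq0 n.+1%:Z.
  apply: (mulIf a0).
  have := acoefS gamma h n.+1%:Z h.
  have -> : a1 gamma h (n.+1%:Z - h%:Z) = a1 gamma h n.+1%:Z.
    by apply: a1_mod; rewrite -[in RHS](subrK h%:Z n.+1%:Z) modzDr.
  move=> <-; rewrite /acoef big_nat_recl// mulrC; congr (_ * _).
    by apply: eq_bigr => i _; congr (a1 _ _ _); lia.
  by congr (a1 _ _ _); lia.
have -> : acoef gamma h e%:Z h = acoef gamma h h.-1%:Z h.
  have H n : acoef gamma h n%:Z h = acoef gamma h 0%:Z h by elim: n => // n <-; exact: step.
  by rewrite H (H h.-1).
rewrite /acoef /AP big_add1 /= big_mkord (reindex_inj rev_ord_inj) /=; apply: eq_bigr => i _.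
by congr (a1 _ _ _); have := ltn_ord i; lia.
Qed.

Lemma acoef_add gamma h (e : int) k l : acoef gamma h e (k + l) = acoef gamma h e k * acoef gamma h (e - k%:Z) l.
Proof.
elim: l => [|l IH]; first by rewrite addn0 /acoef [X in _ * X]big_geq// mulr1.
rewrite addnS !acoefS IH -mulrA; congr (_ * (_ * a1 _ _ _)).
by rewrite PoszD; lia.
Qed.

Lemma acoef_period gamma h (e : int) k : (0 < h)%N -> (forall e, a1 gamma h e != 0) ->
  acoef gamma h e (k + h) = acoef gamma h e k * AP gamma h.
Proof.
move=> h0 a1_neq0; rewrite acoef_add; congr (_ * _).
rewrite -(acoef_full (crep h (e - k%:Z)) h0 a1_neq0).
by apply/esym/acoef_mod; exact: crep_mod.
Qed.

(** Equivalently, the accumulation point of class [e] is the series A^[e](s) / (1 - A_P s^h). *)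
Lemma acoef_modn gamma h (e : int) k : (0 < h)%N -> (forall e, a1 gamma h e != 0) ->
  acoef gamma h e k = acoef gamma h e (k %% h) * AP gamma h ^+ (k %/ h).
Proof.
move=> h0 a1_neq0; rewrite {1}(divn_eq k h); move: (k %/ h)%N => q.
elim: q => [|q IH]; first by rewrite mul0n add0n expr0 mulr1.
rewrite mulSn -addnA addnC acoef_period// IH exprSr mulrA//.
Qed.

End RationalAccumulationLimits.

(** * Radial limits *)

Lemma finite_min_gt0 (R : realType) n (dd : 'I_n -> R) : (forall j, 0 < dd j) ->
  exists2 d : R, 0 < d & forall j, d <= dd j.
Proof.
move=> dd0; have H (rs : seq 'I_n) : exists2 d : R, 0 < d & forall j, j \in rs -> d <= dd j.
  elim: rs => [|j rs [d d0 IH]]; first by exists 1.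
  exists (Num.min d (dd j)); first by rewrite lt_min d0 dd0.
  move=> i; rewrite inE => /orP[/eqP ->|/IH id]; first by rewrite ge_min lexx orbT.
  by rewrite ge_min id.
by have [d d0 Hd] := H (index_enum 'I_n); exists d => // j; apply: Hd; rewrite mem_index_enum.
Qed.

Section RadialLimits.
Variable R : realType.
Local Notation C := (Cplx R).
Implicit Types (x y z : C).
Variables (gamma : nat -> C) (r : R) (h : nat) (D : {poly C}) (F : C -> C)
  (rho : R) (B : C -> C) (m : nat) (w : C).
Hypothesis r0 : 0 < r.
Hypothesis Fsum : forall z, nrm z < r -> psum gamma z (F z).
Hypothesis D0 : D != 0.
Hypothesis Droots : forall y, root D y -> nrm y = r /\ B y != 0.
Hypothesis rr : r < rho.
Hypothesis gB : gbd (dmul D gamma) rho.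
Hypothesis HB : forall z, nrm z < rho -> psum (dmul D gamma) z (B z).
Hypothesis m0 : (0 < m)%N.
Hypothesis mD : forall y, root D y -> (mup y D <= m)%N.
Hypothesis w_prim : h.-primitive_root w.
Variable N0 : nat.
Hypothesis gamma_neq0 : forall n, (N0 <= n)%N -> gamma n != 0.
Hypothesis ratio : forall eps : R, 0 < eps -> exists N, forall n, (N <= n)%N ->
     nrm (gamma n.-1 / gamma n - a1 gamma h n%:Z) < eps.
Hypothesis a1_neq0 : forall e, a1 gamma h e != 0.

Let h0 : (0 < h)%N := prim_order_gt0 w_prim.
Let w1 : nrm w = 1 := prim_root_nrm w_prim.
Let w0 : w != 0.
Proof. by rewrite -nrm_gt0 w1. Qed.

Definition sn n : C := inC n.+2%:R^-1.

Lemma tnE n : tn R n = 1 - sn n.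
Proof. by rewrite /tn /sn inCB inC1. Qed.

Lemma sn_neq0 n : sn n != 0.
Proof. by rewrite -nrm_gt0 nrm_inC ger0_norm ?harm_gt0// ltW// harm_gt0. Qed.

Lemma sn_cvg : sn @ \oo --> (0 : C).
Proof.
apply: (@cvgC0_le _ _ (fun n => n.+2%:R^-1)); first exact: harm_cvg0.
by move=> n; rewrite subr0 nrm_inC ger0_norm// ltW// harm_gt0.
Qed.

Definition rad (f : C -> C) y n := sn n ^+ m * f (tn R n * y).

Lemma wj_nrm j : nrm (w ^+ j) = 1.
Proof. by rewrite nrmX w1 expr1n. Qed.

Lemma gbd_gamma (x : R) : 0 <= x -> x < r -> gbd gamma x.
Proof. by move=> x0 xr; exact: (gbd_disc Fsum x0 xr). Qed.

Lemma B_eq z : nrm z < r -> B z = D.[z] * F z.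
Proof.
move=> zr; have z0 := nrm_ge0 z; pose x := (nrm z + r) / 2.
have x0 : 0 <= x by rewrite /x; lra.
have xr : x < r by rewrite /x; lra.
have zx : nrm z < x by rewrite /x; lra.
apply: (psum_unique (HB (lt_trans zr rr))).
exact: (psum_conv (gbd_poly D x0) (gbd_gamma x0 xr) zx (@psum_poly _ D z) (Fsum zr)).
Qed.

Lemma B_analytic x : nrm x < rho -> analytic_at B x.
Proof. exact: (psum_analytic gB HB). Qed.

Lemma D_disc z : nrm z < r -> D.[z] != 0.
Proof.
move=> zr; apply/negP => rz; have [E _] := Droots rz; by move: zr; rewrite E ltxx.
Qed.

Lemma mup_le y : (mup y D <= m)%N.
Proof.
have [/mD//|/mupNroot ->] := boolP (root D y); exact: leq0n.
Qed.

(** Write F = B / D and D = q (X - y)^k. As t y - y = -(1 - t) y, the factor (1 - t)^m leaves (1 -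
    t)^(m - k) times a function with limit (-y)^(-k) B(y) / q(y). *)
Lemma rad_F_cvg y : nrm y = r -> exists l, rad F y @ \oo --> l /\ (l != 0 <-> mup y D = m).
Proof.
move=> yr; have [q qy E] := mup_factor y D0; set k := mup y D in E *.
have km : (k <= m)%N := mup_le y.
have y0 : y != 0 by rewrite -nrm_gt0 yr.
have yrho : nrm y < rho by rewrite yr.
have tnr n : nrm (tn R n * y) < r by rewrite -yr tn_lt// yr.
have radE n : rad F y n = sn n ^+ (m - k) * ((- y) ^- k * (B (tn R n * y) / q.[tn R n * y])).
  have Dn := D_disc (tnr n); rewrite B_eq// /rad.
  have ED : D.[tn R n * y] = q.[tn R n * y] * (sn n ^+ k * (- y) ^+ k).
    rewrite E hornerM horner_exp hornerXsubC -exprMn; congr (_ * _ ^+ k); rewrite tnE; ring.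
  have qn : q.[tn R n * y] != 0 by apply: contra Dn => /eqP qn; rewrite ED qn mul0r.
  rewrite -[in LHS](subnK km) exprD ED.
  have alg (K : fieldType) (a b c f d : K) : b != 0 -> d != 0 ->
      c * a * f = c * (b^-1 * (d * (a * b) * f / d)).
    by move=> *; field; apply/andP.
  by apply: alg; rewrite ?expf_neq0// oppr_eq0.
have lim1 : (fun n => (- y) ^- k * (B (tn R n * y) / q.[tn R n * y])) @ \oo --> (- y) ^- k * (B y / q.[y]).
  apply: cvgCM; first exact: cvgC_cst.
  apply: cvgCM; first exact: (analytic_tn (B_analytic yrho)).
  apply: cvgCV; first exact: qy.
  exact: (analytic_tn (@analytic_horner _ q y)).
have -> : rad F y = fun n => sn n ^+ (m - k) * ((- y) ^- k * (B (tn R n * y) / q.[tn R n * y])).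
  by apply/funext.
have [km'|km'] := eqVneq k m.
  exists ((- y) ^- k * (B y / q.[y])); split.
    rewrite km' subnn; under eq_fun do rewrite expr0 mul1r; rewrite km' in lim1; exact: lim1.
  (* Since m > 0, multiplicity [m] makes [y] a root of [D], where [B] does not vanish. *)
  split=> // _; have yD : root D y by rewrite -[root _ _]negbK; apply/negP => /mupNroot kk; move: m0; rewrite -km' /k kk.
  have [_ By] := Droots yD.
  by rewrite !mulf_neq0 ?invr_neq0 ?expf_neq0 ?oppr_eq0.
exists 0; split; last by rewrite eqxx; split => // kk; rewrite kk eqxx in km'.
have mk : (0 < m - k)%N by rewrite subn_gt0 ltn_neqAle km'.
have -> : 0 = 0 * ((- y) ^- k * (B y / q.[y])) :> C by rewrite mul0r.
apply: cvgCM; last exact: lim1.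
have -> : 0 = 0 ^+ (m - k) :> C by rewrite expr0n -leqn0 leqNgt mk.
by apply: cvgCX; exact: sn_cvg.
Qed.

Definition lead y : C := lim (rad F y @ \oo).

Lemma lead_cvg y : nrm y = r -> rad F y @ \oo --> lead y.
Proof.
move=> /rad_F_cvg[l [Hl _]]; rewrite /lead (cvg_lim _ Hl); [exact: Hl|exact: norm_hausdorff].
Qed.

Lemma lead_neq0 y : nrm y = r -> lead y != 0 <-> mup y D = m.
Proof.
move=> /rad_F_cvg[l [Hl H]]; rewrite /lead (cvg_lim _ Hl); [exact: H|exact: norm_hausdorff].
Qed.

(** The root-of-unity filter for T^[e]P, applied to [F] rather than to the series so that it also
    makes sense outside the disc; [tlead] is the same filter applied to the radial limits. *)
Definition tfun e z : C := h%:R^-1 * \sum_(j < h) (w ^- (e * j)) * F (w ^+ j * z).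

Definition tlead e y : C := h%:R^-1 * \sum_(j < h) (w ^- (e * j)) * lead (w ^+ j * y).

Let hC : h%:R != 0 :> C.
Proof. by rewrite pnatr_eq0 -lt0n. Qed.

Lemma tlead_cvg e y : nrm y = r -> rad (tfun e) y @ \oo --> tlead e y.
Proof.
move=> yr.
have -> : rad (tfun e) y = fun n => h%:R^-1 * \sum_(j < h) (w ^- (e * j)) * rad F (w ^+ j * y) n.
  apply/funext => n; rewrite /rad /tfun mulrCA mulr_sumr; congr (_ * _); apply: eq_bigr => j _.
  by rewrite mulrCA [w ^+ j * (_ * y)]mulrCA.
apply: cvgCM; first exact: cvgC_cst.
apply: (@cvg_sumC _ _ _ _ _ (fun j n => w ^- (e * j) * rad F (w ^+ j * y) n)) => j.
apply: cvgCM; first exact: cvgC_cst.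
by apply: lead_cvg; rewrite nrmM wj_nrm mul1r.
Qed.

Lemma sum_w (x : C) : x ^+ h = 1 -> h%:R^-1 * \sum_(j < h) x ^+ j = (x == 1)%:R.
Proof.
by move=> xh; rewrite root_unity_sum//; case: eqVneq => _; rewrite ?mulVf// mulr0.
Qed.

Lemma wX_eq1 n : (w ^+ n) ^+ h = 1.
Proof. by rewrite exprAC (prim_expr_order w_prim) expr1n. Qed.

Lemma class_w n e : ((n%:Z == e%:Z %[mod h%:Z])%Z) = (w ^+ n / w ^+ e == 1).
Proof.
rewrite (can2_eq (divfK (expf_neq0 e w0)) (mulfK (expf_neq0 e w0))) mul1r.
by rewrite (eq_prim_root_expr w_prim) !modz_nat.
Qed.

Lemma tfun_psum e z : nrm z < r -> psum (Tpart gamma h e%:Z) z (tfun e z).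
Proof.
move=> zr; have H (j : 'I_h) : psum (fun n => w ^- (e * j) * (gamma n * (w ^+ j) ^+ n)) z (w ^- (e * j) * F (w ^+ j * z)).
  apply: psum_scale; have := @Fsum (w ^+ j * z); rewrite nrmM wj_nrm mul1r => /(_ zr).
  rewrite /psum; under eq_fun do rewrite exprMn mulrA; exact.
have {H} := psum_scale (t := h%:R^-1) (psum_sum (r := index_enum 'I_h) H).
apply: eq_psum => n; rewrite /Tpart class_w.
rewrite (eq_bigr (fun j : 'I_h => gamma n * (w ^+ n / w ^+ e) ^+ j)); last first.
  move=> j _; rewrite mulrCA; congr (_ * _).
  by rewrite expr_div_n -!exprM mulrC [(j * n)%N]mulnC.
rewrite -mulr_sumr mulrCA sum_w; last by rewrite expr_div_n !wX_eq1 divr1.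
by case: ifP => _; rewrite ?mulr1 ?mulr0.
Qed.

(** The classes are listed downwards from [e], the order in which the coefficients of A^[e] arise;
    adding [h] prevents truncated subtraction. *)
Lemma lead_sum e y : \sum_(j < h) tlead (e + h - j) y = lead y.
Proof.
rewrite /tlead -mulr_sumr exchange_big /=.
pose j0 := Ordinal h0.
rewrite (bigD1 j0) //= [X in _ + X]big1 ?addr0 => [|j jn].
  under eq_bigr do rewrite muln0 expr0 invr1 !mul1r.
  by rewrite sumr_const card_ord -[lead y *+ h]mulr_natl mulKf.
rewrite -mulr_suml (eq_bigr (fun i : 'I_h => w ^- ((e + h) * j) * (w ^+ j) ^+ i)); last first.
  move=> i _; rewrite mulnBl expfB_cond ?(negPf w0) ?add0n; last first.
    by rewrite leq_mul2r orbC (leq_trans (ltnW (ltn_ord i)) (leq_addl _ _)).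
  by rewrite invf_div mulrC -exprM [(j * i)%N]mulnC.
rewrite -mulr_sumr root_unity_sum ?wX_eq1//.
have -> : (w ^+ j == 1) = false; last by rewrite mulr0 mul0r.
apply/negbTE; apply: contra jn; rewrite -(expr0 w) (eq_prim_root_expr w_prim) /eqn mod0n modn_small//.
Qed.

Lemma tlead_per e y : tlead (e + h) y = tlead e y.
Proof.
rewrite /tlead; congr (_ * _); apply: eq_bigr => j _; rewrite mulnDl exprD.
by rewrite [w ^+ (h * j)]exprM (prim_expr_order w_prim) expr1n mulr1.
Qed.

Lemma tfun_rot e z : nrm z < r -> tfun e (w * z) = w ^+ e * tfun e z.
Proof.
move=> zr; have wz : nrm (w * z) < r by rewrite nrmM w1 mul1r.
apply: (psum_unique (z := z) (a := fun n => w ^+ e * Tpart gamma h e%:Z n)); last exact: (psum_scale (tfun_psum (e := e) zr)).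
have := tfun_psum (e := e) wz; rewrite /psum.
suff -> : (fun n => Tpart gamma h e n * (w * z) ^+ n) = (fun n => w ^+ e * Tpart gamma h e n * z ^+ n) by [].
apply/funext => n; rewrite exprMn mulrA; congr (_ * _); rewrite /Tpart class_w.
case: ifP => [/eqP H|_]; last by rewrite mulr0 mul0r.
by rewrite mulrC -[w ^+ n](divfK (expf_neq0 e w0)) H mul1r.
Qed.

Lemma tlead_rot e y : nrm y = r -> tlead e (w * y) = w ^+ e * tlead e y.
Proof.
move=> yr; have wy : nrm (w * y) = r by rewrite nrmM w1 mul1r.
apply: (@cvg_unique _ (@norm_hausdorff _ C) (rad (tfun e) (w * y) @ \oo)); first exact: tlead_cvg.
have -> : rad (tfun e) (w * y) = fun n => w ^+ e * rad (tfun e) y n.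
  apply/funext => n; have tr : nrm (tn R n * y) < r by rewrite -yr tn_lt ?yr.
  have E : tn R n * (w * y) = w * (tn R n * y) by exact: mulrCA.
  rewrite /rad E (tfun_rot e tr); exact: mulrCA.
by apply: cvgCM; [exact: cvgC_cst|exact: tlead_cvg].
Qed.

Lemma tlead_rotX e i y : nrm y = r -> tlead e (w ^+ i * y) = w ^+ (e * i) * tlead e y.
Proof.
move=> yr; elim: i => [|i IH]; first by rewrite muln0 !expr0 !mul1r.
by rewrite exprS -mulrA tlead_rot ?nrmM ?wj_nrm ?mul1r// IH mulnS exprD mulrA.
Qed.

Lemma psum_mulX a z s : psum a z s -> psum (fun n => if n is k.+1 then a k else 0) z (z * s).
Proof.
move=> H; have H1 : series (fun n => (a n * z ^+ n) * z) @ \oo --> z * s.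
  have -> : series (fun n => (a n * z ^+ n) * z) = fun n => z * series (fun n => a n * z ^+ n) n.
    by apply/funext => n; rewrite /series /= -mulr_suml mulrC.
  by apply: cvgCM; [exact: cvgC_cst|exact: H].
have := shift_series 1%N H1; rewrite /psum.
suff -> : (fun n => if (1 <= n)%N then a (n - 1)%N * z ^+ (n - 1) * z else 0) =
  (fun n => (if n is k.+1 then a k else 0) * z ^+ n) by [].
by apply/funext => -[|n]; rewrite /= ?mul0r// subn1 /= exprSr mulrA.
Qed.

(** The coefficients of t T^[e]P - a_1 T^[e+1]P: zero outside the class e + 1, and gamma_(n-1) - a_1
    gamma_n at n >= 1 in it. *)
Definition udiff e n : C :=
  (if n is k.+1 then Tpart gamma h e%:Z k else 0) - a1 gamma h e.+1%:Z * Tpart gamma h e.+1%:Z n.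

Lemma udiff_psum e z : nrm z < r ->
  psum (udiff e) z (z * tfun e z - a1 gamma h e.+1%:Z * tfun e.+1 z).
Proof.
move=> zr.
exact: (psum_add (psum_mulX (tfun_psum (e := e) zr)) (psum_opp (psum_scale (tfun_psum (e := e.+1) zr)))).
Qed.

Lemma class_succ k e : ((k.+1%:Z == e.+1%:Z %[mod h%:Z])%Z) = (k%:Z == e%:Z %[mod h%:Z])%Z.
Proof. by rewrite -(addn1 k) -(addn1 e) !PoszD eqz_modDr. Qed.

Lemma udiff_small e (eps : R) : 0 < eps -> exists N, forall n, (N <= n)%N ->
  nrm (udiff e n) <= eps * nrm (gamma n).
Proof.
move=> e0; have [N HN] := ratio e0; exists (maxn N (maxn N0 1)) => n.
rewrite !geq_max => /and3P[n1 n2]; case: n n1 n2 => // k n1 n2 _.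
rewrite /udiff /Tpart class_succ; case: ifP => [/eqP ke|_]; last first.
  by rewrite mulr0 subrr nrm0 mulr_ge0 ?nrm_ge0// ltW.
have gk := gamma_neq0 n2.
have ke' : (k.+1%:Z = e.+1%:Z %[mod h%:Z])%Z by apply/eqP; rewrite class_succ; apply/eqP.
rewrite -(a1_mod gamma ke') -[X in nrm (X - _)](divfK gk) -mulrBl nrmM.
by apply: ler_wpM2r; [exact: nrm_ge0|exact: (ltW (HN _ n1))].
Qed.

Lemma gamma_growth : exists K : R, forall (x : R) N, 0 <= x -> x < r -> psnorm gamma x N * (r - x) ^+ m <= K.
Proof.
have [K HK] := gbd_abs gB (ltW r0) rr.
apply: (@pole_bound _ D m r (dmul D gamma) K r0 D0) => //.
by move=> y yD; split; [exact: (Droots yD).1|exact: mD].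
Qed.

(* The Abelian step: since gamma_(n-1) - a1 gamma_n is o(gamma_n), the
   combination below has a pole of order less than m at every point of the circle. *)
Lemma tlead_rec e y : nrm y = r -> y * tlead e y = a1 gamma h e.+1%:Z * tlead e.+1 y.
Proof.
move=> yr; set al := a1 gamma h _.
pose Delta := y * tlead e y - al * tlead e.+1 y.
apply/eqP; rewrite -subr_eq0 -/Delta -nrm_eq0; apply/eqP/le_anti; rewrite nrm_ge0 andbT.
have y0 : 0 < nrm y by rewrite yr.
pose v n := sn n ^+ m * ((tn R n * y) * tfun e (tn R n * y) - al * tfun e.+1 (tn R n * y)).
have vcvg : v @ \oo --> Delta.
  have -> : v = fun n => (tn R n * y) * rad (tfun e) y n - al * rad (tfun e.+1) y n.
    apply/funext => n; rewrite /v /rad mulrBr; congr (_ - _); exact: mulrCA.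
  apply: cvgCB; apply: cvgCM.
  - exact: tn_cvg.
  - exact: tlead_cvg.
  - exact: cvgC_cst.
  - exact: tlead_cvg.
have [K HK] := gamma_growth.
have K0 : 0 <= K by have := HK 0 0%N (lexx _) r0; rewrite /psnorm big_ord0 mul0r.
have rm : 0 < r ^+ m by exact: exprn_gt0.
have bound (eps : R) : 0 < eps -> nrm Delta <= eps * (2 + K / r ^+ m).
  move=> e0; have [N HN] := udiff_small e e0.
  pose CN := \sum_(k < N.+1) nrm (udiff e k) * r ^+ k.
  have CN0 : 0 <= CN by apply: sumr_ge0 => k _; rewrite mulr_ge0 ?nrm_ge0// exprn_ge0// ltW.
  (* The coefficients up to [N] contribute at most [CN], damped by s^m <= s because m > 0. The
     others are at most [eps] times the majorant of gamma, which is at most K / (s r)^m since r - x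
     = s r. *)
  have vb n : nrm (v n) <= n.+2%:R^-1 * CN + eps * (K / r ^+ m).
    have s0 := @harm_gt0 R n; have s1 := @harm_lt1 R n; set s : R := n.+2%:R^-1 in s0 s1 *.
    have sm : 0 < s ^+ m by exact: exprn_gt0.
    pose x := (1 - s) * r.
    have x0 : 0 <= x by rewrite /x mulr_ge0//; [lra|exact: ltW].
    have xr : x < r by rewrite /x gtr_pMl//; lra.
    have zx : nrm (tn R n * y) = x by rewrite tn_nrm yr.
    have rx : r - x = s * r by rewrite /x; ring.
    rewrite /v nrmM nrmX nrm_inC gtr0_norm// -/s.
    have zr : nrm (tn R n * y) < r by rewrite zx.
    have := @series_cvg_nrm_le _ _ (CN + eps * (K / (r - x) ^+ m)) _ _ (udiff_psum (e := e) zr).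
    rewrite -/al => /(_ _) H.
    apply: le_trans (_ : s ^+ m * (CN + eps * (K / (r - x) ^+ m)) <= _).
      apply: ler_wpM2l; first exact: ltW.
      apply: H => M.
      apply: le_trans (_ : \sum_(k < M) ((if (k <= N)%N then nrm (udiff e k) * r ^+ k else 0) + eps * (nrm (gamma k) * x ^+ k)) <= _).
        apply: ler_sum => k _; rewrite nrmM nrmX zx.
        have gx : 0 <= eps * (nrm (gamma k) * x ^+ k) by rewrite !mulr_ge0 ?nrm_ge0 ?exprn_ge0// ltW.
        case: leqP => kN.
          apply: le_trans (_ : nrm (udiff e k) * r ^+ k <= _); last by rewrite lerDl.
          apply: ler_wpM2l; first exact: nrm_ge0.
          by apply: lerXn2r; rewrite ?nnegrE// ltW.
        rewrite add0r mulrA; apply: ler_wpM2r; first exact: exprn_ge0.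
        by apply: HN; exact: ltnW.
      rewrite big_split /=; apply: lerD.
        apply: (@trunc_sum_le _ (fun k => nrm (udiff e k) * r ^+ k)) => k.
        by rewrite mulr_ge0 ?nrm_ge0// exprn_ge0// ltW.
      rewrite -mulr_sumr; apply: ler_wpM2l; first exact: ltW.
      rewrite ler_pdivlMr; first exact: HK.
      by rewrite exprn_gt0// subr_gt0.
    rewrite mulrDr; apply: lerD.
      apply: ler_wpM2r => //; rewrite -[leRHS]expr1.
      by apply: ler_wiXn2l => //; exact: ltW.
    rewrite rx exprMn le_eqVlt; apply/orP; left; apply/eqP; field.
    by rewrite !lt0r_neq0.
  have /cvgnC/(_ _ e0)[N1 HN1] := vcvg.
  have : (fun n => n.+2%:R^-1 * CN) @ \oo --> (0 * CN).
    by apply: cvgM; [exact: harm_cvg0|exact: cvg_cst].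
  rewrite mul0r => /cvgrPdist_lt/(_ _ e0)[N2 _ HN2].
  pose n := maxn N1 N2.
  have h1 := HN1 n (leq_maxl _ _).
  have := HN2 n (leq_maxr _ _); rewrite /= sub0r normrN => h2.
  have h3 := le_lt_trans (ler_norm _) h2.
  have h4 := vb n.
  have h5 := nrmBB Delta (v n); rewrite nrmB in h5.
  have -> : eps * (2 + K / r ^+ m) = eps + eps + eps * (K / r ^+ m) by ring.
  move: h1 h3 h4 h5; move: (_ * CN) (eps * (K / _)) (nrm (v n - _)) (nrm (v n)) (nrm Delta) => *; lra.
have K2 : 0 < 2 + K / r ^+ m by have : 0 <= K / r ^+ m; [exact: divr_ge0 K0 (ltW rm)|lra].
rewrite leNgt; apply/negP => Dp.
(* For this value the bound reads [nrm Delta <= nrm Delta / 2]. *)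
have ep : 0 < nrm Delta / (2 + K / r ^+ m) / 2 by rewrite !divr_gt0.
have := bound _ ep; rewrite mulrAC divfK ?lt0r_neq0//; lra.
Qed.

Lemma tlead_back e j y : nrm y = r -> (j <= h)%N ->
  tlead (e + h - j) y = y ^- j * acoef gamma h (e + h)%:Z j * tlead (e + h) y.
Proof.
move=> yr; have y0 : y != 0 by rewrite -nrm_gt0 yr.
elim: j => [|j IH] jh; first by rewrite subn0 expr0 invr1 mul1r /acoef big_geq// mul1r.
have := tlead_rec (e + h - j.+1) yr.
have -> : (e + h - j.+1).+1 = (e + h - j)%N by lia.
move=> H; apply: (mulfI y0); rewrite H IH ?(ltnW jh)// acoefS.
have -> : (e + h)%:Z - j%:Z = (e + h - j)%N%:Z by rewrite subzn//; lia.
rewrite exprSr invfM.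
have alg (K : fieldType) (a b c t u : K) : u != 0 -> a * (b * c * t) = u * (b / u * (c * a) * t).
  by move=> *; field.
exact: alg.
Qed.

Lemma lead_Apoly (e : nat) y : nrm y = r -> lead y = (Apoly gamma h e%:Z).[y^-1] * tlead e y.
Proof.
move=> yr; rewrite -(lead_sum e) -(tlead_per e).
rewrite (@Apoly_mod _ gamma h e%:Z (e + h)%:Z); last by rewrite PoszD modzDr.
rewrite Apoly_horner mulr_suml; apply: eq_bigr => j _.
by rewrite tlead_back ?(ltnW (ltn_ord j))// exprVn [_ * y ^- j]mulrC.
Qed.

(** Going once through all classes multiplies R_e(y) by A_P / y^h. *)
Lemma tlead_AP (e : nat) y : nrm y = r -> tlead e y != 0 -> y ^+ h = AP gamma h.
Proof.
move=> yr t0; have y0 : y != 0 by rewrite -nrm_gt0 yr.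
have := tlead_back e yr (leqnn h); rewrite addnK tlead_per acoef_full// => H.
have := mulIf t0 (etrans (mul1r _) H) => H1.
by rewrite -[LHS]mulr1 H1 mulrA divff ?mul1r// expf_neq0.
Qed.

Hypothesis top_exists : exists y, root D y /\ mup y D = m.

(** The solutions form one orbit under rotation by [w], and this orbit contains a top pole, where no
    R_e vanishes. *)
Lemma AP_roots y : y ^+ h = AP gamma h -> nrm y = r /\ forall e, tlead e y != 0.
Proof.
have [x [xD xm]] := top_exists; have [xr _] := Droots xD.
have x0 : x != 0 by rewrite -nrm_gt0 xr.
have tx e : tlead e x != 0.
  have := (lead_neq0 xr).2 xm; rewrite (lead_Apoly e xr); apply: contra => /eqP ->.
  by rewrite mulr0.
have xh := tlead_AP xr (tx 0%N).
move=> yh; have xy1 : (y / x) ^+ h = 1.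
  by rewrite expr_div_n yh xh divff// -xh expf_neq0.
have [i Hi] := prim_rootP w_prim xy1.
have yE : y = w ^+ i * x by rewrite -Hi divfK.
split; first by rewrite yE nrmM wj_nrm mul1r.
by move=> e; rewrite yE tlead_rotX// mulf_neq0// expf_neq0.
Qed.

Lemma top_pole_iff y (e : int) : (root D y && (mup y D == m)) =
  (y ^+ h == AP gamma h) && ((Apoly gamma h e).[y^-1] != 0).
Proof.
have -> : Apoly gamma h e = Apoly gamma h (crep h e)%:Z.
  by apply/esym/Apoly_mod; exact: crep_mod.
apply/idP/idP.
  move=> /andP[yD /eqP ym]; have [yr _] := Droots yD.
  have := (lead_neq0 yr).2 ym; rewrite (lead_Apoly (crep h e) yr) mulf_eq0 negb_or => /andP[-> t0].
  by rewrite (tlead_AP yr t0) eqxx.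
move=> /andP[/eqP /AP_roots[yr t0] A0].
have ym : mup y D = m.
  by apply/(lead_neq0 yr); rewrite (lead_Apoly (crep h e) yr) mulf_neq0.
rewrite ym eqxx andbT -[root _ _]negbK; apply/negP => /mupNroot ky.
by move: m0; rewrite -ym ky.
Qed.

(** After multiplication by R_(e+1)(y), which is nonzero, both sides equal y R(y). *)
Lemma Apoly_rec (e : nat) y : y ^+ h = AP gamma h ->
  y * (Apoly gamma h e.+1%:Z).[y^-1] = a1 gamma h e.+1%:Z * (Apoly gamma h e%:Z).[y^-1].
Proof.
move=> /AP_roots[yr t0]; apply: (mulIf (t0 e.+1)).
rewrite -mulrA -lead_Apoly// mulrAC -tlead_rec// -mulrA [tlead e y * _]mulrC -lead_Apoly//.
Qed.

Hypothesis HF : meromorphic_continuation gamma r F.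
Hypothesis cF : forall x, nrm x = r -> exists v, meromorphic_value (fun z => D.[z] * F z) x v.

(** The exponent is [m] even where the multiplicity is smaller, so that germs at different rotations
    of [y] can be added. *)
Lemma pole_germ y : nrm y = r -> exists2 g, analytic_at g y & \forall z \near y^', (z - y) ^+ m * F z = g z.
Proof.
move=> yr; have [v [g0 [g0y /dnbhsC[d d0 H] _]]] := cF yr.
have [q qy E] := mup_factor y D0; set k := mup y D in E *.
have km : (k <= m)%N := mup_le y.
exists (fun z => (('X - y%:P) ^+ (m - k)%N).[z] * (g0 z * (q.[z])^-1)).
  apply: analytic_mul; first exact: analytic_horner.
  apply: analytic_mul; first exact: g0y.
  apply: (@analytic_inv _ (fun z => q.[z])); [exact: qy|exact: analytic_horner].
have /cvg_atC qc := analytic_cvg (@analytic_horner _ q y).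
have [|d' d'0 Hq] := qc (nrm q.[y]); first by rewrite nrm_gt0.
apply/dnbhsC; exists (Num.min d d'); first by rewrite lt_min d0.
move=> z; rewrite lt_min => /andP[z1 z2] zy.
have qz : q.[z] != 0 by apply/eqP => q0; have := Hq z z2; rewrite q0 sub0r nrmN ltxx.
rewrite -H// E !hornerM !horner_exp hornerXsubC -[in LHS](subnK km) exprD.
have alg (K : fieldType) (a b c f : K) : c != 0 -> a * b * f = a * (c * b * f * c^-1).
  by move=> *; field.
exact: alg.
Qed.

Lemma tfun_germ e y : nrm y = r -> exists2 g, analytic_at g y & \forall z \near y^', (z - y) ^+ m * tfun e z = g z.
Proof.
move=> yr.
have Hj (j : 'I_h) : exists g, analytic_at g (w ^+ j * y) /\ \forall z \near (w ^+ j * y)^', (z - w ^+ j * y) ^+ m * F z = g z.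
  by have [|g g1 g2] := @pole_germ (w ^+ j * y); [rewrite nrmM wj_nrm mul1r|exists g].
have [g Hg] := choice Hj.
have wn0 j : w ^+ j != 0 by rewrite expf_neq0.
exists (fun z => h%:R^-1 * \sum_(j < h) (w ^- (e * j)) * ((w ^- j) ^+ m * g j (w ^+ j * z))).
  apply: analytic_mul; first exact: analytic_cst.
  have gen (rs : seq 'I_h) : analytic_at (fun z => \sum_(j <- rs) w ^- (e * j) * (w ^- j ^+ m * g j (w ^+ j * z))) y.
    elim: rs => [|j rs IH].
      by apply: (@analytic_eqfun _ (fun=> 0)); [move=> z; rewrite big_nil|exact: analytic_cst].
    apply: (@analytic_eqfun _ (fun z => w ^- (e * j) * (w ^- j ^+ m * g j (w ^+ j * z)) + \sum_(j <- rs) w ^- (e * j) * (w ^- j ^+ m * g j (w ^+ j * z)))).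
      by move=> z; rewrite big_cons.
    apply: analytic_add; last exact: IH.
    apply: analytic_mul; first exact: analytic_cst.
    apply: analytic_mul; first exact: analytic_cst.
    apply: (analytic_rot (wj_nrm j)); exact: (Hg j).1.
  exact: gen.
have Hn (j : 'I_h) : exists d : R, 0 < d /\ forall z, nrm (z - y) < d -> z != y -> (w ^+ j * z - w ^+ j * y) ^+ m * F (w ^+ j * z) = g j (w ^+ j * z).
  have /dnbhsC[d d0 H] := (Hg j).2; exists d; split; first exact: d0.
  move=> z z1 z2; apply: H; first by rewrite -mulrBr nrmM wj_nrm mul1r.
  by rewrite (inj_eq (mulfI (wn0 j))).
have [dd Hd] := choice Hn.
have [d d0 dle] := finite_min_gt0 (fun j => (Hd j).1).
apply/dnbhsC; exists d; first exact: d0.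
move=> z z1 z2; rewrite /tfun mulrCA mulr_sumr; congr (_ * _); apply: eq_bigr => j _.
rewrite -((Hd j).2 z)//; last exact: lt_le_trans z1 (dle j).
rewrite -mulrBr exprMn.
have alg (K : fieldType) (a b c f t : K) : b != 0 -> a * (c * f) = c * (b^-1 * (b * a * f)).
  by move=> *; field.
rewrite exprVn; apply: (alg C _ _ _ _ 0); by rewrite expf_neq0.
Qed.

(** The factor comes from t y - y = (1 - t)(-y) on the radius. *)
Lemma germ_value (f : C -> C) g l y : nrm y = r -> analytic_at g y ->
  (\forall z \near y^', (z - y) ^+ m * f z = g z) -> rad f y @ \oo --> l ->
  g y = (- y) ^+ m * l.
Proof.
move=> yr gy /dnbhsC[d d0 H] fl; have y0 : 0 < nrm y by rewrite yr.
apply: (@cvg_unique _ (@norm_hausdorff _ C) ((fun n => g (tn R n * y)) @ \oo)); first exact: analytic_tn.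
have T : (fun n => (- y) ^+ m * rad f y n) @ \oo --> (- y) ^+ m * l.
  by apply: cvgCM; [exact: cvgC_cst|exact: fl].
apply: cvg_trans T; apply: near_eq_cvg.
have /cvgC/(_ _ d0) := @tn_cvg _ y; apply: filterS => n dn.
rewrite -H ?tn_neq// /rad mulrA -exprMn; congr (_ ^+ _ * _); rewrite tnE; ring.
Qed.

Lemma tfun_continuation e : meromorphic_continuation (Tpart gamma h e%:Z) r (tfun e).
Proof.
split.
  move=> z; rewrite nrmE ltc_inC => zr; exact: (tfun_psum (e := e) zr).
have [U [oU Usub HU]] := HF.2.
(* A finite intersection of rotated copies of [U], still containing the rotation-invariant closed
   disc. *)
exists [set z | forall j : 'I_h, U (w ^+ j * z)]; split.
- rewrite openE => z Uz.
  have Hj (j : 'I_h) : exists d : R, 0 < d /\ forall y, nrm (y - z) < d -> U (w ^+ j * y).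
    have : nbhs (w ^+ j * z) U by apply: open_nbhs_nbhs; split; [exact: oU|exact: Uz].
    move=> /nbhsC[d d0 H]; exists d; split; first exact: d0.
    by move=> y yz; apply: H; rewrite -mulrBr nrmM wj_nrm mul1r.
  have [dd Hd] := choice Hj.
  have [d d0 dle] := finite_min_gt0 (fun j => (Hd j).1).
  apply/nbhsC; exists d; first exact: d0.
  move=> y yz j; apply: (Hd j).2; exact: lt_le_trans yz (dle j).
- move=> z; rewrite /= nrmE lec_inC => zr j; apply: Usub.
  by rewrite /= nrmE lec_inC nrmM wj_nrm mul1r.
- move=> z Uz; apply: meromorphic_scale; apply: meromorphic_sum => j.
  apply: meromorphic_scale; apply: (meromorphic_rot (wj_nrm j)); exact: HU.
Qed.

Lemma quotient_valueP (e : nat) x v : root D x -> mup x D = m ->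
  quotient_value gamma r h e%:Z x v <-> v = (Apoly gamma h e%:Z).[x^-1].
Proof.
move=> xD xm; have [xr _] := Droots xD.
have x0 : 0 < nrm x by rewrite xr.
have xn0 : x != 0 by rewrite -nrm_gt0.
have Lx := (lead_neq0 xr).2 xm.
have tx : tlead e x != 0.
  by move: Lx; rewrite (lead_Apoly e xr); apply: contra => /eqP ->; rewrite mulr0.
have AE : (Apoly gamma h e%:Z).[x^-1] = lead x / tlead e x by rewrite (lead_Apoly e xr) mulfK.
split.
  (* Any two continuations agree with [F] and [tfun e] inside the disc, so the radial limit forces
     the value. *)
  move=> [F' [G' [[HF' _] [HG' _] Hv]]].
  have tr n : nrm (tn R n * x) < r by rewrite -xr tn_lt.
  apply: (meromorphic_value_radial x0 Hv (u := fun n => rad F x n / rad (tfun e) x n)).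
    move=> n; rewrite /rad invfM mulrACA divff ?mul1r ?expf_neq0 ?sn_neq0//.
    have trC : `|tn R n * x| < inC r by rewrite nrmE ltc_inC.
    congr (_ / _); first exact: psum_unique (HF' _ trC) (Fsum (tr n)).
    exact: psum_unique (HG' _ trC) (tfun_psum (e := e) (tr n)).
  rewrite AE; apply: cvgCM; first exact: lead_cvg.
  by apply: cvgCV; [exact: tx|exact: tlead_cvg].
move=> ->; exists F, (tfun e); split; [exact: HF|exact: tfun_continuation|].
have [f1 f1x Hf1] := pole_germ xr; have [g1 g1x Hg1] := tfun_germ e xr.
have Ef := germ_value xr f1x Hf1 (lead_cvg xr).
have Eg := germ_value xr g1x Hg1 (@tlead_cvg e x xr).
have cancel (K : fieldType) (c a b : K) : c != 0 -> (c * a) / (c * b) = a / b.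
  by move=> c0; rewrite invfM mulrACA divff// mul1r.
exists (fun z => f1 z * (g1 z)^-1); split.
- apply: analytic_mul; first exact: f1x.
  by apply: analytic_inv; [rewrite Eg mulf_neq0// expf_neq0// oppr_eq0|exact: g1x].
- have nz : x^' (fun z => z != x) by apply/dnbhsC; exists 1.
  move: Hf1 Hg1 nz; apply: filterS3 => z <- <- zx.
  by apply/esym/cancel; rewrite expf_neq0// subr_eq0.
- by rewrite Ef Eg AE; apply: cancel; rewrite expf_neq0// oppr_eq0.
Qed.

End RadialLimits.

(** * Roots of unity and the opposite denominator *)

Section RootsOfUnityAlgebra.
Variable K : fieldType.
Implicit Types (x y z : K) (A p q g : {poly K}) (s tp : seq K).

(** The reversal of the monic polynomial with roots [s], normalized by constant term 1 like
    [delta]. *)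
Definition rpoly s : {poly K} := \prod_(y <- s) (1 - y *: 'X).

Lemma rpoly_horner s z : (rpoly s).[z] = \prod_(y <- s) (1 - y * z).
Proof. by rewrite /rpoly horner_prod; apply: eq_bigr => y _; rewrite !hornerE. Qed.

Lemma rpoly_rev s (t : K) : t != 0 ->
  t ^+ size s * (rpoly s).[t^-1] = (\prod_(y <- s) ('X - y%:P)).[t].
Proof.
move=> t0; rewrite rpoly_horner horner_prod; elim: s => [|y s IH]; first by rewrite !big_nil mulr1.
rewrite !big_cons -IH exprS mulrACA hornerXsubC; congr (_ * _).
by rewrite mulrBr mulr1 mulrCA divff// mulr1.
Qed.

Lemma rpoly_coef0 s : (rpoly s)`_0 = 1.
Proof. by rewrite -horner_coef0 rpoly_horner big1 // => y _; rewrite mulr0 subr0. Qed.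

Lemma rpoly_root s z : root (rpoly s) z = has (fun y => y * z == 1) s.
Proof.
rewrite /root rpoly_horner; elim: s => [|y s IH]; first by rewrite big_nil oner_eq0.
by rewrite big_cons mulf_eq0 IH subr_eq0 eq_sym.
Qed.

Lemma rpoly_eqp s : all (fun y => y != 0) s -> rpoly s %= \prod_(y <- s) ('X - (y^-1)%:P).
Proof.
elim: s => [|y s IH] /=; first by rewrite /rpoly !big_nil eqpxx.
move=> /andP[y0 s0]; rewrite /rpoly !big_cons; have -> : 1 - y *: 'X = - y *: ('X - (y^-1)%:P) :> {poly K}.
  have E : y *: (y^-1)%:P = 1 :> {poly K} by rewrite -mul_polyC -polyCM mulfV.
  by rewrite scaleNr scalerBr opprB E.
apply: eqp_trans (eqp_mulr _ (eqp_scale _ _)) (eqp_mull _ (IH s0)); by rewrite oppr_eq0.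
Qed.

Lemma rpoly_size s : all (fun y => y != 0) s -> size (rpoly s) = (size s).+1.
Proof.
move=> s0; rewrite (eqp_size (rpoly_eqp s0)).
by rewrite -(big_map (fun y => y^-1) predT (fun z => 'X - z%:P)) size_prod_XsubC size_map.
Qed.

Lemma eqp_coef0 p q : p %= q -> p`_0 = 1 -> q`_0 = 1 -> p = q.
Proof.
move=> /eqpP[[a b] /= /andP[a0 b0] E] p1 q1.
have /(congr1 (fun p : {poly K} => p`_0)) := E; rewrite !coefZ p1 q1 !mulr1 => ab.
by apply: (scalerI a0); rewrite E ab.
Qed.

Lemma rpoly_perm s tp : perm_eq s tp -> rpoly s = rpoly tp.
Proof. exact: perm_big. Qed.

Variables (h : nat) (w x0 : K).
Hypothesis w_prim : h.-primitive_root w.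
Hypothesis x0_neq0 : x0 != 0.
Hypothesis h_neq0 : h%:R != 0 :> K.

Let h0 : (0 < h)%N := prim_order_gt0 w_prim.

Let w0 : w != 0.
Proof.
apply/eqP => w0; have := prim_expr_order w_prim; rewrite w0 expr0n.
by rewrite -[h == 0]negbK -lt0n h0 => /eqP; rewrite eq_sym oner_eq0.
Qed.

Definition hroots : seq K := [seq w ^+ i * x0 | i <- index_iota 0 h].

Lemma mem_hroots y : (y \in hroots) = (y ^+ h == x0 ^+ h).
Proof.
apply/mapP/eqP => [[i _ ->]|yh].
  by rewrite exprMn exprAC (prim_expr_order w_prim) expr1n mul1r.
have xy1 : (y / x0) ^+ h = 1 by rewrite expr_div_n yh divff// expf_neq0.
have [i Hi] := prim_rootP w_prim xy1; exists (val i); last by rewrite -Hi divfK.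
by rewrite mem_index_iota /= ltn_ord.
Qed.

Lemma hroots_neq0 : all (fun y => y != 0) hroots.
Proof. by apply/allP => _ /mapP[i _ ->]; rewrite mulf_neq0// expf_neq0. Qed.

Lemma hroots_uniq : uniq hroots.
Proof.
rewrite map_inj_in_uniq ?iota_uniq// => i j; rewrite !mem_index_iota /= => ih jh.
move=> /(mulIf x0_neq0)/eqP; rewrite (eq_prim_root_expr w_prim) /eqn !modn_small//.
by move=> /eqP.
Qed.

Lemma hroots_sum k j : \sum_(y <- hroots) y ^+ k / y ^+ j =
  if k == j %[mod h] then h%:R * (x0 ^+ k / x0 ^+ j) else 0.
Proof.
rewrite big_map big_mkord.
rewrite (eq_bigr (fun i : 'I_h => (x0 ^+ k / x0 ^+ j) * (w ^+ k / w ^+ j) ^+ i)); last first.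
  move=> i _; rewrite expr_div_n -!exprM !exprMn -!exprM invfM mulrACA mulrC.
  by rewrite [(k * i)%N]mulnC [(j * i)%N]mulnC.
rewrite -mulr_sumr root_unity_sum; last first.
  by rewrite expr_div_n !(exprAC _ _ h) (prim_expr_order w_prim) !expr1n divr1.
have -> : (w ^+ k / w ^+ j == 1) = (k == j %[mod h]).
  by rewrite (can2_eq (divfK (expf_neq0 j w0)) (mulfK (expf_neq0 j w0))) mul1r (eq_prim_root_expr w_prim).
by case: ifP => _; rewrite ?mulr0// mulrC.
Qed.

Lemma rpoly_hroots : rpoly hroots = 1 - x0 ^+ h *: 'X^h.
Proof.
have E0 : (1 - x0 ^+ h *: 'X^h : {poly K})`_0 = 1.
  by rewrite coefB coef1 coefZ coefXn /= eq_sym -[h == 0]negbK -lt0n h0 mulr0 subr0.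
apply: eqp_coef0; [|exact: rpoly_coef0|exact: E0].
apply: eqp_trans (rpoly_eqp hroots_neq0) _.
rewrite -(big_map (fun y => y^-1) predT (fun z => 'X - z%:P)).
have sE : size (1 - x0 ^+ h *: 'X^h : {poly K}) = h.+1.
  rewrite -opprB size_opp size_addl size_scale ?expf_neq0// size_polyXn//.
  by rewrite size_opp size_poly1 ltnS.
have rall : all (root (1 - x0 ^+ h *: 'X^h)) [seq y^-1 | y <- hroots].
  apply/allP => z /mapP[y]; rewrite mem_hroots => /eqP yh ->.
  by rewrite /root !hornerE exprVn -yh divff ?subrr// yh expf_neq0.
have runiq : uniq_roots [seq y^-1 | y <- hroots].
  by rewrite uniq_rootsE map_inj_uniq ?hroots_uniq//; exact: invr_inj.
rewrite [X in _ %= X](all_roots_prod_XsubC _ rall runiq); last first.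
  by rewrite sE !size_map size_iota subn0.
rewrite eqp_sym; apply: eqp_scale; rewrite lead_coef_eq0 -size_poly_eq0 sE//.
Qed.

(** The roots 1/y of [E] are simple. Split the y by whether A(1/y) vanishes: one factor of [E]
    divides [A], the other is coprime to it, so the gcd is the first factor and the quotient the
    second. *)
Lemma quotient_gcd A tp : uniq tp ->
  (forall y, (y \in tp) = (y ^+ h == x0 ^+ h) && (A.[y^-1] != 0)) ->
  let E := 1 - x0 ^+ h *: 'X^h in
  let g := gcdp A E in
  E %/ ((g`_0)^-1 *: g) = rpoly tp.
Proof.
move=> utp Htp E g.
pose s1 := [seq y <- hroots | A.[y^-1] == 0].
pose s2 := [seq y <- hroots | A.[y^-1] != 0].
have hn0 := allP hroots_neq0.
have n1 : all (fun y => y != 0) s1 by apply/allP => y; rewrite mem_filter => /andP[_ /hn0].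
have n2 : all (fun y => y != 0) s2 by apply/allP => y; rewrite mem_filter => /andP[_ /hn0].
have EE : E = rpoly s1 * rpoly s2.
  rewrite /E -rpoly_hroots /rpoly -big_cat /=; apply: perm_big.
  by rewrite perm_sym; apply/permPl; exact: (perm_filterC (fun y => A.[y^-1] == 0)).
have d1 : rpoly s1 %| A.
  rewrite (eqp_dvdl _ (rpoly_eqp n1)) -(big_map (fun y => y^-1) predT (fun z => 'X - z%:P)).
  apply: uniq_roots_dvdp.
    by apply/allP => z /mapP[y]; rewrite mem_filter => /andP[/eqP Ay _] ->; apply/rootP.
  by rewrite uniq_rootsE map_inj_uniq ?filter_uniq ?hroots_uniq//; exact: invr_inj.
have c2 : coprimep A (rpoly s2).
  rewrite (eqp_coprimepr _ (rpoly_eqp n2)) big_seq; elim/big_ind: _ => [|p q cp cq|y].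
  - exact: coprimep1.
  - by rewrite coprimepMr cp cq.
  - by rewrite mem_filter => /andP[Ay _]; rewrite coprimep_XsubC.
have gE : g %= rpoly s1.
  rewrite /g EE; apply: eqp_trans (Gauss_gcdpl _ c2) _.
  by rewrite /eqp dvdp_gcdr dvdp_gcd d1 dvdpp.
have g0 : g`_0 != 0.
  apply/negP => /eqP g0; have : root g 0 by rewrite /root horner_coef0 g0.
  rewrite (eqp_root gE) rpoly_root => /hasP[y _]; by rewrite mulr0 eq_sym oner_eq0.
have -> : (g`_0)^-1 *: g = rpoly s1.
  apply: eqp_coef0; [|by rewrite coefZ mulVf|exact: rpoly_coef0].
  by apply: eqp_trans (eqp_scale _ _) gE; rewrite invr_neq0.
rewrite EE mulKp; last by rewrite -size_poly_eq0 rpoly_size.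
apply: rpoly_perm; apply: uniq_perm => //; first by rewrite filter_uniq// hroots_uniq.
by move=> y; rewrite mem_filter mem_hroots Htp andbC.
Qed.

End RootsOfUnityAlgebra.

(** * Rank and dimension from orthogonality of characters *)

Section TopPoles.
Variable R : realType.
Local Notation C := (Cplx R).
Variables (gamma : nat -> C) (h : nat) (w x0 : C) (d : nat) (x : d.-tuple C).
Hypothesis w_prim : h.-primitive_root w.
Hypothesis x0_neq0 : x0 != 0.
Hypothesis AP_x0 : AP gamma h = x0 ^+ h.
Hypothesis a1_neq0 : forall e, a1 gamma h e != 0.
Hypothesis x_uniq : uniq x.
Hypothesis mem_x : forall (y : C) (e : int), (y \in x) = (y ^+ h == x0 ^+ h) && ((Apoly gamma h e).[y^-1] != 0).
Hypothesis A_rec : forall (e : nat) (y : C), y ^+ h = x0 ^+ h ->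
  y * (Apoly gamma h e.+1%:Z).[y^-1] = a1 gamma h e.+1%:Z * (Apoly gamma h e%:Z).[y^-1].

Let h0 : (0 < h)%N := prim_order_gt0 w_prim.
Let hC : h%:R != 0 :> C.
Proof. by rewrite pnatr_eq0 -lt0n. Qed.

Lemma tnth_root i : tnth x i ^+ h = x0 ^+ h.
Proof. by have := mem_tnth i x; rewrite (mem_x _ 0) => /andP[/eqP]. Qed.

Lemma tnth_neq0 i : tnth x i != 0.
Proof.
apply/eqP => E; have := tnth_root i; rewrite E expr0n -[h == 0%N]negbK -lt0n h0 /= => /esym/eqP.
by rewrite expf_eq0 (negPf x0_neq0) andbF.
Qed.

Lemma tnth_div_eq1 i i' : (tnth x i / tnth x i' == 1) = (i == i').
Proof.
rewrite (can2_eq (divfK (tnth_neq0 i')) (mulfK (tnth_neq0 i'))) mul1r.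
apply/eqP/eqP => [/eqP|-> //]; rewrite !(tnth_nth 0) nth_uniq ?size_tuple// => /eqP.
exact: val_inj.
Qed.

Lemma Apoly_neq0 i (e : int) : (Apoly gamma h e).[(tnth x i)^-1] != 0.
Proof. by have := mem_tnth i x; rewrite (mem_x _ e) => /andP[]. Qed.

Lemma sum_hroots_tuple (G : C -> C) : (forall y, y ^+ h = x0 ^+ h -> y \notin x -> G y = 0) ->
  \sum_(y <- hroots h w x0) G y = \sum_(i < d) G (tnth x i).
Proof.
move=> G0; rewrite -(big_tuple _ _ x predT G) (bigID (fun y => y \in x)) /= [X in _ + X]big1_seq ?addr0; last first.
  by move=> y /andP[yx]; rewrite (mem_hroots w_prim x0_neq0) => /eqP yh; exact: G0.
rewrite -big_filter; apply: perm_big; apply: uniq_perm => //.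
  by rewrite filter_uniq// hroots_uniq.
move=> y; rewrite mem_filter (mem_hroots w_prim x0_neq0).
by case yx: (y \in x) => //; move: yx; rewrite (mem_x _ 0) => /andP[->].
Qed.

(** Fourier inversion over the solutions of y^h = A_P recovers the coefficient of A^[e] at k mod h,
    and y^h = A_P supplies the missing power of A_P. Solutions that are not top poles drop out
    because A^[e](1/y) = 0 there. *)
Lemma acoef_poles (e : int) k :
  acoef gamma h e k = h%:R^-1 * \sum_(i < d) (Apoly gamma h e).[(tnth x i)^-1] * tnth x i ^+ k.
Proof.
rewrite -(@sum_hroots_tuple (fun y => (Apoly gamma h e).[y^-1] * y ^+ k)); last first.
  move=> y yh; rewrite (mem_x _ e) yh eqxx /= negbK => /eqP ->; exact: mul0r.
under eq_bigr do rewrite Apoly_horner mulr_suml.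
rewrite exchange_big /=.
have kh : (k %% h < h)%N by rewrite ltn_mod.
rewrite (bigD1 (Ordinal kh)) //= [X in _ + X]big1 ?addr0 => [|j jk].
  rewrite (eq_bigr (fun y => acoef gamma h e (k %% h) * (y ^+ k / y ^+ (k %% h)))); last first.
    by move=> y _; rewrite exprVn -mulrA; congr (_ * _); exact: mulrC.
  rewrite -mulr_sumr (hroots_sum _ w_prim) modn_mod eqxx acoef_modn// AP_x0.
  have -> : x0 ^+ k / x0 ^+ (k %% h) = (x0 ^+ h) ^+ (k %/ h).
    by rewrite {1}(divn_eq k h) exprD mulfK ?expf_neq0// mulnC exprM.
  by rewrite mulrCA mulKf.
rewrite (eq_bigr (fun y => acoef gamma h e j * (y ^+ k / y ^+ j))); last first.
  by move=> y _; rewrite exprVn -mulrA; congr (_ * _); exact: mulrC.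
rewrite -mulr_sumr (hroots_sum _ w_prim).
have -> : (k == j %[mod h]) = false; last by rewrite mulr0.
apply/negbTE; apply: contra jk; rewrite (modn_small (ltn_ord j)) => /eqP kj.
by apply/eqP/val_inj; rewrite /= kj.
Qed.

(** One step in [e] multiplies A^[e](1/x_i) by a_1 / x_i; the factor a_1 is common to all poles and
    cancels in the ratio. *)
Lemma Apoly_ratio (e : nat) i i' :
  (Apoly gamma h e%:Z).[(tnth x i')^-1] / (Apoly gamma h e%:Z).[(tnth x i)^-1] =
  (Apoly gamma h 0%:Z).[(tnth x i')^-1] / (Apoly gamma h 0%:Z).[(tnth x i)^-1] * (tnth x i / tnth x i') ^+ e.
Proof.
elim: e => [|e IH]; first by rewrite expr0 mulr1.
have step j : (Apoly gamma h e.+1%:Z).[(tnth x j)^-1] = (tnth x j)^-1 * (a1 gamma h e.+1%:Z * (Apoly gamma h e%:Z).[(tnth x j)^-1]).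
  by rewrite -A_rec ?tnth_root// mulKf// tnth_neq0.
have alg (K : fieldType) (u v a b c : K) : u != 0 -> v != 0 -> a != 0 -> c != 0 ->
    (v^-1 * (a * b)) / (u^-1 * (a * c)) = (b / c) * (u / v).
  by move=> *; field; apply/and4P.
rewrite !step alg ?tnth_neq0 ?a1_neq0 ?Apoly_neq0// IH exprSr; exact/esym/mulrA.
Qed.

Definition pole_matrix : 'M[C]_(h, d) := \matrix_(e < h, i < d) (Apoly gamma h e%:Z).[(tnth x i)^-1].

(** An explicit left inverse: by [Apoly_ratio] the sum over [e] is a constant times the sum of the
    powers of x_i / x_i', an h-th root of unity. *)
Lemma pole_matrix_inv i i' :
  \sum_(e < h) (h%:R * pole_matrix e i)^-1 * pole_matrix e i' = (i == i')%:R.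
Proof.
rewrite (eq_bigr (fun e : 'I_h => (h%:R^-1 * ((Apoly gamma h 0%:Z).[(tnth x i')^-1] / (Apoly gamma h 0%:Z).[(tnth x i)^-1])) * (tnth x i / tnth x i') ^+ e)); last first.
  by move=> e _; rewrite !mxE invfM -[RHS]mulrA -Apoly_ratio -[LHS]mulrA; congr (_ * _); exact: mulrC.
rewrite -mulr_sumr root_unity_sum; last first.
  by rewrite expr_div_n !tnth_root divff// expf_neq0.
rewrite tnth_div_eq1.
case: eqVneq => [<-|_]; last by rewrite mulr0.
by rewrite divff ?Apoly_neq0// mulr1 mulVf.
Qed.

Lemma pole_matrix_rank : \rank pole_matrix = d.
Proof.
apply/eqP; rewrite -[_ == _]/(row_full pole_matrix); apply/row_fullP.
exists (\matrix_(i, e) (h%:R * pole_matrix e i)^-1).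
apply/matrixP => i i'; rewrite !mxE -pole_matrix_inv; apply: eq_bigr => e _.
by rewrite [X in X * _]mxE.
Qed.

(** The basis consists of the geometric series of the top poles; [acoef_poles] expresses the
    accumulation points in it, and the left inverse of the pole matrix inverts this. *)
Lemma span_dim : (forall b, Omega gamma b <-> exists e : 'I_h, b = acoef gamma h e%:Z) ->
  has_dim (Cspan (Omega gamma)) d.
Proof.
move=> HO; exists (fun i k => tnth x i ^+ k); split.
(* The extra factor h cancels the 1/h in [acoef_poles]. *)
- move=> i; exists h, (fun e => h%:R * (h%:R * pole_matrix e i)^-1), (fun e => acoef gamma h e%:Z).
  split; first by move=> e; apply/HO; exists e.
  move=> k.
  rewrite (eq_bigr (fun e : 'I_h => \sum_(i' < d) (h%:R * pole_matrix e i)^-1 * pole_matrix e i' * tnth x i' ^+ k)); last first.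
    move=> e _; rewrite acoef_poles mulrACA divff// mul1r.
    by rewrite mulr_sumr; apply: eq_bigr => i' _; rewrite !mxE mulrA.
  rewrite exchange_big /= (bigD1 i) //= [X in _ + X]big1 ?addr0 => [|i' ii'].
    by rewrite -mulr_suml pole_matrix_inv eqxx mul1r.
  by rewrite -mulr_suml pole_matrix_inv eq_sym (negPf ii') mul0r.
- move=> c Hc i.
  (* Pairing the relation with the powers of 1/x_i over one period isolates [c i]. *)
  have : \sum_(k < h) (tnth x i)^-1 ^+ k * (\sum_(j < d) c j * tnth x j ^+ k) = h%:R * c i.
    under eq_bigr do rewrite mulr_sumr.
    rewrite exchange_big /= (bigD1 i) //= [X in _ + X]big1 ?addr0 => [|j ji].
      rewrite (eq_bigr (fun=> c i)); last first.
        by move=> k _; rewrite mulrCA -exprMn mulVf ?tnth_neq0// expr1n mulr1.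
      by rewrite sumr_const card_ord mulr_natl.
    rewrite (eq_bigr (fun k : 'I_h => c j * (tnth x j / tnth x i) ^+ k)); last first.
      by move=> k _; rewrite mulrCA -exprMn [X in X ^+ _]mulrC.
    rewrite -mulr_sumr root_unity_sum; last by rewrite expr_div_n !tnth_root divff// expf_neq0.
    by rewrite tnth_div_eq1 (negPf ji) mulr0.
  rewrite big1 => [/esym/eqP|k _]; last by rewrite Hc mulr0.
  by rewrite mulf_eq0 (negPf hC) /= => /eqP.
- move=> f [n [c [g [Hg Hf]]]].
  have [es Hes] := choice (fun j => (HO (g j)).1 (Hg j)).
  exists (fun i => \sum_(j < n) c j * (h%:R^-1 * (Apoly gamma h (es j)%:Z).[(tnth x i)^-1])) => k.
  rewrite Hf (eq_bigr (fun j : 'I_n => \sum_(i < d) c j * (h%:R^-1 * (Apoly gamma h (es j)%:Z).[(tnth x i)^-1]) * tnth x i ^+ k)); last first.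
    move=> j _; rewrite Hes acoef_poles mulrA mulr_sumr; apply: eq_bigr => i _.
    by rewrite !mulrA.
  by rewrite exchange_big /=; apply: eq_bigr => i _; rewrite mulr_suml.
Qed.

End TopPoles.

(** * Positivity of the radius, top roots and conclusion *)

Section Denominators.
Variable R : realType.
Local Notation C := (Cplx R).

(** The lower bound [u] on the ratios makes |gamma_n| u^n eventually nonincreasing, so the series
    converges at u / 2. *)
Lemma tame_radius_gt0 (gamma : nat -> C) (r : R) : tame gamma -> radius_of_convergence gamma r -> 0 < r.
Proof.
move=> /tame_ratio[u [v [u0 [v0 [N HN]]]]] [_ rad2].
rewrite ltNge; apply/negP => r0.
have gu : gbd gamma u.
  pose M := \sum_(k < N.+1) nrm (gamma k) * u ^+ k.
  have t0 k : 0 <= nrm (gamma k) * u ^+ k by rewrite mulr_ge0 ?nrm_ge0// exprn_ge0// ltW.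
  have small n : (n <= N)%N -> nrm (gamma n) * u ^+ n <= M.
    move=> nN; rewrite /M (bigD1 (Ordinal (nN : (n < N.+1)%N))) //= lerDl.
    by apply: sumr_ge0 => k _.
  exists M => n; have [/small//|Nn] := leqP n N.
  elim: n Nn => // n IH; rewrite ltnS => Nn.
  have {}IH : nrm (gamma n) * u ^+ n <= M.
    by move: Nn; rewrite leq_eqVlt => /orP[/eqP <-|/IH//]; exact: small.
  apply: le_trans IH; have [g0 h1 _] := HN n.+1 (leqW Nn).
  move: h1; rewrite nrmM nrmV /= ler_pdivlMr ?nrm_gt0// => h1.
  rewrite exprS mulrA; apply: ler_wpM2r; first by rewrite exprn_ge0// ltW.
  by rewrite mulrC.
have zE : nrm (inC (u / 2)) = u / 2 by rewrite nrm_inC ger0_norm//; lra.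
apply: (rad2 (inC (u / 2))); first by rewrite nrmE ltc_inC zE; lra.
have [|s Hs] := @gbd_psum _ gamma u (inC (u / 2)) gu; first by rewrite zE; lra.
by apply/cvg_ex; exists s.
Qed.

Lemma mem_distinct_roots (p : {poly C}) z : p != 0 -> (z \in distinct_roots p) = root p z.
Proof.
move=> p0; rewrite mem_undup; case: (closed_field_poly_normal p) => s /= E.
by rewrite [in RHS]E rootZ ?lead_coef_eq0// root_prod_XsubC.
Qed.

Lemma bigmax_seq_attained (T : eqType) (f : T -> nat) (s : seq T) : s != [::] ->
  exists2 x, x \in s & f x = (\max_(y <- s) f y)%N.
Proof.
elim: s => // a s IH _; rewrite big_cons; have [->|/IH[x xs fx]] := eqVneq s [::].
  by exists a; rewrite ?mem_head// big_nil maxn0.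
case: (leqP (f a) (\max_(y <- s) f y)) => _; last by exists a; rewrite ?mem_head.
by exists x; rewrite // inE xs orbT.
Qed.

End Denominators.

(** Quantifying over every class [e0] includes the independence of the opposite denominator from the
    class. The equivalence defining [M] includes that each quotient has a value, the same for all
    continuations. *)
Theorem mainTheorem1 (R : realType) (gamma : nat -> Cplx R) (r : R) (h : nat) :
  tame gamma ->
  radius_of_convergence gamma r ->
  Ct_r r gamma ->
  fra_series gamma h ->
  exists d : nat, has_dim (Cspan (Omega gamma)) d /\
  forall e0 : int,
  let Dtop := top_denom gamma r in
  let Dop := opp_denom gamma h e0 in
  [/\ (size Dtop).-1 = d,
      (size Dop).-1 = d,
      (forall t : Cplx R, t != 0 -> t ^+ d * Dop.[t^-1] = Dtop.[t]) &
      (forall s : Cplx R, s != 0 -> s ^+ d * Dtop.[s^-1] = Dop.[s])]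
  /\
  (forall x : d.-tuple (Cplx R),
     uniq x -> (forall z, (z \in x) = root Dtop z) ->
     (forall z, (z \in [seq y^-1 | y <- x]) = root Dop z) /\
     exists M : 'M[Cplx R]_(h, d),
       [/\ (forall (e : 'I_h) (i : 'I_d) (v : Cplx R),
              quotient_value gamma r h e%:Z (tnth x i) v <-> v = M e i),
           M = \matrix_(e < h, i < d) (Apoly gamma h e%:Z).[(tnth x i)^-1] &
           \rank M = d]).
Proof.
move=> tg rg Cg fg.
have r0 := tame_radius_gt0 tg rg.
have [h0 ratio a1_neq0 HO] := fra_limits tg fg.
have [F [rho [B [[mD sD] HF cF [rr gB HB] Droots]]]] := circle_data r0 rg Cg.
have [u1 [u2 [_ [_ [N0 HN0]]]]] := tame_ratio tg.
have gamma_neq0 n : (N0 <= n)%N -> gamma n != 0 by move=> /HN0[].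
have [w w_prim] := prim_root_ex R h0.
set D := circle_denom gamma r in mD sD cF gB HB Droots.
pose m := (\max_(x <- distinct_roots D) mup x D)%N.
have D0 := monic_neq0 mD.
have memD z := @mem_distinct_roots R D z D0.
have Fsum z : nrm z < r -> psum gamma z (F z).
  by move=> zr; apply: HF.1; rewrite nrmE ltc_inC.
have mup_le y : root D y -> (mup y D <= m)%N.
  by rewrite -memD => yD; exact: leq_bigmax_seq.
have [x0 x0D x0m] : exists2 y, root D y & mup y D = m.
  have [|y yD ym] := @bigmax_seq_attained _ (fun y => mup y D) (distinct_roots D).
    have [|y yD] := closed_rootP D _; first by apply/eqP => sD1; rewrite sD1 in sD.
    by apply/eqP => E; move: (memD y); rewrite yD E.
  by exists y => //; rewrite -memD.
have m0 : (0 < m)%N by rewrite -x0m mup_geq// expr1 dvdp_XsubCl.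
have top_exists : exists y, root D y /\ mup y D = m by exists x0.
have top_iff := top_pole_iff r0 Fsum D0 Droots rr gB HB m0 mup_le w_prim gamma_neq0 ratio a1_neq0 top_exists.
(* A single top pole [x0] yields all solutions of y^h = A_P as its rotations, the form in which the
   algebraic lemmas take [AP]. *)
have APx0 : AP gamma h = x0 ^+ h.
  by have := top_iff x0 0; rewrite x0D x0m eqxx => /esym/andP[/eqP ->].
have x0_neq0 : x0 != 0 by have [x0r _] := Droots x0 x0D; rewrite -nrm_gt0 x0r.
have A_rec (e : nat) y : y ^+ h = x0 ^+ h ->
    y * (Apoly gamma h e.+1%:Z).[y^-1] = a1 gamma h e.+1%:Z * (Apoly gamma h e%:Z).[y^-1].
  rewrite -APx0; exact: (Apoly_rec r0 Fsum D0 Droots rr gB HB m0 mup_le w_prim gamma_neq0 ratio a1_neq0 top_exists).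
pose tp := [seq x <- distinct_roots D | mup x D == m].
have utp : uniq tp by rewrite filter_uniq// undup_uniq.
have mem_tp y : (y \in tp) = root D y && (mup y D == m) by rewrite mem_filter memD andbC.
have mem_tp_iff y (e : int) : (y \in tp) = (y ^+ h == x0 ^+ h) && ((Apoly gamma h e).[y^-1] != 0).
  by rewrite mem_tp (top_iff y e) APx0.
have DtopE : top_denom gamma r = \prod_(x <- tp) ('X - x%:P).
  by rewrite /top_denom /tp big_filter.
have root_top z : root (top_denom gamma r) z = (z \in tp) by rewrite DtopE root_prod_XsubC.
have tp_neq0 : all (fun y => y != 0) tp.
  apply/allP => y; rewrite mem_tp => /andP[yD _]; have [yr _] := Droots y yD.
  by rewrite -nrm_gt0 yr.
exists (size tp); split.
  apply: (@span_dim _ gamma h w x0 _ (in_tuple tp)) => //.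
move=> e0 Dtop Dop.
have DopE : Dop = rpoly tp.
  rewrite /Dop /opp_denom /delta APx0; exact: (quotient_gcd w_prim x0_neq0 utp (fun y => mem_tp_iff y e0)).
split; first split.
- by rewrite /Dtop DtopE size_prod_XsubC.
- by rewrite DopE rpoly_size.
- by move=> t t0; rewrite DopE /Dtop DtopE rpoly_rev.
- move=> s s0; rewrite DopE /Dtop DtopE -[in RHS](invrK s) -rpoly_rev ?invr_eq0// invrK.
  by rewrite exprVn mulVKf// expf_neq0.
move=> x ux Hx.
have Hx' y (e : int) : (y \in x) = (y ^+ h == x0 ^+ h) && ((Apoly gamma h e).[y^-1] != 0).
  by rewrite Hx root_top (mem_tp_iff y e).
split.
  move=> z; rewrite DopE rpoly_root.
  apply/mapP/hasP => [[y yx ->]|[y yt /eqP yz]].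
    have yt : y \in tp by rewrite -root_top -Hx.
    by exists y => //; rewrite mulfV// (allP tp_neq0).
  exists y; first by rewrite Hx root_top.
  by apply: (mulfI (allP tp_neq0 y yt)); rewrite yz mulfV// (allP tp_neq0).
exists (pole_matrix gamma h x); split => //.
- move=> e i v; rewrite mxE.
  have : tnth x i \in tp by rewrite -root_top -Hx mem_tnth.
  rewrite mem_tp => /andP[iD /eqP im].
  exact: (quotient_valueP r0 Fsum D0 Droots rr gB HB m0 mup_le w_prim gamma_neq0 ratio HF cF).
- exact: (pole_matrix_rank w_prim x0_neq0 a1_neq0 ux Hx' A_rec).
Qed.
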